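(* (Work in $\mathsf{ZF}$.) Let $\mathfrak F$ be the least class of ideals such that $\mathrm{Fin}\in\mathfrak F$ and $\mathfrak F$ is closed under Fubini sums over $\mathrm{Fin}$. Suppose that (i) $\mathsf{DC}_{\mathbb R}$ holds, i.e., the Principle of Dependent Choice restricted to $\mathcal P(\omega)$; (ii) the Principle of Ramsey positive uniformisation holds: for every relation $R\subseteq[\omega]^\infty\times[\omega]^\infty$ with $\mathrm{dom}(R)=[\omega]^\infty$ there are $A\in[\omega]^\infty$ and a function $f$ with domain $[A]^\infty$ such that $(x,f(x))\in R$ for all $x\in[A]^\infty$; (iii) every subset of $[\omega]^\infty$ has the Ramsey property. Then for every ideal $\mathcal I\in\mathfrak F$ there is no infinite $\mathcal I$-mad family.
   Context: $[\omega]^\infty$ denotes the set of infinite subsets of $\omega$, with the topology inherited from $\mathcal P(\omega)\cong 2^\omega$; $[A]^\infty$ is the set of infinite subsets of $A$. A set $X\subseteq[\omega]^\infty$ has the Ramsey property if there is $A\in[\omega]^\infty$ with $[A]^\infty\subseteq X$ or $[A]^\infty\cap X=\emptyset$. An ideal on a countable set $S$ is a family $\mathcal I\subseteq\mathcal P(S)$ closed under finite unions and subsets; $\mathrm{Fin}$ is the ideal of finite subsets of $\omega$. If $\mathcal I_n$ is an ideal on a countable set $S_n$ for each $n\in\omega$, the Fubini sum over $\mathrm{Fin}$ is the ideal on $\{(n,x):n\in\omega,x\in S_n\}$ consisting of those $X$ such that $\{n:\{x:(n,x)\in X\}\notin\mathcal I_n\}$ is finite; closure of $\mathfrak F$ under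 Fubini sums means that whenever all $\mathcal I_n\in\mathfrak F$, their Fubini sum over $\mathrm{Fin}$ is in $\mathfrak F$. For an ideal $\mathcal I$ on $S$, an $\mathcal I$-almost disjoint family is a set $\mathcal A\subseteq\mathcal P(S)\setminus\mathcal I$ such that $A\cap B\in\mathcal I$ for all distinct $A,B\in\mathcal A$; it is $\mathcal I$-mad if it is maximal under inclusion among $\mathcal I$-almost disjoint families. *)

(* Defs.v *)
(* Provability in ZF is rendered, following Goedel's completeness theorem, as
   truth in every first-order model of ZF.  Rocq's own sets of sets could not
   play the role of the universe: with the usual choice axioms the statement
   that all sets have the Ramsey property becomes refutable.  Accordingly every
   set-theoretic notion below (omega, finiteness, functions, ...) is the one
   internal to the model, and the model need not be well-founded. *)

Set Implicit Arguments.
Unset Strict Implicit.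
Unset Printing Implicit Defensive.

Record set_structure : Type := SetStructure {
  carrier :> Type;
  mem : carrier -> carrier -> Prop
}.

Declare Scope set_theory_scope.
Notation "x ∈ y" := (mem x y) (at level 70) : set_theory_scope.
Notation "x ∉ y" := (~ mem x y) (at level 70) : set_theory_scope.
Open Scope set_theory_scope.

(* First-order formulas in the language of set theory, with de Bruijn indices. *)
Inductive formula : Type :=
| fMem (i j : nat)
| fEq (i j : nat)
| fNot (p : formula)
| fAnd (p q : formula)
| fOr (p q : formula)
| fImp (p q : formula)
| fAll (p : formula)
| fEx (p : formula).

Definition scons (T : Type) (x : T) (rho : nat -> T) : nat -> T :=
  fun n => match n with O => x | S k => rho k end.

Fixpoint sat (V : set_structure) (rho : nat -> V) (phi : formula) : Prop :=
  match phi with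
  | fMem i j => rho i ∈ rho j
  | fEq i j => rho i = rho j
  | fNot p => ~ sat rho p
  | fAnd p q => sat rho p /\ sat rho q
  | fOr p q => sat rho p \/ sat rho q
  | fImp p q => sat rho p -> sat rho q
  | fAll p => forall x : V, sat (scons x rho) p
  | fEx p => exists x : V, sat (scons x rho) p
  end.

Section Internal.
Context {V : set_structure}.
Implicit Types x y z p f R w n m N X Y A B S I J T s i : V.

(* Classes are definable from parameters; [rho] supplies the parameters, of
   which [phi] mentions only finitely many. *)
Definition definable1 (C : V -> Prop) : Prop :=
  exists (phi : formula) (rho : nat -> V),
    forall x, C x <-> sat (scons x rho) phi.

Definition definable2 (C : V -> V -> Prop) : Prop :=
  exists (phi : formula) (rho : nat -> V),
    forall x y, C x y <-> sat (scons x (scons y rho)) phi.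

Definition subset x y : Prop := forall z, z ∈ x -> z ∈ y.
Definition is_empty x : Prop := forall z, z ∉ x.
Definition is_upair p x y : Prop := forall z, z ∈ p <-> z = x \/ z = y.
Definition is_union2 X A B : Prop := forall z, z ∈ X <-> z ∈ A \/ z ∈ B.
Definition is_inter2 X A B : Prop := forall z, z ∈ X <-> z ∈ A /\ z ∈ B.
Definition is_succ m n : Prop := forall z, z ∈ m <-> z ∈ n \/ z = n.

Definition is_opair p x y : Prop :=
  exists u v, is_upair u x x /\ is_upair v x y /\ is_upair p u v.

(* The ordered pair of [x] and [y] is an element of [R]. *)
Definition pair_in R x y : Prop := exists p, is_opair p x y /\ p ∈ R.

Definition inductive_set w : Prop :=
  (exists e, is_empty e /\ e ∈ w) /\
  (forall n, n ∈ w -> exists m, is_succ m n /\ m ∈ w).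

Definition is_natural n : Prop := forall w, inductive_set w -> n ∈ w.
Definition is_omega w : Prop := forall n, n ∈ w <-> is_natural n.

Definition relation_on (D E : V -> Prop) R : Prop :=
  forall p, p ∈ R -> exists x y, D x /\ E y /\ is_opair p x y.

Definition function_on (D : V -> Prop) f : Prop :=
  (forall p, p ∈ f -> exists x y, D x /\ is_opair p x y) /\
  (forall x, D x -> exists! y, pair_in f x y).

Definition injection f X Y : Prop :=
  function_on (fun x => x ∈ X) f /\
  (forall x y, pair_in f x y -> y ∈ Y) /\
  (forall x1 x2 y, pair_in f x1 y -> pair_in f x2 y -> x1 = x2).

Definition bijection f X Y : Prop :=
  injection f X Y /\ forall y, y ∈ Y -> exists x, pair_in f x y.

Definition finite X : Prop :=
  exists n f, is_natural n /\ bijection f n X.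
Definition infinite X : Prop := ~ finite X.
Definition countable X : Prop :=
  exists w f, is_omega w /\ injection f X w.

Definition subset_omega x : Prop := forall n, n ∈ x -> is_natural n.
Definition inf_subset A x : Prop := subset x A /\ infinite x.
Definition inf_subset_omega x : Prop := subset_omega x /\ infinite x.

Definition ideal_on S I : Prop :=
  (forall A, A ∈ I -> subset A S) /\
  (exists e, is_empty e /\ e ∈ I) /\
  (forall A B, A ∈ I -> B ∈ I -> exists X, is_union2 X A B /\ X ∈ I) /\
  (forall A B, A ∈ I -> subset B A -> B ∈ I).

Definition is_Fin I : Prop :=
  forall x, x ∈ I <-> subset_omega x /\ finite x.

(* [Y] is the vertical section of [X] at [n]. *)
Definition is_section Y X n : Prop := forall x, x ∈ Y <-> pair_in X n x.

Definition is_sum_set s T : Prop :=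
  forall p, p ∈ T <->
    exists n x Sn, is_natural n /\ pair_in s n Sn /\ x ∈ Sn /\ is_opair p n x.

(* [s] and [i] are the sequences of the underlying sets and of the ideals; [J]
   is their Fubini sum over Fin, an ideal on [T]. *)
Definition is_Fubini_sum s i T J : Prop :=
  is_sum_set s T /\
  forall X, X ∈ J <->
    subset X T /\
    exists N, finite N /\
      forall n, n ∈ N <->
        is_natural n /\
        exists In Xn, pair_in i n In /\ is_section Xn X n /\ Xn ∉ In.

(* A class of ideals is given by the pairs (S, I) with I an ideal on S. *)
Definition class_of_ideals (C : V -> V -> Prop) : Prop :=
  definable2 C /\ forall S I, C S I -> countable S /\ ideal_on S I.

Definition contains_Fin (C : V -> V -> Prop) : Prop :=
  forall w I, is_omega w -> is_Fin I -> C w I.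

Definition closed_under_Fubini_sums (C : V -> V -> Prop) : Prop :=
  forall s i T J,
    function_on is_natural s -> function_on is_natural i ->
    (forall n Sn In, is_natural n -> pair_in s n Sn -> pair_in i n In ->
       C Sn In) ->
    is_Fubini_sum s i T J -> C T J.

(* The least class as an intersection.  ZF proves that such classes exist: all
   ideals generated from Fin live on subsets of the closure of omega under
   x |-> (n, x), which is countable without any choice; and the intersection is
   itself a class, the union of the stages of a transfinite recursion. *)
Definition in_least_class S I : Prop :=
  forall C : V -> V -> Prop,
    class_of_ideals C -> contains_Fin C -> closed_under_Fubini_sums C -> C S I.

Definition almost_disjoint S I X : Prop :=
  (forall A, A ∈ X -> subset A S /\ A ∉ I) /\
  (forall A B, A ∈ X -> B ∈ X -> A <> B -> exists Y, is_inter2 Y A B /\ Y ∈ I).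

Definition mad S I X : Prop :=
  almost_disjoint S I X /\
  forall Y, almost_disjoint S I Y -> subset X Y -> Y = X.

Definition Ramsey_property X : Prop :=
  exists A, inf_subset_omega A /\
    ((forall x, inf_subset A x -> x ∈ X) \/
     (forall x, inf_subset A x -> x ∉ X)).

End Internal.

Record ZF (V : set_structure) : Prop := {
  ZF_extensionality : forall x y : V, (forall z : V, z ∈ x <-> z ∈ y) -> x = y;
  ZF_foundation : forall x : V, (exists y, y ∈ x) ->
    exists y, y ∈ x /\ forall z, z ∈ x -> z ∉ y;
  ZF_pairing : forall x y : V, exists p, is_upair p x y;
  ZF_union : forall x : V, exists u : V,
    forall z, z ∈ u <-> exists y, y ∈ x /\ z ∈ y;
  ZF_powerset : forall x : V, exists u : V, forall z, z ∈ u <-> subset z x;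
  ZF_infinity : exists w : V, inductive_set w;
  ZF_separation : forall C : V -> Prop, definable1 C ->
    forall x : V, exists y : V, forall z, z ∈ y <-> z ∈ x /\ C z;
  ZF_replacement : forall C : V -> V -> Prop, definable2 C ->
    forall x : V, (forall a, a ∈ x -> exists! b, C a b) ->
    exists y : V, forall b, b ∈ y <-> exists a, a ∈ x /\ C a b
}.

Definition DC_R (V : set_structure) : Prop :=
  forall R : V, relation_on subset_omega subset_omega R ->
    (forall x : V, subset_omega x -> exists y, pair_in R x y) ->
    exists f : V, function_on is_natural f /\
      forall n m x y : V, is_natural n -> is_succ m n ->
        pair_in f n x -> pair_in f m y -> pair_in R x y.

Definition Ramsey_positive_uniformisation (V : set_structure) : Prop :=
  forall R : V, relation_on inf_subset_omega inf_subset_omega R ->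
    (forall x : V, inf_subset_omega x -> exists y, pair_in R x y) ->
    exists A f : V, inf_subset_omega A /\ function_on (inf_subset A) f /\
      forall x y : V, inf_subset A x -> pair_in f x y -> pair_in R x y.

Definition all_sets_Ramsey (V : set_structure) : Prop :=
  forall X : V, (forall x, x ∈ X -> inf_subset_omega x) -> Ramsey_property X.

(* Main.v *)
(* Fix an ideal I on a countable set S and a maximal I-almost disjoint family F.  A unit
   is a pair a < b, and an infinite z ⊆ ω is read as the stream of units
   (z_0, z_1), (z_2, z_3), ...  Suppose that streams w code sets c(w) ∉ I such that every
   I-positive Q ⊆ c(w) is witnessed by an infinitely splitting tree of finite parts of w all
   of whose branches v satisfy c(v) ⊆ Q.  By maximality and these trees every cube contains
   some z with c(z) contained in a member of F, so by the Ramsey property this holds for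
   all z in some cube; that member f(z) is unique as c(z) ∉ I.  Splitting a stream into
   subsequences and applying the Ramsey property to f(z^0) = f(z^1), the trees (which can
   be interleaved) give a cube on which f is constant.  If moreover the code is built from
   distinct members A_0, A_1, ... of F so that c(z) takes a positive part of A_a whenever
   (a, b) is the first unit of z, the constant value equals A_a for infinitely many a, a
   contradiction.

   Such codes exist for all the ideals considered: for a Fubini sum split z into infinitely
   many subsequences z^i, use the first unit (a_i, b_i) of z^i to select a column n > b_i on
   which A_{a_i} is positive, and the rest of z^i to code a positive subset of that section.
   In the trees the column is then chosen together with a_i, b_i, which is why units
   rather than single numbers are used. *)

(* Induction over the least class is an instance of minimality, so the induction hypothesis must
   itself be a definable class of the model. Hence the existence of codings is packed into the
   first-order property [codable], and all operations come with definability lemmas. Choice is the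
   second constraint: dependent choice is given for subsets of omega only, whereas the induction
   step picks a coding for every unit and a tree for every substream. A coding is therefore a
   relation between finite stages and points, all of them hereditarily finite, and Ackermann's
   enumeration turns it into a set of naturals. Fin is treated as the sum of the ideals with the
   empty set as only member on singletons, so that base and step are both instances of
   [codable_of_fibres]. That theorem rests on the inequalities index <= a < b < column: only
   finitely many substreams reach a given column, so a positive fibre of Q there meets one of their
   contributions positively, and unboundedly many positive columns force arbitrarily late first
   units. *)
From Stdlib Require Import ClassicalEpsilon FunctionalExtensionality Lia Setoid.
Require Import Defs.

(** * Definability *)

Existing Class ZF.

Definition shift_under (f : nat -> nat) (n : nat) : nat :=
  match n with O => O | S k => S (f k) end.

Fixpoint rename (f : nat -> nat) (p : formula) : formula :=
  match p with
  | fMem i j => fMem (f i) (f j)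
  | fEq i j => fEq (f i) (f j)
  | fNot p => fNot (rename f p)
  | fAnd p q => fAnd (rename f p) (rename f q)
  | fOr p q => fOr (rename f p) (rename f q)
  | fImp p q => fImp (rename f p) (rename f q)
  | fAll p => fAll (rename (shift_under f) p)
  | fEx p => fEx (rename (shift_under f) p)
  end.

Lemma scons_shift_under (V : set_structure) (x : V) (rho : nat -> V) f :
  (fun n => scons x rho (shift_under f n)) = scons x (fun n => rho (f n)).
Proof. apply functional_extensionality; intros [|n]; reflexivity. Qed.

Lemma sat_rename (V : set_structure) (p : formula) : forall (rho : nat -> V) f,
  sat rho (rename f p) <-> sat (fun n => rho (f n)) p.
Proof.
  induction p as [i j|i j|p IH|p IHp q IHq|p IHp q IHq|p IHp q IHq|p IH|p IH];
    intros rho f; simpl; try reflexivity;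
    try (rewrite IHp, IHq; reflexivity); try (rewrite IH; reflexivity).
  - split; intros H x; specialize (H x); rewrite IH, scons_shift_under in *; exact H.
  - split; intros [x H]; exists x; rewrite IH, scons_shift_under in *; exact H.
Qed.

Section Definability.
Context {V : set_structure} {hZF : ZF V}.

(** Contexts of fixed length keep the bound variables apart from the parameters: [extend] places the
    [k] variables in front of the parameter sequence. *)
Fixpoint env (k : nat) : Type :=
  match k with O => unit | S k => (env k * V)%type end.

Definition tl {k} (e : env (S k)) : env k := fst e.
Definition hd {k} (e : env (S k)) : V := snd e.

Fixpoint extend (k : nat) : env k -> (nat -> V) -> nat -> V :=
  match k with
  | O => fun _ rho => rho
  | S k => fun e rho => scons (hd e) (extend k (tl e) rho)
  end.

(* Separation, replacement and hence induction hold only for definable classes of [V].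
   [D k P] and [T k t] say that a predicate and an operation are definable; parameters are
   allowed, so elements of [V] may occur in [P] and [t] as constants.  Goals of this kind
   are proved by the tactic [dfn], which follows the syntax. *)
Definition D (k : nat) (P : env k -> Prop) : Prop :=
  exists phi rho, forall e, P e <-> sat (extend k e rho) phi.

Definition T (k : nat) (t : env k -> V) : Prop :=
  D (S k) (fun e => hd e = t (tl e)).

(** Two formulas come with two parameter sequences. Sending these to the even and the odd positions
    lets one sequence serve both. *)
Fixpoint interleave (r s : nat -> V) (n : nat) : V :=
  match n with O => r O | S m => interleave s (fun k => r (S k)) m end.

Lemma interleave_even : forall n r s, interleave r s (n + n) = r n.
Proof.
  induction n; intros r s; simpl; [reflexivity|].
  replace (n + S n) with (S (n + n)) by lia; simpl.
  exact (IHn (fun k => r (S k)) (fun k => s (S k))).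
Qed.

Lemma interleave_odd n r s : interleave r s (S (n + n)) = s n.
Proof. simpl; apply interleave_even. Qed.

Fixpoint shift_above (k : nat) (f : nat -> nat) : nat -> nat :=
  match k with O => f | S k => shift_under (shift_above k f) end.

Lemma extend_shift_above k : forall e rho f,
  (fun n => extend k e rho (shift_above k f n)) = extend k e (fun n => rho (f n)).
Proof.
  induction k; intros e rho f; simpl; [reflexivity|].
  rewrite scons_shift_under, IHk; reflexivity.
Qed.

Lemma D_ext k (P Q : env k -> Prop) :
  D k P -> (forall e, Q e <-> P e) -> D k Q.
Proof.
  intros (phi & rho & H) E; exists phi, rho; intros e; rewrite E; apply H.
Qed.

Lemma D_pair k (P Q : env k -> Prop) : D k P -> D k Q ->
  exists phi psi rho, forall e,
    (P e <-> sat (extend k e rho) phi) /\ (Q e <-> sat (extend k e rho) psi).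
Proof.
  intros (phi & r & H) (psi & s & H').
  exists (rename (shift_above k (fun n => n + n)) phi),
    (rename (shift_above k (fun n => S (n + n))) psi), (interleave r s).
  intros e; rewrite !sat_rename, !extend_shift_above; split.
  - replace (fun n => interleave r s (n + n)) with r; [apply H|].
    apply functional_extensionality; intros n; symmetry; apply interleave_even.
  - replace (fun n => interleave r s (S (n + n))) with s; [apply H'|].
    apply functional_extensionality; intros n; symmetry; apply interleave_odd.
Qed.

Lemma D_not k (P : env k -> Prop) : D k P -> D k (fun e => ~ P e).
Proof.
  intros (phi & rho & H); exists (fNot phi), rho; intros e; simpl; rewrite H; tauto.
Qed.

Lemma D_and k (P Q : env k -> Prop) : D k P -> D k Q -> D k (fun e => P e /\ Q e).
Proof.
  intros H H'; destruct (D_pair _ _ _ H H') as (phi & psi & rho & E).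
  exists (fAnd phi psi), rho; intros e; simpl; destruct (E e); tauto.
Qed.

Lemma D_or k (P Q : env k -> Prop) : D k P -> D k Q -> D k (fun e => P e \/ Q e).
Proof.
  intros H H'; destruct (D_pair _ _ _ H H') as (phi & psi & rho & E).
  exists (fOr phi psi), rho; intros e; simpl; destruct (E e); tauto.
Qed.

Lemma D_imp k (P Q : env k -> Prop) : D k P -> D k Q -> D k (fun e => P e -> Q e).
Proof.
  intros H H'; destruct (D_pair _ _ _ H H') as (phi & psi & rho & E).
  exists (fImp phi psi), rho; intros e; simpl; destruct (E e); tauto.
Qed.

Lemma D_iff k (P Q : env k -> Prop) : D k P -> D k Q -> D k (fun e => P e <-> Q e).
Proof. intros; apply D_and; apply D_imp; assumption. Qed.

Lemma D_all k (P : env k -> V -> Prop) :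
  D (S k) (fun e => P (tl e) (hd e)) -> D k (fun e => forall x, P e x).
Proof.
  intros (phi & rho & H); exists (fAll phi), rho; intros e; simpl.
  split; intros A x; apply (H (e, x)); exact (A x).
Qed.

Lemma D_ex k (P : env k -> V -> Prop) :
  D (S k) (fun e => P (tl e) (hd e)) -> D k (fun e => exists x, P e x).
Proof.
  intros (phi & rho & H); exists (fEx phi), rho; intros e; simpl.
  split; intros [x A]; exists x; apply (H (e, x)); exact A.
Qed.

Lemma V_inhabited : inhabited V.
Proof. destruct (ZF_infinity hZF) as [w _]; exact (inhabits w). Qed.

(** By excluded middle in the metatheory: the formula is picked according to whether [Q] holds, so
    [Q] itself may be any proposition. *)
Lemma D_const k (Q : Prop) : D k (fun _ => Q).
Proof.
  destruct V_inhabited as [v].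
  destruct (classic Q) as [q|q].
  - exists (fEq 0 0), (fun _ => v); intros e; simpl; tauto.
  - exists (fNot (fEq 0 0)), (fun _ => v); intros e; simpl; tauto.
Qed.

Lemma T_v0 k : T (S k) (fun e => hd e).
Proof.
  destruct V_inhabited as [v]; exists (fEq 0 1), (fun _ => v); intros e; simpl; tauto.
Qed.

Lemma T_const k (c : V) : T k (fun _ => c).
Proof.
  exists (fEq 0 (S k)), (fun _ => c); intros [e x]; simpl.
  replace (extend k e (fun _ => c) k) with c; [tauto|].
  enough (E : forall j (e : env j) m, extend j e (fun _ => c) (j + m) = c).
  { pose proof (E k e 0) as h; rewrite <- plus_n_O in h; symmetry; exact h. }
  clear; induction j; intros e m; simpl; [reflexivity|apply IHj].
Qed.

Lemma D_wk k (P : env k -> V -> Prop) :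
  D (S k) (fun e => P (tl e) (hd e)) -> D (S (S k)) (fun e => P (tl (tl e)) (hd e)).
Proof.
  intros (phi & rho & H).
  exists (rename (fun n => match n with O => O | S n => S (S n) end) phi), rho.
  intros [[e x] y]; rewrite sat_rename; simpl.
  rewrite (H (e, y)); simpl.
  replace (fun n => scons y (scons x (extend k e rho))
             match n with O => O | S n => S (S n) end)
    with (scons y (extend k e rho)); [tauto|].
  apply functional_extensionality; intros [|n]; reflexivity.
Qed.

Lemma T_wk k (t : env k -> V) : T k t -> T (S k) (fun e => t (tl e)).
Proof. exact (D_wk k (fun e x => x = t e)). Qed.

(** The language has no function symbols, so a definable operation is substituted by quantifying
    over its value. *)
Lemma D_sub k (P : env k -> V -> Prop) (t : env k -> V) :
  D (S k) (fun e => P (tl e) (hd e)) -> T k t -> D k (fun e => P e (t e)).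
Proof.
  intros HP Ht.
  apply D_ext with (P := fun e => exists x, x = t e /\ P e x).
  - apply D_ex, D_and; assumption.
  - intros e; split; [eauto|intros (x & -> & H); exact H].
Qed.

Lemma D_eq k (t u : env k -> V) : T k t -> T k u -> D k (fun e => t e = u e).
Proof.
  intros Ht Hu; apply (D_sub k (fun e x => x = u e) t); assumption.
Qed.

Lemma D_mem k (t u : env k -> V) : T k t -> T k u -> D k (fun e => t e ∈ u e).
Proof.
  intros Ht Hu; apply (D_sub k (fun e x => x ∈ u e) t); [|assumption].
  apply (D_sub (S k) (fun e y => hd e ∈ y) (fun e => u (tl e))).
  - destruct V_inhabited as [v]; exists (fMem 1 0), (fun _ => v); intros e; simpl; tauto.
  - apply T_wk; assumption.
Qed.

Lemma D_exuniq k (P : env k -> V -> Prop) :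
  D (S k) (fun e => P (tl e) (hd e)) -> D k (fun e => exists! x, P e x).
Proof.
  intros H; apply D_ex, D_and; [exact H|].
  apply D_all, D_imp; [apply D_wk; exact H|apply D_eq; [apply T_wk|]; apply T_v0].
Qed.

(* Total description operator: the empty set when there is no unique witness. *)
Definition the (P : V -> Prop) : V :=
  epsilon V_inhabited
    (fun y => (P y /\ exists! x, P x) \/ (~ (exists! x, P x) /\ is_empty y)).

Lemma ext_eq (x y : V) : (forall z, z ∈ x <-> z ∈ y) -> x = y.
Proof. apply ZF_extensionality; exact hZF. Qed.

(** The epsilon operator belongs to the metatheory; what makes descriptions definable is that this
    characterisation of the value is first-order in [P]. *)
Lemma the_char (P : V -> Prop) (y : V) :
  y = the P <-> (P y /\ exists! x, P x) \/ (~ (exists! x, P x) /\ is_empty y).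
Proof.
  assert (ex : exists y, (P y /\ exists! x, P x) \/ (~ (exists! x, P x) /\ is_empty y)).
  { destruct (classic (exists! x, P x)) as [h|h].
    - pose proof h as [x [hx _]]; exists x; auto.
    - destruct (ZF_infinity hZF) as (w & (e & he & _) & _); exists e; auto. }
  pose proof (epsilon_spec V_inhabited _ ex) as sp; fold (the P) in sp.
  split; [intros ->; exact sp|intros H].
  destruct H as [[H H1]|[H H1]], sp as [[K K1]|[K K1]]; try tauto.
  - destruct H1 as [x [_ ux]]; rewrite <- (ux _ H), <- (ux _ K); reflexivity.
  - apply ext_eq; intros z; split; intros hz; exfalso; [apply (H1 z hz)|apply (K1 z hz)].
Qed.

Lemma the_spec (P : V -> Prop) : (exists! x, P x) -> P (the P).
Proof. intros h; destruct (proj1 (the_char P (the P)) eq_refl) as [[H _]|[H _]]; tauto. Qed.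

Lemma the_eq (P : V -> Prop) x : (exists! x, P x) -> P x -> the P = x.
Proof. intros h hx; symmetry; apply the_char; auto. Qed.

Lemma T_the k (P : env k -> V -> Prop) :
  D (S k) (fun e => P (tl e) (hd e)) -> T k (fun e => the (P e)).
Proof.
  intros H0.
  apply D_ext with (P := fun e : env (S k) =>
    (P (tl e) (hd e) /\ exists! x, P (tl e) x) \/
    (~ (exists! x, P (tl e) x) /\ is_empty (hd e))); [|intros e; apply the_char].
  assert (H : D (S k) (fun e => exists! x, P (tl e) x))
    by (apply (D_exuniq (S k) (fun e => P (tl e))), D_wk, H0).
  apply D_or; apply D_and; try assumption; [apply D_not; assumption|].
  apply D_all, D_not, D_mem; [|apply T_wk]; apply T_v0.
Qed.

Definition D1 (P : V -> Prop) : Prop := D 1 (fun e => P (hd e)).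
Definition D2 (P : V -> V -> Prop) : Prop := D 2 (fun e => P (hd (tl e)) (hd e)).
Definition T1 (F : V -> V) : Prop := T 1 (fun e => F (hd e)).
Definition T2 (F : V -> V -> V) : Prop := T 2 (fun e => F (hd (tl e)) (hd e)).
Definition D3 (P : V -> V -> V -> Prop) : Prop :=
  D 3 (fun e => P (hd (tl (tl e))) (hd (tl e)) (hd e)).

Lemma extend_tail k : forall (e : env k) rho m, extend k e rho (k + m) = rho m.
Proof. induction k; intros e rho m; simpl; [reflexivity|apply IHk]. Qed.

Lemma D_app1 k P t : D1 P -> T k t -> D k (fun e => P (t e)).
Proof.
  intros (phi & rho & H) Ht.
  apply (D_sub k (fun _ => P)); [|exact Ht].
  exists (rename (shift_under (fun n => k + n)) phi), rho; intros [e x].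
  rewrite sat_rename; simpl; rewrite scons_shift_under.
  replace (fun n => extend k e rho (k + n)) with rho; [apply (H (tt, x))|].
  apply functional_extensionality; intros n; symmetry; apply extend_tail.
Qed.

Lemma D_app2 k P t u : D2 P -> T k t -> T k u -> D k (fun e => P (t e) (u e)).
Proof.
  intros (phi & rho & H) Ht Hu.
  apply (D_sub k (fun e x => P x (u e))); [|exact Ht].
  apply (D_sub (S k) (fun e => P (hd e)) (fun e => u (tl e))); [|apply T_wk, Hu].
  exists (rename (shift_under (shift_under (fun n => k + n))) phi), rho; intros [[e x] y].
  rewrite sat_rename; simpl; rewrite !scons_shift_under.
  replace (fun n => extend k e rho (k + n)) with rho; [apply (H (tt, x, y))|].
  apply functional_extensionality; intros n; symmetry; apply extend_tail.
Qed.

Lemma D_app3 k P t u v : D3 P -> T k t -> T k u -> T k v ->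
  D k (fun e => P (t e) (u e) (v e)).
Proof.
  intros (phi & rho & H) Ht Hu Hv.
  apply (D_sub k (fun e x => P x (u e) (v e))); [|exact Ht].
  apply (D_sub (S k) (fun e y => P (hd e) y (v (tl e))) (fun e => u (tl e)));
    [|apply T_wk, Hu].
  apply (D_sub (S (S k)) (fun e => P (hd (tl e)) (hd e)) (fun e => v (tl (tl e))));
    [|apply (T_wk (S k) (fun e => v (tl e))), T_wk, Hv].
  exists (rename (shift_under (shift_under (shift_under (fun n => k + n)))) phi), rho.
  intros [[[e x] y] z].
  rewrite sat_rename; simpl; rewrite !scons_shift_under.
  replace (fun n => extend k e rho (k + n)) with rho; [apply (H (tt, x, y, z))|].
  apply functional_extensionality; intros n; symmetry; apply extend_tail.
Qed.

Lemma T_app1 k F t : T1 F -> T k t -> T k (fun e => F (t e)).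
Proof.
  intros HF Ht.
  apply (D_app2 (S k) (fun x y => y = F x) (fun e => t (tl e)) (fun e => hd e));
    [exact HF|apply T_wk, Ht|apply T_v0].
Qed.

Lemma T_app2 k F t u : T2 F -> T k t -> T k u -> T k (fun e => F (t e) (u e)).
Proof.
  intros HF Ht Hu.
  apply (D_app3 (S k) (fun x x' y => y = F x x')
    (fun e => t (tl e)) (fun e => u (tl e)) (fun e => hd e));
    [exact HF|apply T_wk, Ht|apply T_wk, Hu|apply T_v0].
Qed.

(** Maps of contexts that act on variable positions alone, so that they can be absorbed by renaming
    the formula. *)
Definition reindexing (k j : nat) (s : env k -> env j) : Prop :=
  exists f, forall e rho n, extend j (s e) rho n = extend k e rho (f n).

Lemma D_reindex k j P s : D j P -> reindexing k j s -> D k (fun e => P (s e)).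
Proof.
  intros (phi & rho & H) (f & E); exists (rename f phi), rho; intros e.
  rewrite sat_rename, (H (s e)).
  replace (fun n => extend k e rho (f n)) with (extend j (s e) rho); [reflexivity|].
  apply functional_extensionality; intros n; apply E.
Qed.

Lemma T_reindex k j t s : T j t -> reindexing k j s -> T k (fun e => t (s e)).
Proof.
  intros H (f & E).
  apply (D_reindex (S k) (S j) (fun e => hd e = t (tl e)) (fun e => (s (tl e), hd e)));
    [exact H|].
  exists (shift_under f); intros e rho [|n]; [reflexivity|exact (E (tl e) rho n)].
Qed.

Lemma T_hd k j (s : env k -> env (S j)) : reindexing k (S j) s -> T k (fun e => hd (s e)).
Proof. intros H; apply (T_reindex k (S j) hd s); [apply T_v0|exact H]. Qed.

(** This and the next three lemmas let a family known to be definable over one context be used under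
    further binders. *)
Lemma D_env1 k j P s t : D (S j) (fun e => P (tl e) (hd e)) ->
  reindexing k j s -> T k t -> D k (fun e => P (s e) (t e)).
Proof.
  intros H (f & E) Ht; apply (D_sub k (fun e => P (s e))); [|exact Ht].
  apply (D_reindex (S k) (S j) (fun e => P (tl e) (hd e)) (fun e => (s (tl e), hd e)));
    [exact H|].
  exists (shift_under f); intros e rho [|n];
    [reflexivity|exact (E (tl e) rho n)].
Qed.

Lemma D_env2 k j P s t u : D (S (S j)) (fun e => P (tl (tl e)) (hd (tl e)) (hd e)) ->
  reindexing k j s -> T k t -> T k u -> D k (fun e => P (s e) (t e) (u e)).
Proof.
  intros H (f & E) Ht Hu; apply (D_sub k (fun e x => P (s e) x (u e))); [|exact Ht].
  apply (D_sub (S k) (fun e => P (s (tl e)) (hd e)) (fun e => u (tl e)));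
    [|apply T_wk, Hu].
  apply (D_reindex (S (S k)) (S (S j)) (fun e => P (tl (tl e)) (hd (tl e)) (hd e))
    (fun e => (s (tl (tl e)), hd (tl e), hd e))); [exact H|].
  exists (shift_under (shift_under f)).
  intros e rho [|[|n]]; [reflexivity|reflexivity|exact (E (tl (tl e)) rho n)].
Qed.

Lemma T_env1 k j F s t : T (S j) (fun e => F (tl e) (hd e)) ->
  reindexing k j s -> T k t -> T k (fun e => F (s e) (t e)).
Proof.
  intros H (f & E) Ht.
  apply (D_env2 (S k) j (fun e x y => y = F e x) (fun e => s (tl e)));
    [exact H| |apply T_wk, Ht|apply T_v0].
  exists (fun n => S (f n)); intros e rho n; exact (E (tl e) rho n).
Qed.

Lemma T_env2 k j F s t u : T (S (S j)) (fun e => F (tl (tl e)) (hd (tl e)) (hd e)) ->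
  reindexing k j s -> T k t -> T k u -> T k (fun e => F (s e) (t e) (u e)).
Proof.
  intros H (f & E) Ht Hu.
  apply (D_sub (S k) (fun e x => hd e = F (s (tl e)) x (u (tl e))) (fun e => t (tl e)));
    [|apply T_wk, Ht].
  apply (D_env2 (S (S k)) (S j) (fun e x y => y = F (tl e) (hd e) x)
    (fun e => (s (tl (tl e)), hd e)) (fun e => u (tl (tl e))) (fun e => hd (tl e)));
    [exact H| |exact (T_wk (S k) (fun e => u (tl e)) (T_wk k u Hu))
      |exact (T_wk (S k) _ (T_v0 k))].
  exists (shift_under (fun n => S (f n))); intros e rho [|n];
    [reflexivity|exact (E (tl (tl e)) rho n)].
Qed.

End Definability.

(* Redefined each time operations are shown to be definable. *)
Ltac dfn_lemma := fail.

(** Iterating [tl] shifts all positions by a constant, which is found by trial; 15 merely stops the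
    search. *)
Ltac reindex_from m :=
  first [ exists (Nat.add m); reflexivity
        | lazymatch m with 15 => fail | _ => reindex_from (S m) end ].
Ltac reindex := reindex_from 0.

Ltac duse :=
  match goal with
  | |- D _ (fun e => ?P (@?t e)) =>
      is_var P; match goal with H : D1 P |- _ => apply (D_app1 _ P t H) end
  | |- D _ (fun e => ?P (@?t e) (@?u e)) =>
      is_var P; match goal with H : D2 P |- _ => apply (D_app2 _ P t u H) end
  | |- D _ (fun e => ?P (@?t e) (@?u e) (@?v e)) =>
      is_var P; match goal with H : D3 P |- _ => apply (D_app3 _ P t u v H) end
  | |- T _ (fun e => ?F (@?t e)) =>
      is_var F; match goal with H : T1 F |- _ => apply (T_app1 _ F t H) end
  | |- T _ (fun e => ?F (@?t e) (@?u e)) =>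
      is_var F; match goal with H : T2 F |- _ => apply (T_app2 _ F t u H) end
  | H : T ?k ?t |- T ?k ?t => exact H
  | H : T _ ?t |- T _ (fun e => ?t (@?s e)) => apply (T_reindex _ _ t s H); reindex
  | H : D _ ?P |- D _ ?P => exact H
  | H : D (S _) (fun e => ?P (tl e) (hd e)) |- D _ (fun e => ?P (@?s e) (@?t e)) =>
      apply (D_env1 _ _ P s t H); [reindex|]
  | H : D (S (S _)) (fun e => ?P (tl (tl e)) (hd (tl e)) (hd e))
    |- D _ (fun e => ?P (@?s e) (@?t e) (@?u e)) =>
      apply (D_env2 _ _ P s t u H); [reindex| |]
  | H : T (S _) (fun e => ?P (tl e) (hd e)) |- T _ (fun e => ?P (@?s e) (@?t e)) =>
      apply (T_env1 _ _ P s t H); [reindex|]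
  | H : T (S (S _)) (fun e => ?P (tl (tl e)) (hd (tl e)) (hd e))
    |- T _ (fun e => ?P (@?s e) (@?t e) (@?u e)) =>
      apply (T_env2 _ _ P s t u H); [reindex| |]
  end.

Ltac dcore :=
  cbv beta;
  lazymatch goal with
  | |- D1 _ => red
  | |- D2 _ => red
  | |- D3 _ => red
  | |- T1 _ => red
  | |- T2 _ => red
  | |- D _ (fun _ => ?Q) => apply D_const
  | |- D _ (fun e => ~ @?P e) => apply (D_not _ P)
  | |- D _ (fun e => @?P e <-> @?Q e) => apply (D_iff _ P Q)
  | |- D _ (fun e => @?P e /\ @?Q e) => apply (D_and _ P Q)
  | |- D _ (fun e => @?P e \/ @?Q e) => apply (D_or _ P Q)
  | |- D _ (fun e => ex (unique (@?P e))) => apply (D_exuniq _ P)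
  | |- D _ (fun e => ex (@?P e)) => apply (D_ex _ P)
  | |- D _ (fun e => @?t e = @?u e) => apply (D_eq _ t u)
  | |- D _ (fun e => mem (@?t e) (@?u e)) => apply (D_mem _ t u)
  | |- D _ (fun e => forall x : carrier _, @?P e x) => apply (D_all _ P)
  | |- D _ (fun e => @?P e -> @?Q e) => apply (D_imp _ P Q)
  | |- T _ (fun _ => ?c) => apply T_const
  | |- T _ hd => apply T_v0
  | |- T _ (fun e => hd e) => apply T_v0
  | |- T _ (fun e => hd (@?s e)) => apply (T_hd _ _ s); reindex
  | |- _ => first [duse | dfn_lemma]
  end.

Ltac dfn := solve [repeat dcore].

(** * Basic sets, functions and natural numbers *)

Section BasicSets.
Context {V : set_structure} {hZF : ZF V}.

Lemma D_is_empty k (t : env k -> V) : T k t -> D k (fun e => is_empty (t e)).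
Proof. intros; unfold is_empty; dfn. Qed.

Lemma D_subset k (t u : env k -> V) : T k t -> T k u -> D k (fun e => subset (t e) (u e)).
Proof. intros; unfold subset; dfn. Qed.
End BasicSets.

Ltac dfn_subset := first [apply D_subset | apply D_is_empty].
Ltac dfn_lemma ::= dfn_subset.

Section Operations.
Context {V : set_structure} {hZF : ZF V}.

Lemma set_ext_the (P : V -> Prop) :
  (exists y : V, forall z, z ∈ y <-> P z) ->
  forall z, z ∈ the (fun y => forall z, z ∈ y <-> P z) <-> P z.
Proof.
  intros [y hy]. apply (the_spec (fun y => forall z, z ∈ y <-> P z)).
  exists y; split; [exact hy|]. intros y' hy'; apply ext_eq; intros z.
  rewrite hy, hy'; reflexivity.
Qed.

Definition upair (x y : V) : V := the (fun p => forall z, z ∈ p <-> z = x \/ z = y).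

Lemma upair_spec x y z : z ∈ upair x y <-> z = x \/ z = y.
Proof. revert z; apply set_ext_the; apply (ZF_pairing hZF). Qed.

Definition bigcup (x : V) : V := the (fun u => forall z, z ∈ u <-> exists y, y ∈ x /\ z ∈ y).

Lemma bigcup_spec x z : z ∈ bigcup x <-> exists y, y ∈ x /\ z ∈ y.
Proof. revert z; apply set_ext_the; apply (ZF_union hZF). Qed.

Definition power (x : V) : V := the (fun u => forall z, z ∈ u <-> subset z x).

Lemma power_spec x z : z ∈ power x <-> subset z x.
Proof. revert z; apply set_ext_the; apply (ZF_powerset hZF). Qed.

Definition sep (x : V) (P : V -> Prop) : V := the (fun y => forall z, z ∈ y <-> z ∈ x /\ P z).

Lemma D1_definable1 (P : V -> Prop) : D1 P -> definable1 P.
Proof. intros (phi & rho & H); exists phi, rho; intros x; apply (H (tt, x)). Qed.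

Lemma sep_spec x P z : D1 P -> (z ∈ sep x P <-> z ∈ x /\ P z).
Proof.
  intros H; revert z; apply set_ext_the, (ZF_separation hZF), D1_definable1, H.
Qed.

(** Holds for every [P], because a description without a witness denotes the empty set. *)
Lemma sep_subset x P : subset (sep x P) x.
Proof.
  destruct (classic (exists y : V, forall z, z ∈ y <-> z ∈ x /\ P z)) as [h|h].
  - intros z hz; apply (set_ext_the _ h) in hz; tauto.
  - intros z hz; exfalso; unfold sep in hz.
    destruct (proj1 (the_char (fun y => forall z, z ∈ y <-> z ∈ x /\ P z) _) eq_refl)
      as [(h' & _)|(_ & h')]; [apply h; eauto|exact (h' z hz)].
Qed.

Definition img (x : V) (F : V -> V) : V :=
  the (fun y => forall z, z ∈ y <-> exists a, a ∈ x /\ z = F a).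

Lemma img_spec x F z : T1 F -> (z ∈ img x F <-> exists a, a ∈ x /\ z = F a).
Proof.
  intros H; revert z; apply set_ext_the, (ZF_replacement hZF (C := fun a b => b = F a)).
  - assert (H' : D 2 (fun e : env 2 => hd (tl e) = F (hd e))) by dfn.
    destruct H' as (phi & rho & H'); exists phi, rho; intros a b.
    rewrite (H' (tt, b, a)); simpl; reflexivity.
  - intros a _; exists (F a); split; congruence.
Qed.

Definition empty : V := the is_empty.

Lemma empty_spec z : z ∉ empty.
Proof.
  assert (H : is_empty empty); [|exact (H z)].
  apply (the_spec is_empty); destruct (ZF_infinity hZF) as (w & (e & he & _) & _).
  exists e; split; [exact he|intros e' he'; apply ext_eq; intros x].
  split; intros h; exfalso; [apply (he x h)|apply (he' x h)].
Qed.

Definition sing (x : V) : V := upair x x.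

Lemma sing_spec x z : z ∈ sing x <-> z = x.
Proof. unfold sing; rewrite upair_spec; tauto. Qed.

Definition union2 (x y : V) : V := bigcup (upair x y).

Lemma union2_spec x y z : z ∈ union2 x y <-> z ∈ x \/ z ∈ y.
Proof.
  unfold union2; rewrite bigcup_spec; split.
  - intros (u & hu & hz); apply upair_spec in hu; destruct hu; subst; auto.
  - intros [h|h]; [exists x|exists y]; rewrite upair_spec; auto.
Qed.

Definition adj (x y : V) : V := union2 x (sing y).

Lemma adj_spec x y z : z ∈ adj x y <-> z ∈ x \/ z = y.
Proof. unfold adj; rewrite union2_spec, sing_spec; tauto. Qed.

Definition opair (x y : V) : V := upair (sing x) (upair x y).

Lemma upair_inj_sing x a b : sing x = upair a b -> x = a /\ x = b.
Proof.
  intros H; split; symmetry; apply (sing_spec x); rewrite H; apply upair_spec; auto.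
Qed.

Lemma opair_inj a b c d : opair a b = opair c d -> a = c /\ b = d.
Proof.
  unfold opair; intros H.
  assert (ac : a = c).
  { assert (h : sing a ∈ upair (sing c) (upair c d)) by (rewrite <- H, upair_spec; auto).
    apply upair_spec in h; destruct h as [h|h].
    - exact (proj1 (upair_inj_sing _ _ _ h)).
    - exact (proj1 (upair_inj_sing _ _ _ h)). }
  subst c; split; [reflexivity|].
  assert (E : forall b d, upair (sing a) (upair a b) = upair (sing a) (upair a d) ->
    b = a -> b = d).
  { clear; intros b d H ->.
    assert (h : upair a d ∈ upair (sing a) (upair a a))
      by (rewrite H, upair_spec; auto).
    assert (h' : upair a d = sing a) by (apply upair_spec in h; destruct h; assumption).
    symmetry in h'; apply (upair_inj_sing _ _ _ h'). }
  destruct (classic (b = a)) as [e|e]; [exact (E b d H e)|].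
  destruct (classic (d = a)) as [e'|e']; [symmetry; exact (E d b (eq_sym H) e')|].
  assert (h : upair a b ∈ upair (sing a) (upair a d)) by (rewrite <- H, upair_spec; auto).
  apply upair_spec in h; destruct h as [h|h].
  - symmetry in h; destruct (upair_inj_sing _ _ _ h); congruence.
  - assert (h' : b ∈ upair a d) by (rewrite <- h, upair_spec; auto).
    apply upair_spec in h'; destruct h'; congruence.
Qed.

Lemma is_opair_iff p x y : is_opair p x y <-> p = opair x y.
Proof.
  split.
  - intros (u & v & hu & hv & hp); apply ext_eq; intros z; rewrite (hp z).
    unfold opair; rewrite upair_spec.
    assert (u = sing x) as -> by (apply ext_eq; intros t; rewrite (hu t), sing_spec; tauto).
    assert (v = upair x y) as -> by (apply ext_eq; intros t; rewrite (hv t), upair_spec; tauto).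
    tauto.
  - intros ->; exists (sing x), (upair x y); split; [|split]; intros z.
    + rewrite sing_spec; tauto.
    + apply upair_spec.
    + apply upair_spec.
Qed.

Lemma pair_in_iff R x y : pair_in R x y <-> opair x y ∈ R.
Proof.
  split.
  - intros (p & h & hp); apply is_opair_iff in h; subst; exact hp.
  - intros h; exists (opair x y); split; [apply is_opair_iff; reflexivity|exact h].
Qed.

Definition ite (Q : Prop) (x y : V) : V := the (fun z => (Q /\ z = x) \/ (~ Q /\ z = y)).

Lemma ite_true (Q : Prop) x y : Q -> ite Q x y = x.
Proof.
  intros q; apply the_eq; [|tauto].
  exists x; split; [tauto|]; intros z [[_ h]|[h _]]; [congruence|tauto].
Qed.

Lemma ite_false (Q : Prop) x y : ~ Q -> ite Q x y = y.
Proof.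
  intros q; apply the_eq; [|tauto].
  exists y; split; [tauto|]; intros z [[h _]|[_ h]]; [tauto|congruence].
Qed.

Lemma upair_opair x y : opair x y = upair (upair x x) (upair x y).
Proof. reflexivity. Qed.

Definition app (f x : V) : V := the (fun y => opair x y ∈ f).

Definition lam (A : V) (F : V -> V) : V := img A (fun x => opair x (F x)).

End Operations.

Section DefinabilityOfOperations.
Context {V : set_structure} {hZF : ZF V}.
Variable k : nat.
Implicit Types t u : @env V k -> V.

Lemma T_upair t u : T k t -> T k u -> T k (fun e => upair (t e) (u e)).
Proof. intros; unfold upair; apply T_the; dfn. Qed.

Lemma T_bigcup t : T k t -> T k (fun e => bigcup (t e)).
Proof. intros; unfold bigcup; apply T_the; dfn. Qed.

Lemma T_sep t (P : env k -> V -> Prop) : T k t ->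
  D (S k) (fun e => P (tl e) (hd e)) -> T k (fun e => sep (t e) (P e)).
Proof. intros; unfold sep; apply T_the; dfn. Qed.

Lemma T_img t (F : env k -> V -> V) : T k t ->
  T (S k) (fun e => F (tl e) (hd e)) -> T k (fun e => img (t e) (F e)).
Proof. intros; unfold img; apply T_the; dfn. Qed.

Lemma T_ite (Q : env k -> Prop) t u : D k Q -> T k t -> T k u ->
  T k (fun e => ite (Q e) (t e) (u e)).
Proof.
  intros HQ Ht Hu; unfold ite; apply T_the.
  assert (D (S k) (fun e => Q (tl e))) by (apply (D_reindex _ _ Q tl HQ); reindex).
  dfn.
Qed.

Lemma T_sing t : T k t -> T k (fun e => sing (t e)).
Proof. intros; apply T_upair; assumption. Qed.

Lemma T_union2 t u : T k t -> T k u -> T k (fun e => union2 (t e) (u e)).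
Proof. intros; apply T_bigcup, T_upair; assumption. Qed.

Lemma T_adj t u : T k t -> T k u -> T k (fun e => adj (t e) (u e)).
Proof. intros; apply T_union2, T_sing; assumption. Qed.

Lemma T_opair t u : T k t -> T k u -> T k (fun e => opair (t e) (u e)).
Proof. intros; repeat apply T_upair; assumption. Qed.

End DefinabilityOfOperations.

Ltac dfn_sets := first
  [ apply T_opair | apply T_adj | apply T_union2 | apply T_sing | apply T_ite
  | apply T_img | apply T_sep | apply T_bigcup | apply T_upair
  | dfn_subset].
Ltac dfn_lemma ::= dfn_sets.

#[global] Opaque the upair bigcup power sep img empty sing union2 adj opair ite.

Section Functions.
Context {V : set_structure} {hZF : ZF V}.

Lemma T_app k (t u : env k -> V) : T k t -> T k u -> T k (fun e => app (t e) (u e)).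
Proof. intros; unfold app; apply T_the; dfn. Qed.

Lemma T_lam k (t : env k -> V) F : T k t ->
  T (S k) (fun e => F (tl e) (hd e)) -> T k (fun e => lam (t e) (F e)).
Proof. intros; unfold lam; dfn. Qed.

Lemma lam_spec A F p : T1 F -> (p ∈ lam A F <-> exists x, x ∈ A /\ p = opair x (F x)).
Proof. intros; unfold lam; rewrite img_spec; [reflexivity|dfn]. Qed.

Lemma app_eq f x y : (exists! y, opair x y ∈ f) -> opair x y ∈ f -> app f x = y.
Proof. exact (the_eq (fun y => opair x y ∈ f) y). Qed.

Lemma app_lam A F x : T1 F -> x ∈ A -> app (lam A F) x = F x.
Proof.
  intros H hx; apply app_eq.
  - exists (F x); split; [apply lam_spec; eauto|].
    intros y hy; apply lam_spec in hy; [|exact H].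
    destruct hy as (x' & _ & e); apply opair_inj in e; destruct e; subst; reflexivity.
  - apply lam_spec; eauto.
Qed.

Lemma lam_ext A F G : T1 F -> T1 G -> (forall x, x ∈ A -> F x = G x) -> lam A F = lam A G.
Proof.
  intros HF HG E; apply ext_eq; intros p; rewrite !lam_spec by assumption.
  split; intros (x & hx & ->); exists x; rewrite (E x hx); auto.
Qed.

Definition succ (n : V) : V := adj n n.

Lemma succ_spec n z : z ∈ succ n <-> z ∈ n \/ z = n.
Proof. apply adj_spec. Qed.

Lemma is_succ_iff m n : is_succ m n <-> m = succ n.
Proof.
  split; [intros H; apply ext_eq; intros z; rewrite succ_spec; apply H|].
  intros -> z; apply succ_spec.
Qed.

Lemma is_empty_iff x : is_empty x <-> x = empty.
Proof.
  split; [|intros ->; exact empty_spec].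
  intros H; apply ext_eq; intros z; split; intros h;
    exfalso; [apply (H z h)|apply (empty_spec z h)].
Qed.

Lemma inductive_iff w :
  inductive_set w <-> empty ∈ w /\ forall n, n ∈ w -> succ n ∈ w.
Proof.
  split.
  - intros [(e & he & hw) H]; apply is_empty_iff in he; subst; split; [exact hw|].
    intros n hn; destruct (H n hn) as (m & hm & h); apply is_succ_iff in hm; subst; exact h.
  - intros [H0 H1]; split; [exists empty; split; [exact empty_spec|exact H0]|].
    intros n hn; exists (succ n); split; [apply is_succ_iff; reflexivity|auto].
Qed.

Lemma T_succ k (t : env k -> V) : T k t -> T k (fun e => succ (t e)).
Proof. intros; apply T_adj; assumption. Qed.

End Functions.

#[global] Opaque app lam.

Ltac dfn_functions := first [dfn_sets | apply T_succ | apply T_app | apply T_lam].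
Ltac dfn_lemma ::= dfn_functions.

Section Omega.
Context {V : set_structure} {hZF : ZF V}.

Lemma succ_eq n : succ n = adj n n.
Proof. reflexivity. Qed.

Definition omega : V := the (fun w => forall n, n ∈ w <-> is_natural n).

Lemma D_is_natural k (t : env k -> V) : T k t -> D k (fun e => is_natural (t e)).
Proof.
  intros; unfold is_natural.
  apply D_ext with (P := fun e => forall w,
    empty ∈ w /\ (forall n, n ∈ w -> succ n ∈ w) -> t e ∈ w); [dfn|].
  intros e; split; intros h w hw; apply h, inductive_iff, hw.
Qed.

End Omega.

#[global] Opaque succ.

Ltac dfn_naturals := first [dfn_functions | apply D_is_natural].
Ltac dfn_lemma ::= dfn_naturals.

Section NaturalInduction.
Context {V : set_structure} {hZF : ZF V}.

Lemma omega_spec n : n ∈ omega <-> is_natural n.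
Proof.
  revert n; apply set_ext_the.
  destruct (ZF_infinity hZF) as [w hw].
  exists (sep w is_natural); intros n; rewrite sep_spec by dfn.
  split; [tauto|intros h; split; [exact (h w hw)|exact h]].
Qed.

Lemma nat_0 : empty ∈ omega.
Proof. apply omega_spec; intros w hw; apply inductive_iff in hw; tauto. Qed.

Lemma nat_succ n : n ∈ omega -> succ n ∈ omega.
Proof.
  rewrite !omega_spec; intros h w hw; specialize (h w hw).
  apply inductive_iff in hw; destruct hw; auto.
Qed.

Lemma nat_ind (P : V -> Prop) : D1 P -> P empty ->
  (forall n, n ∈ omega -> P n -> P (succ n)) -> forall n, n ∈ omega -> P n.
Proof.
  intros HP H0 H1 n hn; apply (sep_spec omega P n HP).
  apply omega_spec; [exact hn|]; apply inductive_iff; split.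
  - apply sep_spec; [exact HP|split; [exact nat_0|exact H0]].
  - intros m hm; apply sep_spec in hm; [|exact HP]; destruct hm.
    apply sep_spec; [exact HP|split; [apply nat_succ; assumption|auto]].
Qed.

End NaturalInduction.

#[global] Opaque omega.

Ltac nat_induction :=
  lazymatch goal with
  | |- forall n, n ∈ omega -> @?P n => apply (nat_ind P); cbv beta; [dfn| |]
  end.

Section NaturalOrder.
Context {V : set_structure} {hZF : ZF V}.

Lemma nat_transitive n : n ∈ omega -> forall m, m ∈ n -> m ∈ omega /\ subset m n.
Proof.
  revert n; nat_induction.
  - intros m hm; destruct (empty_spec m hm).
  - intros n hn IH m hm; apply succ_spec in hm; destruct hm as [hm| ->].
    + destruct (IH m hm) as [a b]; split; [exact a|].
      intros z hz; apply succ_spec; auto.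
    + split; [exact hn|intros z hz; apply succ_spec; auto].
Qed.

Lemma nat_mem n m : n ∈ omega -> m ∈ n -> m ∈ omega.
Proof. intros hn hm; exact (proj1 (nat_transitive n hn m hm)). Qed.

Lemma nat_trans n m l : n ∈ omega -> l ∈ m -> m ∈ n -> l ∈ n.
Proof. intros hn hl hm; exact (proj2 (nat_transitive n hn m hm) l hl). Qed.

(** Foundation is applied inside the model, which may be ill-founded from outside. *)
Lemma mem_irrefl (x : V) : x ∉ x.
Proof.
  intros h; destruct (ZF_foundation hZF (x := sing x)) as (y & hy & H).
  - exists x; apply sing_spec; reflexivity.
  - apply sing_spec in hy; subst y; apply (H x); [apply sing_spec; reflexivity|exact h].
Qed.

Lemma nat_asym n m : n ∈ omega -> n ∈ m -> m ∈ n -> False.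
Proof. intros hn h1 h2; apply (mem_irrefl n), (nat_trans n m n); assumption. Qed.

Lemma nat_0_le n : n ∈ omega -> n = empty \/ empty ∈ n.
Proof.
  revert n; nat_induction; [auto|].
  intros n _ IH; right; apply succ_spec; destruct IH as [->|h]; auto.
Qed.

Lemma nat_total n : n ∈ omega -> forall m, m ∈ omega -> m ∈ n \/ m = n \/ n ∈ m.
Proof.
  revert n; nat_induction.
  - intros m hm; destruct (nat_0_le m hm); auto.
  - intros n hn IH; nat_induction.
    + left; apply succ_spec; destruct (nat_0_le n hn) as [->|]; auto.
    + intros m hm IHm; rewrite !succ_spec.
      destruct IHm as [h|[h|h]]; [|subst; auto|auto].
      apply succ_spec in h; destruct h as [h| ->]; [|auto].
      destruct (IH (succ m) (nat_succ m hm)) as [h'|[h'|h']]; auto.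
      apply succ_spec in h'; destruct h' as [h'| ->]; exfalso.
      * apply (nat_asym n m); assumption.
      * apply (mem_irrefl m h).
Qed.

End NaturalOrder.

(** * Recursion on the natural numbers *)

Section SuccInjective.
Context {V : set_structure} {hZF : ZF V}.

Lemma bigcup_succ n : n ∈ omega -> bigcup (succ n) = n.
Proof.
  intros hn; apply ext_eq; intros z; rewrite bigcup_spec; split.
  - intros (y & hy & hz); apply succ_spec in hy; destruct hy as [hy| ->]; [|exact hz].
    apply (nat_trans n y z); assumption.
  - intros hz; exists n; split; [apply succ_spec; auto|exact hz].
Qed.

Lemma succ_inj n m : n ∈ omega -> m ∈ omega -> succ n = succ m -> n = m.
Proof. intros hn hm E; rewrite <- (bigcup_succ n hn), E; apply bigcup_succ, hm. Qed.

Lemma mem_succ n : n ∈ succ n.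
Proof. apply succ_spec; right; reflexivity. Qed.

Lemma eq_succ_mem {n m} : n = succ m -> m ∈ n.
Proof. intros ->; apply mem_succ. Qed.

End SuccInjective.

Ltac nat_side :=
  solve [ assumption | apply nat_0 | apply nat_succ; nat_side
        | match goal with H : ?a ∈ ?n |- ?a ∈ omega =>
            apply (nat_mem n a); [solve [assumption | repeat apply nat_succ; assumption]|exact H] end ].

Ltac nat_order_split :=
  repeat match goal with
  | H : _ /\ _ |- _ => destruct H
  | H : _ \/ _ |- _ => destruct H
  | H : ~ (_ \/ _) |- _ => apply not_or_and in H; destruct H
  | H : ~ (_ /\ _) |- _ => apply not_and_or in H; destruct H
  | H : ~ ~ _ |- _ => apply NNPP in H
  | H : ?a = ?a |- _ => clear H
  | H : ?a <> ?a |- _ => destruct (H eq_refl)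
  | H : ?a ∉ ?b, K : ?a ∈ ?b |- _ => destruct (H K)
  | H : ?a = ?b |- _ => subst a || subst b
  | H : succ ?a = succ ?b |- _ =>
      apply succ_inj in H; [|nat_side|nat_side]
  | H : ?a = succ ?b |- _ =>
      pose proof (eq_succ_mem H); clear H
  | H : succ ?b = ?a |- _ =>
      pose proof (eq_succ_mem (eq_sym H)); clear H
  | H : ?a ∈ succ ?b |- _ =>
      lazymatch a with b => fail | _ => apply succ_spec in H; destruct H end
  | H : ?a ∉ ?b |- _ =>
      let ha := fresh in let hb := fresh in let h := fresh in
      assert (ha : a ∈ omega) by nat_side; assert (hb : b ∈ omega) by nat_side;
      destruct (nat_total b hb a ha) as [h|[h|h]]; clear ha hb;
        [destruct (H h)|clear H|clear H]
  | H : ?a <> ?b |- _ =>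
      let ha := fresh in let hb := fresh in let h := fresh in
      assert (ha : a ∈ omega) by nat_side; assert (hb : b ∈ omega) by nat_side;
      destruct (nat_total b hb a ha) as [h|[h|h]]; clear ha hb;
        [clear H|destruct (H h)|clear H]
  end.
Ltac nat_order_saturate :=
  repeat match goal with
  | H : ?a ∈ ?a |- _ => destruct (mem_irrefl a H)
  | H : ?a ∈ empty |- _ => destruct (empty_spec a H)
  | H1 : ?a ∈ ?b, H2 : ?b ∈ ?c |- _ =>
      lazymatch c with omega => fail | _ => idtac end;
      lazymatch goal with K : a ∈ c |- _ => fail | _ => idtac end;
      assert (a ∈ c) by (apply (nat_trans c b a); [nat_side|exact H1|exact H2])
  end.
Ltac nat_order_succ :=
  repeat match goal with
  | H : context [succ ?a] |- _ =>
      lazymatch goal with K : a ∈ succ a |- _ => fail | _ => idtac end;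
      assert (a ∈ succ a) by (apply succ_spec; right; reflexivity)
  end.
(* Refutes the negated goal by case distinctions on the linear order of the natural numbers
   and saturation under transitivity. *)
Ltac nord :=
  intros; apply NNPP; intro; exfalso; nat_order_succ;
  do 3 (nat_order_split; nat_order_succ; nat_order_saturate).

Section Recursion.
Context {V : set_structure} {hZF : ZF V}.

Definition approx (G : V -> V -> V) (g n : V) : Prop :=
  forall m, m ∈ n -> app g m = G m (lam m (fun x => app g x)).

(** Course-of-values recursion: [G] sees the restriction of the function to [n]. Describing the
    value through any approximation keeps [rec] definable. *)
Definition rec (G : V -> V -> V) (n : V) : V :=
  the (fun y => exists g, approx G g n /\ y = G n (lam n (fun x => app g x))).

Lemma D_approx k (G : env k -> V -> V -> V) g n :
  T (S (S k)) (fun e => G (tl (tl e)) (hd (tl e)) (hd e)) -> T k g -> T k n ->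
  D k (fun e => approx (G e) (g e) (n e)).
Proof. intros; unfold approx; dfn. Qed.

Lemma T_rec k (G : env k -> V -> V -> V) n :
  T (S (S k)) (fun e => G (tl (tl e)) (hd (tl e)) (hd e)) -> T k n ->
  T k (fun e => rec (G e) (n e)).
Proof.
  intros; unfold rec, approx; apply T_the; dfn.
Qed.

End Recursion.

Ltac dfn_recursion := first [dfn_naturals | apply T_rec | apply D_approx].
Ltac dfn_lemma ::= dfn_recursion.

Section RecursionTheorem.
Context {V : set_structure} {hZF : ZF V}.

Variable G : V -> V -> V.
Hypothesis hG : T2 G.

Lemma approx_unique g g' : forall n, n ∈ omega -> approx G g n -> approx G g' n ->
  forall m, m ∈ n -> app g m = app g' m.
Proof.
  nat_induction.
  - intros _ _ m hm; destruct (empty_spec m hm).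
  - intros n hn IH H H' m hm.
    assert (E : lam n (fun x => app g x) = lam n (fun x => app g' x)).
    { apply lam_ext; [dfn|dfn|]; apply IH; intros x hx;
        [apply H|apply H']; apply succ_spec; auto. }
    apply succ_spec in hm; destruct hm as [hm| ->].
    + apply IH; try assumption; intros x hx; [apply H|apply H']; apply succ_spec; auto.
    + rewrite H, H' by (apply succ_spec; auto); rewrite E; reflexivity.
Qed.

Lemma approx_rec g n : n ∈ omega -> approx G g n -> rec G n = G n (lam n (fun x => app g x)).
Proof.
  intros hn H; apply the_eq; [|eauto].
  exists (G n (lam n (fun x => app g x))); split; [eauto|].
  intros y (g' & H' & ->); apply (f_equal (G _)), lam_ext; [dfn|dfn|].
  exact (approx_unique g g' n hn H H').
Qed.

Lemma approx_rec_app g n : n ∈ omega -> approx G g n -> forall m, m ∈ n -> rec G m = app g m.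
Proof.
  intros hn H m hm; rewrite (H m hm); apply approx_rec; [exact (nat_mem n m hn hm)|].
  intros x hx; apply H, (nat_trans n m x); assumption.
Qed.

Lemma approx_exists : forall n, n ∈ omega -> exists g, approx G g n.
Proof.
  nat_induction.
  - exists empty; intros m hm; destruct (empty_spec m hm).
  (* [g] is only known to be correct below [n]; tabulating [rec G] up to and including [n] supplies
     the missing value. *)
  - intros n hn (g & H); exists (lam (succ n) (rec G)); intros m hm.
    assert (hT : T1 (rec G)) by dfn.
    assert (hm' : m ∈ omega) by nat_side.
    rewrite app_lam by assumption.
    assert (Hm : approx G g m).
    { intros x hx; apply H; nord. }
    rewrite (approx_rec g m hm' Hm); apply (f_equal (G _)), lam_ext; [dfn|dfn|].
    intros x hx; rewrite app_lam; [|exact hT|nord].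
    symmetry; apply (approx_rec_app g m); assumption.
Qed.

Theorem rec_eq n : n ∈ omega -> rec G n = G n (lam n (rec G)).
Proof.
  intros hn; destruct (approx_exists n hn) as [g H].
  rewrite (approx_rec g n hn H); apply (f_equal (G _)), lam_ext; [dfn|dfn|].
  intros x hx; symmetry; apply (approx_rec_app g n); assumption.
Qed.

End RecursionTheorem.

#[global] Opaque rec approx.

(** * Binary expansions and hereditarily finite sets *)

Section PrimitiveRecursion.
Context {V : set_structure} {hZF : ZF V}.

(** The predecessor of a nonzero natural number is its union, see [bigcup_succ]. *)
Definition nrec (a : V) (F : V -> V -> V) (n : V) : V :=
  rec (fun n g => ite (n = empty) a (F (bigcup n) (app g (bigcup n)))) n.

Lemma T_nrec k a (F : env k -> V -> V -> V) n : T k a ->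
  T (S (S k)) (fun e => F (tl (tl e)) (hd (tl e)) (hd e)) -> T k n ->
  T k (fun e => nrec (a e) (F e) (n e)).
Proof. intros; unfold nrec; dfn. Qed.

Lemma nrec_0 a F : T2 F -> nrec a F empty = a.
Proof.
  intros hF; unfold nrec; rewrite rec_eq; [|dfn|apply nat_0].
  apply ite_true; reflexivity.
Qed.

Lemma nrec_succ a F n : T2 F -> n ∈ omega -> nrec a F (succ n) = F n (nrec a F n).
Proof.
  intros hF hn; unfold nrec at 1; rewrite rec_eq; [|dfn|nat_side].
  assert (hs : n ∈ succ n) by (apply succ_spec; auto).
  rewrite ite_false, (bigcup_succ n hn), app_lam; [reflexivity|dfn|exact hs|].
  intros e; rewrite e in hs; exact (empty_spec n hs).
Qed.

Definition least (P : V -> Prop) : V :=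
  the (fun n => n ∈ omega /\ P n /\ forall m, m ∈ n -> ~ P m).

(** A membership-minimal element, obtained from Foundation, is least because the naturals are
    linearly ordered by membership. *)
Lemma least_spec P : D1 P -> (exists n, n ∈ omega /\ P n) ->
  least P ∈ omega /\ P (least P) /\ forall m, m ∈ least P -> ~ P m.
Proof.
  intros hP [n [hn hn']].
  apply (the_spec (fun n => n ∈ omega /\ P n /\ forall m, m ∈ n -> ~ P m)).
  destruct (ZF_foundation hZF (x := sep omega P)) as (y & hy & H).
  { exists n; apply sep_spec; auto. }
  apply sep_spec in hy; [|exact hP]; destruct hy as [hy hPy].
  assert (H' : forall m, m ∈ y -> ~ P m).
  { intros m hm hPm; apply (H m); [apply sep_spec; [exact hP|]|exact hm].
    split; [nat_side|exact hPm]. }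
  exists y; split; [auto|]; intros z (hz & hPz & hz').
  destruct (nat_total y hy z hz) as [h|[h|h]]; [|auto|].
  - destruct (H' z h hPz).
  - destruct (hz' y h hPy).
Qed.

Lemma least_eq P n : n ∈ omega -> P n -> (forall m, m ∈ n -> ~ P m) -> least P = n.
Proof.
  intros hn h h'; apply (the_eq (fun n => n ∈ omega /\ P n /\ forall m, m ∈ n -> ~ P m));
    [|auto].
  exists n; split; [auto|]; intros m (hm & g & g').
  destruct (nat_total m hm n hn) as [e|[e|e]]; [|auto|].
  - destruct (g' n e h).
  - destruct (h' m e g).
Qed.

Lemma T_least k (P : env k -> V -> Prop) :
  D (S k) (fun e => P (tl e) (hd e)) -> T k (fun e => least (P e)).
Proof. intros; unfold least; apply T_the; dfn. Qed.

End PrimitiveRecursion.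

#[global] Opaque nrec least.
Ltac dfn_primitive_recursion := first [dfn_recursion | apply T_nrec | apply T_least].
Ltac dfn_lemma ::= dfn_primitive_recursion.

Section BinaryExpansions.
Context {V : set_structure} {hZF : ZF V}.

(** A set of naturals is read as a binary numeral, the set of positions of its ones. The carry in
    adding one stops at the lowest zero [mu s]: the ones below it are cleared and it becomes a
    one. *)
Definition mu (s : V) : V := least (fun n => n ∉ s).
Definition increment (s : V) : V := adj (sep s (fun x => x ∉ mu s)) (mu s).
Definition bit (n : V) : V := nrec empty (fun _ s => increment s) n.

Lemma T_mu k (t : env k -> V) : T k t -> T k (fun e => mu (t e)).
Proof. intros; unfold mu; dfn. Qed.
Lemma T_bit k (t : env k -> V) : T k t -> T k (fun e => bit (t e)).
Proof. intros; unfold bit, increment, mu; dfn. Qed.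

End BinaryExpansions.

Ltac dfn_binary := first [dfn_primitive_recursion | apply T_mu | apply T_bit].
Ltac dfn_lemma ::= dfn_binary.

Section BinaryExpansionsTheory.
Context {V : set_structure} {hZF : ZF V}.

Lemma mu_spec s : (exists n, n ∈ omega /\ n ∉ s) ->
  mu s ∈ omega /\ mu s ∉ s /\ subset (mu s) s.
Proof.
  intros h; destruct (least_spec (fun n => n ∉ s) ltac:(dfn) h) as (a & b & c).
  split; [exact a|split; [exact b|]]; intros m hm; apply NNPP; exact (c m hm).
Qed.

Lemma mu_eq s n : n ∈ omega -> n ∉ s -> subset n s -> mu s = n.
Proof. intros hn h h'; apply least_eq; [exact hn|exact h|intros m hm g; apply g, h', hm]. Qed.

Lemma increment_spec s z : z ∈ increment s <-> (z ∈ s /\ z ∉ mu s) \/ z = mu s.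
Proof. unfold increment; rewrite adj_spec, sep_spec by dfn; reflexivity. Qed.

Lemma bit_0 : bit empty = empty.
Proof. apply nrec_0; dfn. Qed.

Lemma bit_succ n : n ∈ omega -> bit (succ n) = increment (bit n).
Proof. intros hn; unfold bit; rewrite nrec_succ; [reflexivity|dfn|exact hn]. Qed.

(** Position [n] is a zero in the numeral of [n], so the carry stops at or below [n]. *)
Lemma bit_subset : forall n, n ∈ omega -> subset (bit n) n.
Proof.
  nat_induction.
  - rewrite bit_0; intros z hz; exact hz.
  - intros n hn IH z hz; rewrite (bit_succ n hn), increment_spec in hz.
    apply succ_spec; destruct hz as [[hz _]| ->]; [left; apply IH, hz|].
    assert (hn' : n ∉ bit n) by (intros h; apply (mem_irrefl n), IH, h).
    destruct (mu_spec (bit n)) as (a & b & c); [eauto|].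
    assert (h : n ∉ mu (bit n)) by (intros h; apply hn', c, h).
    generalize dependent (mu (bit n)); intros m **; clear - hn a h. apply NNPP; intros H.
    destruct (nat_total n hn m a) as [h'|[h'|h']]; tauto.
Qed.

Lemma mu_bit n : n ∈ omega -> mu (bit n) ∈ omega /\ mu (bit n) ∉ bit n /\
  subset (mu (bit n)) (bit n) /\ n ∉ mu (bit n).
Proof.
  intros hn; assert (hn' : n ∉ bit n)
    by (intros h; apply (mem_irrefl n), (bit_subset n hn), h).
  destruct (mu_spec (bit n)) as (a & b & c); [eauto|].
  split; [exact a|split; [exact b|split; [exact c|]]].
  intros h; apply hn', c, h.
Qed.

Definition has_code (s : V) : Prop := exists k, k ∈ omega /\ bit k = s.

(* Incrementing the set [u ∪ n] carries into [n], which makes [u ∪ {n}] reachable. *)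
Lemma bit_reaches : forall n, n ∈ omega -> forall u, has_code u ->
  (forall x, x ∈ u -> x ∉ n) -> forall s, subset s n -> has_code (union2 u s).
Proof.
  unfold has_code; nat_induction.
  - intros u hu _ s hs; replace (union2 u s) with u; [exact hu|].
    apply ext_eq; intros z; rewrite union2_spec; split; [auto|].
    intros [h|h]; [exact h|destruct (empty_spec z (hs z h))].
  - intros n hn IH u hu du s hs.
    assert (dn : forall x, x ∈ u -> x ∉ n) by (intros x hx h; apply (du x hx), succ_spec; auto).
    destruct (classic (n ∈ s)) as [hns|hns].
    + assert (hnu : n ∉ u) by (intros h; apply (du n h), succ_spec; auto).
      destruct (IH u hu dn n ltac:(intros z; tauto)) as (k & hk & ek).
      assert (em : mu (bit k) = n).
      { rewrite ek; apply mu_eq; [exact hn| |intros z hz; apply union2_spec; auto].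
        intros h; apply union2_spec in h; destruct h; [tauto|exact (mem_irrefl n H)]. }
      assert (hu' : has_code (adj u n)).
      { exists (succ k); split; [nat_side|]; rewrite (bit_succ k hk).
        apply ext_eq; intros z; rewrite increment_spec, em, ek, union2_spec, adj_spec.
        specialize (dn z); tauto. }
      replace (union2 u s) with (union2 (adj u n) (sep s (fun x => x ∈ n))).
      * apply IH; [exact hu'| |].
        -- intros x hx; apply adj_spec in hx; destruct hx as [hx| ->]; [auto|].
           apply mem_irrefl.
        -- intros x hx; apply sep_spec in hx; [tauto|dfn].
      * apply ext_eq; intros z; rewrite !union2_spec, adj_spec, sep_spec by dfn.
        split; [intros [[h| ->]|h]; tauto|intros [h|h]; [auto|]].
        specialize (hs z h); apply succ_spec in hs; tauto.
    + apply IH; try assumption.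
      intros z hz; specialize (hs z hz); apply succ_spec in hs; destruct hs as [h| ->]; tauto.
Qed.

Lemma bit_surjective n s : n ∈ omega -> subset s n -> has_code s.
Proof.
  intros hn hs; replace s with (union2 empty s).
  - apply (bit_reaches n); [exact hn| |intros x hx; destruct (empty_spec x hx)|exact hs].
    exists empty; split; [apply nat_0|apply bit_0].
  - apply ext_eq; intros z; rewrite union2_spec; pose proof (empty_spec z); tauto.
Qed.

(* Ackermann's enumeration of the hereditarily finite sets. *)
Definition hf (n : V) : V := rec (fun n g => img (bit n) (fun m => app g m)) n.
Definition HF : V := img omega hf.
(** [HF] is the common countable universe of streams, stages, trees and underlying sets. Through
    [code] its subsets become subsets of omega, the only sets that [DC_R] can choose. *)
Definition code (x : V) : V := least (fun n => hf n = x).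

End BinaryExpansionsTheory.
Ltac dfn_hf := first [dfn_binary ].
Ltac dfn_lemma ::= dfn_hf.
Section HereditarilyFinite.
Context {V : set_structure} {hZF : ZF V}.

Lemma T_code k (t : env k -> V) : T k t -> T k (fun e => code (t e)).
Proof. intros; unfold code; dfn. Qed.

Lemma hf_eq n z : n ∈ omega -> (z ∈ hf n <-> exists m, m ∈ bit n /\ z = hf m).
Proof.
  intros hn; unfold hf at 1; rewrite rec_eq; [|dfn|exact hn].
  rewrite img_spec by dfn.
  split; intros (m & hm & ->); exists m; (split; [exact hm|]);
    rewrite app_lam; try reflexivity; try dfn; apply bit_subset; assumption.
Qed.

Lemma HF_spec x : x ∈ HF <-> exists n, n ∈ omega /\ x = hf n.
Proof. unfold HF; apply img_spec; dfn. Qed.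

Lemma empty_HF : empty ∈ HF.
Proof.
  apply HF_spec; exists empty; split; [apply nat_0|].
  apply ext_eq; intros z; rewrite hf_eq, bit_0 by apply nat_0.
  split; [intros h; destruct (empty_spec z h)|intros (m & h & _); destruct (empty_spec m h)].
Qed.

Lemma nat_bound a b : a ∈ omega -> b ∈ omega -> exists c, c ∈ omega /\ a ∈ c /\ b ∈ c.
Proof.
  intros ha hb; destruct (nat_total a ha b hb) as [h|[h|h]].
  - exists (succ a); split; [nat_side|split; nord].
  - exists (succ a); split; [nat_side|split; nord].
  - exists (succ b); split; [nat_side|split; nord].
Qed.

(** By [bit_surjective] the set of codes enlarged by one further code is again the set of ones of
    some natural number. *)
Lemma adj_HF x y : x ∈ HF -> y ∈ HF -> adj x y ∈ HF.
Proof.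
  intros hx hy; apply HF_spec in hx, hy.
  destruct hx as (n & hn & ->), hy as (m & hm & ->).
  destruct (nat_bound n m hn hm) as (l & hl & h1 & h2).
  destruct (bit_surjective l (adj (bit n) m) hl) as (k & hk & ek).
  - intros z hz; apply adj_spec in hz; destruct hz as [hz| ->]; [|exact h2].
    apply (bit_subset n hn) in hz; apply (nat_trans l n); assumption.
  - apply HF_spec; exists k; split; [exact hk|]; apply ext_eq; intros z.
    rewrite adj_spec, !hf_eq, ek by assumption; split.
    + intros [(i & hi & ->)| ->]; [exists i|exists m]; rewrite adj_spec; auto.
    + intros (i & hi & ->); apply adj_spec in hi; destruct hi as [hi| ->]; eauto.
Qed.

Lemma omega_HF n : n ∈ omega -> n ∈ HF.
Proof.
  revert n; nat_induction; [apply empty_HF|].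
  intros n hn IH; rewrite succ_eq; apply adj_HF; assumption.
Qed.

Lemma upair_HF x y : x ∈ HF -> y ∈ HF -> upair x y ∈ HF.
Proof.
  intros hx hy; replace (upair x y) with (adj (adj empty x) y).
  - apply adj_HF; [apply adj_HF; [apply empty_HF|exact hx]|exact hy].
  - apply ext_eq; intros z; rewrite !adj_spec, upair_spec.
    pose proof (empty_spec z); tauto.
Qed.

Lemma opair_HF x y : x ∈ HF -> y ∈ HF -> opair x y ∈ HF.
Proof. intros hx hy; rewrite upair_opair; apply upair_HF; apply upair_HF; assumption. Qed.

Lemma code_spec x : x ∈ HF -> code x ∈ omega /\ hf (code x) = x.
Proof.
  intros hx; apply HF_spec in hx; destruct hx as (n & hn & ->).
  destruct (least_spec (fun m => hf m = hf n) ltac:(dfn)) as (a & b & _); [eauto|auto].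
Qed.

Lemma code_inj x y : x ∈ HF -> y ∈ HF -> code x = code y -> x = y.
Proof.
  intros hx hy e; rewrite <- (proj2 (code_spec x hx)), <- (proj2 (code_spec y hy)), e.
  reflexivity.
Qed.

End HereditarilyFinite.

#[global] Opaque mu increment bit hf HF code.
Ltac dfn_code := first [dfn_hf | apply T_code].
Ltac dfn_lemma ::= dfn_code.

(** * Counting and the relativised Ramsey property *)

Section Counting.
Context {V : set_structure} {hZF : ZF V}.

(* The cardinality of [z ∩ n]. *)
Definition cnt (z n : V) : V := nrec empty (fun m c => ite (m ∈ z) (succ c) c) n.

Lemma T_cnt k (t u : env k -> V) : T k t -> T k u -> T k (fun e => cnt (t e) (u e)).
Proof. intros; unfold cnt; dfn. Qed.

(** Unboundedness stands in for the definition by bijections; [infinite_unbounded] proves them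
    equivalent. *)
Definition Inf (x : V) : Prop :=
  subset x omega /\ forall n, n ∈ omega -> exists m, m ∈ x /\ n ∈ m.

Lemma D_Inf k (t : env k -> V) : T k t -> D k (fun e => Inf (t e)).
Proof. intros; unfold Inf; dfn. Qed.

End Counting.

Ltac dfn_counting := first [dfn_code | apply T_cnt | apply D_Inf].
Ltac dfn_lemma ::= dfn_counting.

Ltac nord_cnt :=
  repeat match goal with
  | |- context [cnt ?z ?n] => generalize dependent (cnt z n); intros
  | H : context [cnt ?z ?n] |- _ => generalize dependent (cnt z n); intros
  end; nord.

Section CountingTheory.
Context {V : set_structure} {hZF : ZF V}.

Lemma cnt_0 z : cnt z empty = empty.
Proof. apply nrec_0; dfn. Qed.

Lemma cnt_in z n : n ∈ omega -> n ∈ z -> cnt z (succ n) = succ (cnt z n).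
Proof.
  intros hn h; unfold cnt at 1; rewrite nrec_succ; [|dfn|exact hn].
  apply ite_true, h.
Qed.

Lemma cnt_out z n : n ∈ omega -> n ∉ z -> cnt z (succ n) = cnt z n.
Proof.
  intros hn h; unfold cnt at 1; rewrite nrec_succ; [|dfn|exact hn].
  apply ite_false, h.
Qed.

Lemma cnt_nat z : forall n, n ∈ omega -> cnt z n ∈ omega.
Proof.
  nat_induction; [rewrite cnt_0; apply nat_0|].
  intros n hn IH; destruct (classic (n ∈ z)) as [h|h].
  - rewrite cnt_in by assumption; apply nat_succ, IH.
  - rewrite cnt_out by assumption; exact IH.
Qed.

Lemma cnt_local z z' : forall n, n ∈ omega ->
  (forall m, m ∈ n -> (m ∈ z <-> m ∈ z')) -> cnt z n = cnt z' n.
Proof.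
  nat_induction; [intros _; rewrite !cnt_0; reflexivity|].
  intros n hn IH H.
  assert (IH' : cnt z n = cnt z' n) by (apply IH; intros m hm; apply H, succ_spec; auto).
  assert (hn' : n ∈ z <-> n ∈ z') by (apply H, succ_spec; auto).
  destruct (classic (n ∈ z)) as [h|h].
  - rewrite !cnt_in, IH' by tauto; reflexivity.
  - rewrite !cnt_out, IH' by tauto; reflexivity.
Qed.

Lemma cnt_le z : forall n, n ∈ omega -> cnt z n ∈ succ n.
Proof.
  nat_induction; [rewrite cnt_0; apply succ_spec; auto|].
  intros n hn IH; pose proof (cnt_nat z n hn) as hc.
  destruct (classic (n ∈ z)) as [h|h].
  - rewrite cnt_in by assumption; clear h; nord_cnt.
  - rewrite cnt_out by assumption; clear h; nord_cnt.
Qed.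

Lemma cnt_mono z : forall n, n ∈ omega -> forall m, m ∈ succ n -> cnt z m ∈ succ (cnt z n).
Proof.
  nat_induction.
  - intros m hm; apply succ_spec in hm; destruct hm as [h| ->];
      [destruct (empty_spec m h)|apply succ_spec; auto].
  - intros n hn IH m hm; apply succ_spec in hm; destruct hm as [hm| ->];
      [|apply succ_spec; auto].
    specialize (IH m hm).
    assert (hm' : m ∈ omega) by nat_side.
    pose proof (cnt_nat z n hn) as hc; pose proof (cnt_nat z m hm') as hc'.
    destruct (classic (n ∈ z)) as [h|h].
    + rewrite cnt_in by assumption; clear - hZF IH hc hc'. nord_cnt.
    + rewrite cnt_out by assumption; exact IH.
Qed.

Lemma cnt_lt z n m : n ∈ omega -> m ∈ n -> m ∈ z -> cnt z m ∈ cnt z n.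
Proof.
  intros hn hm h.
  assert (hm' : m ∈ omega) by nat_side.
  assert (h' : succ m ∈ succ n) by nord.
  pose proof (cnt_mono z n hn _ h') as H; rewrite cnt_in in H by assumption.
  pose proof (cnt_nat z n hn) as hc; pose proof (cnt_nat z m hm') as hc'.
  clear - hZF H hc hc'; nord_cnt.
Qed.

Lemma cnt_inj z n m : n ∈ omega -> m ∈ omega -> n ∈ z -> m ∈ z -> cnt z n = cnt z m -> n = m.
Proof.
  intros hn hm h h' e; destruct (nat_total n hn m hm) as [g|[g|g]]; [|auto|]; exfalso.
  - pose proof (cnt_lt z n m hn g h') as H; rewrite e in H; exact (mem_irrefl _ H).
  - pose proof (cnt_lt z m n hm g h) as H; rewrite e in H; exact (mem_irrefl _ H).
Qed.

Lemma cnt_gap z m : m ∈ omega -> forall n, n ∈ omega -> m ∈ succ n ->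
  (forall x, x ∈ n -> x ∈ z -> x ∈ m) -> cnt z n = cnt z m.
Proof.
  intros hm; nat_induction.
  - intros h _; apply succ_spec in h; destruct h as [h| ->];
      [destruct (empty_spec m h)|reflexivity].
  - intros n hn IH h H; apply succ_spec in h; destruct h as [h| ->]; [|reflexivity].
    rewrite cnt_out; [apply IH; [exact h|]|exact hn|].
    + intros x hx; apply H, succ_spec; auto.
    + intros hz; assert (n ∈ m) by (apply H; [apply succ_spec; auto|exact hz]); nord.
Qed.

Lemma cnt_surj z : forall n, n ∈ omega -> forall k, k ∈ cnt z n ->
  exists m, m ∈ n /\ m ∈ z /\ cnt z m = k.
Proof.
  nat_induction.
  - intros k hk; rewrite cnt_0 in hk; destruct (empty_spec k hk).
  - intros n hn IH k hk; destruct (classic (n ∈ z)) as [h|h].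
    + rewrite cnt_in in hk by assumption; apply succ_spec in hk; destruct hk as [hk| ->].
      * destruct (IH k hk) as (m & a & b & c); exists m; rewrite succ_spec; auto.
      * exists n; rewrite succ_spec; auto.
    + rewrite cnt_out in hk by assumption.
      destruct (IH k hk) as (m & a & b & c); exists m; rewrite succ_spec; auto.
Qed.

Lemma Inf_nat z m : Inf z -> m ∈ z -> m ∈ omega.
Proof. intros [h _]; apply h. Qed.

(** Together with [cnt_inj] this makes [cnt z], restricted to an infinite [z], the inverse of the
    increasing enumeration of [z]. *)
Lemma cnt_onto z : Inf z -> forall k, k ∈ omega -> exists m, m ∈ z /\ cnt z m = k.
Proof.
  intros hz.
  enough (H : forall k, k ∈ omega -> exists n, n ∈ omega /\ k ∈ cnt z n).
  { intros k hk; destruct (H k hk) as (n & hn & h).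
    destruct (cnt_surj z n hn k h) as (m & _ & h'); eauto. }
  nat_induction.
  - destruct (proj2 hz empty nat_0) as (m & hm & _); pose proof (Inf_nat z m hz hm) as hm'.
    exists (succ m); split; [nat_side|]; rewrite cnt_in by assumption.
    pose proof (cnt_nat z m hm') as hc; destruct (nat_0_le _ hc) as [->|h];
      apply succ_spec; auto.
  - intros k hk (n & hn & h); destruct (proj2 hz n hn) as (m & hm & hnm).
    pose proof (Inf_nat z m hz hm) as hm'.
    exists (succ m); split; [nat_side|]; rewrite cnt_in by assumption.
    assert (h' : n ∈ succ m) by (apply succ_spec; auto).
    pose proof (cnt_mono z m hm' n h') as H.
    pose proof (cnt_nat z n hn) as hc; pose proof (cnt_nat z m hm') as hc'.
    clear - hZF H hc hc' h hk; nord_cnt.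
Qed.

(** Finitely many bounded sets have a common bound. The induction carries the bound existentially,
    so no bounds have to be chosen simultaneously. *)
Lemma collect_bound (R : V -> V -> Prop) : D2 R -> forall n, n ∈ omega ->
  (forall i, i ∈ n -> exists M, M ∈ omega /\ forall x, R i x -> x ∈ M) ->
  exists M, M ∈ omega /\ forall i x, i ∈ n -> R i x -> x ∈ M.
Proof.
  intros hR; nat_induction.
  - intros _; exists empty; split; [apply nat_0|].
    intros i x hi; destruct (empty_spec i hi).
  - intros n hn IH H.
    destruct IH as (M & hM & h); [intros i hi; apply H, succ_spec; auto|].
    destruct (H n) as (M' & hM' & h'); [apply succ_spec; auto|].
    destruct (nat_bound M M' hM hM') as (L & hL & a & b).
    exists L; split; [exact hL|]; intros i x hi hx; apply succ_spec in hi.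
    destruct hi as [hi| ->].
    + apply (nat_trans L M x); [exact hL|exact (h i x hi hx)|exact a].
    + apply (nat_trans L M' x); [exact hL|exact (h' x hx)|exact b].
Qed.

Lemma finite_bounded x : subset x omega -> finite x -> exists N, N ∈ omega /\ subset x N.
Proof.
  intros hx (n & f & hn & ((f1 & f2) & _) & fs).
  apply omega_spec in hn.
  destruct (collect_bound (fun i y => opair i y ∈ f /\ y ∈ omega) ltac:(dfn) n hn)
    as (M & hM & h).
  - intros i hi; destruct (f2 i hi) as (y & _ & uy).
    destruct (classic (y ∈ omega)) as [hy|hy].
    + exists (succ y); split; [nat_side|]; intros z (hz & _).
      rewrite <- (uy z); [apply succ_spec; auto|apply pair_in_iff, hz].
    + exists empty; split; [apply nat_0|]; intros z (hz & hz').
      rewrite <- (uy z) in hz' by (apply pair_in_iff, hz).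
      destruct hy; exact hz'.
  - exists M; split; [exact hM|]; intros y hy; destruct (fs y hy) as (i & hi).
    apply pair_in_iff in hi; apply (h i).
    + destruct (f1 _ hi) as (i' & y' & hi' & e).
      apply is_opair_iff, opair_inj in e; destruct e; subst; exact hi'.
    + split; [exact hi|apply hx, hy].
Qed.

Lemma bounded_finite x N : N ∈ omega -> subset x N -> finite x.
Proof.
  (* [cnt x] counts the elements of [x] in increasing order, so its transposed graph is a bijection
     from a natural number onto [x]. *)
  intros hN hx; exists (cnt x N), (img x (fun m => opair (cnt x m) m)).
  assert (hx' : forall m, m ∈ x -> m ∈ omega) by (intros m hm; apply (nat_mem N m hN), hx, hm).
  assert (S : forall a b, pair_in (img x (fun m => opair (cnt x m) m)) a b <->
    b ∈ x /\ a = cnt x b).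
  { intros a b; rewrite pair_in_iff, img_spec by dfn; split.
    - intros (m & hm & e); apply opair_inj in e; destruct e; subst; auto.
    - intros (hb & ->); eauto. }
  split; [apply omega_spec, cnt_nat, hN|].
  split; [split; [split|split]|].
  - intros p hp; apply img_spec in hp; [|dfn]; destruct hp as (m & hm & ->).
    exists (cnt x m), m; split; [apply cnt_lt; auto|apply is_opair_iff; reflexivity].
  - intros k hk; destruct (cnt_surj x N hN k hk) as (m & _ & hm & <-).
    exists m; split; [apply S; auto|]; intros m' h'; apply S in h'; destruct h' as [h' e].
    apply (cnt_inj x); auto.
  - intros a b h; apply S in h; tauto.
  - intros a b y h h'; apply S in h, h'; destruct h, h'; congruence.
  - intros y hy; exists (cnt x y); apply S; auto.
Qed.

Lemma infinite_unbounded x : inf_subset_omega x <-> Inf x.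
Proof.
  split; intros [h h'].
  - assert (hx : subset x omega) by (intros m hm; apply omega_spec, h, hm).
    split; [exact hx|]; intros n hn; apply NNPP; intros H; apply h'.
    apply (bounded_finite x (succ n)); [nat_side|]; intros m hm.
    pose proof (hx m hm) as hm'.
    assert (n ∉ m) by (intros h''; apply H; eauto); nord.
  - split; [intros m hm; apply omega_spec, h, hm|]; intros hf.
    destruct (finite_bounded x h hf) as (N & hN & hb).
    destruct (h' N hN) as (m & hm & hNm); specialize (hb m hm).
    apply (nat_asym N m); assumption.
Qed.

Lemma inf_subset_iff A x : subset A omega -> (inf_subset A x <-> Inf x /\ subset x A).
Proof.
  intros hA; rewrite <- infinite_unbounded; unfold inf_subset, inf_subset_omega; split.
  - intros [h h']; split; [split|]; auto; intros m hm; apply omega_spec, hA, h, hm.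
  - tauto.
Qed.

Lemma Inf_omega : Inf omega.
Proof.
  split; [intros z; auto|]; intros n hn; exists (succ n); split; [nat_side|].
  apply succ_spec; auto.
Qed.

(** The Ramsey property on omega is transported along the increasing enumeration of [H]; [pull y] is
    the image of [y] under that enumeration. *)
Lemma Ramsey_below (hR : all_sets_Ramsey V) H P : Inf H -> D1 P ->
  exists H', Inf H' /\ subset H' H /\
    ((forall x, Inf x -> subset x H' -> P x) \/ (forall x, Inf x -> subset x H' -> ~ P x)).
Proof.
  intros hH hP.
  set (pull := fun y => sep H (fun m => cnt H m ∈ y)).
  assert (pullS : forall y m, m ∈ pull y <-> m ∈ H /\ cnt H m ∈ y)
    by (intros; unfold pull; rewrite sep_spec by dfn; reflexivity).
  assert (hnat := fun m => Inf_nat H m hH).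
  assert (pullI : forall y, Inf y -> Inf (pull y)).
  { intros y hy; split; [intros m hm; apply pullS in hm; apply hnat, hm|].
    intros n hn; destruct (proj2 hy n hn) as (k & hk & hnk).
    pose proof (Inf_nat y k hy hk) as hk'.
    destruct (cnt_onto H hH k hk') as (m & hm & e).
    exists m; split; [apply pullS; rewrite e; auto|].
    pose proof (hnat m hm) as hm'; pose proof (cnt_le H m hm') as h; rewrite e in h.
    clear - hZF hn hk' hm' hnk h; nord. }
  destruct (hR (sep (power omega) (fun y => Inf y /\ P (pull y)))) as (A & hA & hom).
  { intros y hy; apply sep_spec in hy; [|unfold pull; dfn].
    apply infinite_unbounded; tauto. }
  apply infinite_unbounded in hA.
  exists (pull A); split; [apply pullI, hA|split; [intros m hm; apply pullS in hm; tauto|]].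
  assert (E : forall x, Inf x -> subset x (pull A) ->
    exists y, Inf y /\ subset y A /\ pull y = x).
  { intros x hx hxA; exists (img x (cnt H)).
    assert (iS : forall k, k ∈ img x (cnt H) <-> exists m, m ∈ x /\ k = cnt H m)
      by (intros; rewrite img_spec by dfn; reflexivity).
    assert (hxH : forall m, m ∈ x -> m ∈ H) by (intros m hm; apply hxA, pullS in hm; tauto).
    split; [split|split].
    - intros k hk; apply iS in hk; destruct hk as (m & hm & ->); apply cnt_nat; auto.
    - intros n hn; destruct (cnt_onto H hH n hn) as (m & hm & <-).
      destruct (proj2 hx m (hnat m hm)) as (m' & hm' & h).
      exists (cnt H m'); split; [apply iS; eauto|apply cnt_lt; auto].
    - intros k hk; apply iS in hk; destruct hk as (m & hm & ->).
      apply hxA, pullS in hm; tauto.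
    - apply ext_eq; intros m; rewrite pullS, iS; split.
      + intros (hm & m' & hm' & e); apply cnt_inj in e; subst; auto.
      + intros hm; split; [auto|eauto]. }
  destruct hom as [hom|hom]; [left|right]; intros x hx hxA;
    destruct (E x hx hxA) as (y & hy & hyA & <-);
    specialize (hom y (proj2 (inf_subset_iff A y (proj1 hA)) (conj hy hyA)));
    rewrite sep_spec in hom by (unfold pull; dfn); [tauto|].
  intros h; apply hom; split; [|tauto]; apply power_spec, hy.
Qed.

End CountingTheory.
#[global] Opaque cnt.

(** * Streams of units *)

Section Units.
Context {V : set_structure} {hZF : ZF V}.

Definition dom (w : V) : V := sep omega (fun a => exists b, opair a b ∈ w).

(* Labels split a stream into infinitely many streams: every label occurs infinitely often,
   and it depends only on the number of units before [a]. *)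
Definition label (w a : V) : V := mu (bit (cnt (dom w) a)).

Definition units (w : V) : Prop :=
  forall p, p ∈ w -> exists a b, a ∈ omega /\ b ∈ omega /\ a ∈ b /\ p = opair a b.

Definition functional (w : V) : Prop :=
  forall a b b', opair a b ∈ w -> opair a b' ∈ w -> b = b'.

(** Units of a stream may overlap. [block_ordered] is asked for only where a stream has to be
    recovered from the set of its entries. *)
Definition stream (w : V) : Prop :=
  units w /\ functional w /\ forall n, n ∈ omega -> exists a b, n ∈ a /\ opair a b ∈ w.

(** The finite pieces of streams. Membership in [HF] makes sets of stages accessible to choice, and
    the bound tells from where on new units come after all the old entries. *)
Definition stage (s : V) : Prop :=
  s ∈ HF /\ units s /\ functional s /\
  exists n, n ∈ omega /\ forall a b, opair a b ∈ s -> b ∈ n.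

Definition below (w m : V) : V := sep w (fun p => exists a b, p = opair a b /\ a ∈ m).
Definition rest (w m : V) : V := sep w (fun p => exists a b, p = opair a b /\ m ∈ a).
Definition part (w i : V) : V :=
  sep w (fun p => exists a b, p = opair a b /\ label w a = i).

Definition first_unit (w a b : V) : Prop :=
  opair a b ∈ w /\ forall a' b', opair a' b' ∈ w -> a' ∉ a.

Variable k : nat.
Implicit Types t u v : @env V k -> V.

Lemma D_stream t : T k t -> D k (fun e => stream (t e)).
Proof. intros; unfold stream, units, functional; dfn. Qed.
Lemma D_stage t : T k t -> D k (fun e => stage (t e)).
Proof. intros; unfold stage, units, functional; dfn. Qed.
Lemma T_below t u : T k t -> T k u -> T k (fun e => below (t e) (u e)).
Proof. intros; unfold below; dfn. Qed.
Lemma T_rest t u : T k t -> T k u -> T k (fun e => rest (t e) (u e)).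
Proof. intros; unfold rest; dfn. Qed.
Lemma T_part t u : T k t -> T k u -> T k (fun e => part (t e) (u e)).
Proof. intros; unfold part, label, dom; dfn. Qed.
Lemma D_first_unit t u v : T k t -> T k u -> T k v ->
  D k (fun e => first_unit (t e) (u e) (v e)).
Proof. intros; unfold first_unit; dfn. Qed.

End Units.

Ltac dfn_units := first [dfn_counting | apply D_stream | apply D_stage | apply T_below | apply T_rest
  | apply T_part | apply D_first_unit].
Ltac dfn_lemma ::= dfn_units.

Section UnitsTheory.
Context {V : set_structure} {hZF : ZF V}.

Lemma dom_spec w a : a ∈ dom w <-> a ∈ omega /\ exists b, opair a b ∈ w.
Proof. unfold dom; rewrite sep_spec by dfn; reflexivity. Qed.

Lemma sep_opair_spec w (P : V -> Prop) a b : D1 P ->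
  (opair a b ∈ sep w (fun p => exists a b, p = opair a b /\ P a) <-> opair a b ∈ w /\ P a).
Proof.
  intros hP; rewrite sep_spec by dfn; split.
  - intros (h & a' & b' & e & hp); apply opair_inj in e; destruct e; subst; auto.
  - intros (h & hp); eauto.
Qed.

Lemma below_spec w m a b : opair a b ∈ below w m <-> opair a b ∈ w /\ a ∈ m.
Proof. apply (sep_opair_spec w (fun a => a ∈ m)); dfn. Qed.

Lemma rest_spec w m a b : opair a b ∈ rest w m <-> opair a b ∈ w /\ m ∈ a.
Proof. apply (sep_opair_spec w (fun a => m ∈ a)); dfn. Qed.

Lemma part_spec w i a b : opair a b ∈ part w i <-> opair a b ∈ w /\ label w a = i.
Proof. unfold part; apply (sep_opair_spec w (fun a => label w a = i)); dfn. Qed.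

Lemma below_subset w m : subset (below w m) w.
Proof. apply sep_subset. Qed.

Lemma rest_subset w m : subset (rest w m) w.
Proof. apply sep_subset. Qed.

Lemma part_subset w i : subset (part w i) w.
Proof. apply sep_subset. Qed.

Lemma units_subset w w' : subset w w' -> units w' -> units w.
Proof. intros h hw p hp; apply hw, h, hp. Qed.

Lemma functional_subset w w' : subset w w' -> functional w' -> functional w.
Proof. intros h hw a b b' h1 h2; apply (hw a); apply h; assumption. Qed.

Lemma units_ext w w' : units w -> units w' ->
  (forall a b, a ∈ omega -> b ∈ omega -> a ∈ b -> (opair a b ∈ w <-> opair a b ∈ w')) ->
  w = w'.
Proof.
  intros hw hw' H; apply ext_eq; intros p; split; intros hp.
  - destruct (hw p hp) as (a & b & ha & hb & hab & ->); apply (H a b); assumption.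
  - destruct (hw' p hp) as (a & b & ha & hb & hab & ->); apply (H a b); assumption.
Qed.

Lemma units_mem w a b : units w -> opair a b ∈ w -> a ∈ omega /\ b ∈ omega /\ a ∈ b.
Proof.
  intros hw h; destruct (hw _ h) as (a' & b' & ha & hb & hab & e).
  apply opair_inj in e; destruct e; subst; auto.
Qed.

(** The label is at most the number of units starting before [a], hence at most [a]. This is the
    source of the inequality between the index of a substream and its first unit. *)
Lemma label_spec w a : a ∈ omega -> label w a ∈ omega /\ a ∉ label w a.
Proof.
  intros ha; unfold label.
  pose proof (cnt_nat (dom w) a ha) as hc; pose proof (cnt_le (dom w) a ha) as hl.
  destruct (mu_bit _ hc) as (h1 & _ & _ & h4); split; [exact h1|]; intros h.
  apply h4; clear h4; generalize dependent (mu (bit (cnt (dom w) a))); intros m hm h.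
  nord_cnt.
Qed.

Lemma label_local w w' a : a ∈ omega ->
  (forall x b, x ∈ a -> opair x b ∈ w -> exists b, opair x b ∈ w') ->
  (forall x b, x ∈ a -> opair x b ∈ w' -> exists b, opair x b ∈ w) ->
  label w a = label w' a.
Proof.
  intros ha H H'; unfold label; rewrite (cnt_local (dom w) (dom w')); auto.
  intros x hx; rewrite !dom_spec; split; intros (h & b & hb); split; eauto.
Qed.

(** Once all units of [w] start below [m], every later position has the label of [m]: the label of
    the next unit is known before its position. *)
Lemma label_gap w m a : m ∈ omega -> a ∈ omega -> m ∈ succ a ->
  (forall x b, opair x b ∈ w -> x ∈ m) -> label w a = label w m.
Proof.
  intros hm ha h H; unfold label; rewrite (cnt_gap (dom w) m hm a ha h); [reflexivity|].
  intros x _ hx; apply dom_spec in hx; destruct hx as (_ & b & hb); exact (H x b hb).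
Qed.

Lemma stream_dom w : stream w -> Inf (dom w).
Proof.
  intros (hu & _ & h); split; [intros x hx; apply dom_spec in hx; tauto|].
  intros n hn; destruct (h n hn) as (a & b & hna & hab); exists a; split; [|exact hna].
  apply dom_spec; split; [|eauto]; apply (units_mem w a b hu hab).
Qed.

Lemma label_frequent w i n : stream w -> i ∈ omega -> n ∈ omega ->
  exists a b, n ∈ a /\ opair a b ∈ w /\ label w a = i.
Proof.
  intros hw hi hn; destruct (nat_bound i n hi hn) as (m & hm & him & hnm).
  (* The numeral with ones exactly at the positions below [i] and at [m] has lowest zero [i]. Its
     value [c] exceeds [m], so a unit preceded by [c] others starts after [n]. *)
  destruct (bit_surjective (succ m) (adj i m)) as (c & hc & ec); [nat_side| |].
  { intros x hx; apply adj_spec in hx; apply succ_spec; destruct hx as [hx| ->]; [|auto].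
    left; apply (nat_trans m i x); assumption. }
  destruct (cnt_onto (dom w) (stream_dom w hw) c hc) as (a & ha & ea).
  apply dom_spec in ha; destruct ha as (ha & b & hb).
  exists a, b; split; [|split; [exact hb|]].
  - assert (m ∈ c) by (apply (bit_subset c hc); rewrite ec; apply adj_spec; auto).
    pose proof (cnt_le (dom w) a ha) as h; rewrite ea in h.
    clear - hZF h hc ha hm hn hnm H; nord.
  - unfold label; rewrite ea, ec; apply mu_eq; [exact hi| |].
    + intros h; apply adj_spec in h; destruct h as [h| ->]; exact (mem_irrefl _ h) || idtac.
      exact (mem_irrefl _ him).
    + intros x hx; apply adj_spec; auto.
Qed.

Lemma stream_part w i : stream w -> i ∈ omega -> stream (part w i).
Proof.
  intros hw hi; pose proof hw as (hu & hf & _); split; [|split].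
  - apply (units_subset _ w); [apply part_subset|exact hu].
  - apply (functional_subset _ w); [apply part_subset|exact hf].
  - intros n hn; destruct (label_frequent w i n hw hi hn) as (a & b & h1 & h2 & h3).
    exists a, b; split; [exact h1|apply part_spec; auto].
Qed.

Lemma stream_rest w m : stream w -> m ∈ omega -> stream (rest w m).
Proof.
  intros (hu & hf & hw) hm; split; [|split].
  - apply (units_subset _ w); [apply rest_subset|exact hu].
  - apply (functional_subset _ w); [apply rest_subset|exact hf].
  - intros n hn; destruct (nat_bound n m hn hm) as (l & hl & h1 & h2).
    destruct (hw l hl) as (a & b & h3 & h4); exists a, b.
    destruct (units_mem w a b hu h4) as (ha & _ & _).
    split; [apply (nat_trans a l n); assumption|apply rest_spec; split; [exact h4|]].
    apply (nat_trans a l m); assumption.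
Qed.

Lemma stage_empty : stage empty.
Proof.
  split; [apply empty_HF|split; [intros p hp; destruct (empty_spec p hp)|split]].
  - intros a b b' h; destruct (empty_spec _ h).
  - exists empty; split; [apply nat_0|intros a b h; destruct (empty_spec _ h)].
Qed.

Lemma stage_adj s a b : stage s -> a ∈ omega -> b ∈ omega -> a ∈ b ->
  (forall a' b', opair a' b' ∈ s -> a' <> a) -> stage (adj s (opair a b)).
Proof.
  intros (h1 & h2 & h3 & n & hn & h4) ha hb hab H.
  split; [apply adj_HF; [exact h1|apply opair_HF; apply omega_HF; assumption]|].
  split; [|split].
  - intros p hp; apply adj_spec in hp; destruct hp as [hp| ->]; [auto|].
    exists a, b; auto.
  - intros x y y' h h'; apply adj_spec in h, h'; destruct h as [h|h], h' as [h'|h'].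
    + apply (h3 x); assumption.
    + apply opair_inj in h'; destruct h'; subst; destruct (H a y h eq_refl).
    + apply opair_inj in h; destruct h; subst; destruct (H a y' h' eq_refl).
    + apply opair_inj in h, h'; destruct h, h'; congruence.
  - destruct (nat_bound n b hn hb) as (m & hm & g1 & g2); exists m; split; [exact hm|].
    intros x y h; apply adj_spec in h; destruct h as [h|h].
    + apply (nat_trans m n y); [exact hm|exact (h4 x y h)|exact g1].
    + apply opair_inj in h; destruct h; subst; exact g2.
Qed.

Lemma below_0 w : below w empty = empty.
Proof.
  apply ext_eq; intros p; split; intros h; [|destruct (empty_spec p h)].
  apply sep_spec in h; [|dfn]; destruct h as (_ & a & b & _ & h).
  destruct (empty_spec a h).
Qed.

Lemma below_succ_out w m : units w -> (forall b, opair m b ∉ w) -> below w (succ m) = below w m.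
Proof.
  intros hu H; apply units_ext; try (apply (units_subset _ w); [apply below_subset|exact hu]).
  intros a b _ _ _; rewrite !below_spec, succ_spec; split; [|tauto].
  intros [h [h'| ->]]; [auto|destruct (H b h)].
Qed.

Lemma below_succ_in w m b : units w -> functional w -> opair m b ∈ w ->
  below w (succ m) = adj (below w m) (opair m b).
Proof.
  intros hu hf h; apply ext_eq; intros p; split.
  - intros hp; pose proof (below_subset _ _ p hp) as hp'.
    destruct (hu p hp') as (a & c & _ & _ & _ & ->).
    apply below_spec in hp; rewrite succ_spec in hp; apply adj_spec.
    destruct hp as [_ [hp| ->]]; [left; apply below_spec; auto|].
    rewrite (hf m c b hp' h); auto.
  - intros hp; apply adj_spec in hp; destruct hp as [hp| ->].
    + pose proof (below_subset _ _ p hp) as hp'.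
      destruct (hu p hp') as (a & c & _ & _ & _ & ->).
      apply below_spec in hp; apply below_spec; rewrite succ_spec; tauto.
    + apply below_spec; split; [exact h|apply mem_succ].
Qed.

Lemma stage_below w : stream w -> forall m, m ∈ omega -> stage (below w m).
Proof.
  intros (hu & hf & _); nat_induction; [rewrite below_0; apply stage_empty|].
  intros m hm IH; destruct (classic (exists b, opair m b ∈ w)) as [[b h]|h].
  - rewrite (below_succ_in w m b hu hf h).
    destruct (units_mem w m b hu h) as (ha & hb & hab).
    apply stage_adj; try assumption; intros a' b' h'; apply below_spec in h'.
    destruct h' as [_ h']; intros ->; exact (mem_irrefl m h').
  - rewrite below_succ_out; [exact IH|exact hu|eauto].
Qed.

(** Labels look only backwards, so splitting commutes with truncation; a stage thus knows the stages
    of all its substreams. *)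
Lemma part_below w m i : units w -> m ∈ omega -> part (below w m) i = below (part w i) m.
Proof.
  intros hu hm; apply units_ext.
  - apply (units_subset _ w); [|exact hu].
    intros p hp; apply (below_subset w m), (part_subset _ i), hp.
  - apply (units_subset _ w); [|exact hu].
    intros p hp; apply (part_subset w i), (below_subset _ m), hp.
  - intros a b ha hb hab; rewrite part_spec, !below_spec, part_spec.
    assert (E : a ∈ m -> label (below w m) a = label w a).
    { intros ham; apply label_local; [exact ha| |].
      - intros x c _ h; apply below_spec in h; exists c; tauto.
      - intros x c hx h; exists c; apply below_spec; split; [exact h|].
        apply (nat_trans m a x); assumption. }
    split; [intros ((h & h') & e)|intros ((h & e) & h')]; rewrite (E h') in *; auto.
Qed.

Lemma first_unit_exists w : stream w -> exists a b, first_unit w a b.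
Proof.
  intros hw; pose proof hw as (hu & _ & h).
  destruct (least_spec (fun a => exists b, opair a b ∈ w) ltac:(dfn)) as (h1 & (b & h2) & h3).
  - destruct (h empty nat_0) as (a & b & _ & hab); exists a; split; [|eauto].
    apply (units_mem w a b hu hab).
  - exists (least (fun a => exists b, opair a b ∈ w)), b; split; [exact h2|].
    intros a' b' h' h''; apply (h3 a' h''); eauto.
Qed.

Lemma first_unit_unique w a b a' b' : units w -> functional w ->
  first_unit w a b -> first_unit w a' b' -> a = a' /\ b = b'.
Proof.
  intros hu hf [h1 h2] [h3 h4].
  destruct (units_mem w a b hu h1) as (ha & _ & _).
  destruct (units_mem w a' b' hu h3) as (ha' & _ & _).
  assert (a = a') as <-.
  { destruct (nat_total a ha a' ha') as [h|[h|h]]; [|auto|].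
    - destruct (h2 _ _ h3 h).
    - destruct (h4 _ _ h1 h). }
  split; [reflexivity|apply (hf a); assumption].
Qed.

End UnitsTheory.
#[global] Opaque dom label below rest part.

(** * Trees and branches *)

Section Trees.
Context {V : set_structure} {hZF : ZF V}.

(** Each node has extensions by units starting arbitrarily late. This freedom is what allows trees
    to be interleaved and branches to be made block ordered. *)
Definition tree (T : V) : Prop :=
  empty ∈ T /\ forall s, s ∈ T -> stage s /\
    forall n, n ∈ omega -> exists a b, n ∈ a /\
      (forall a' b', opair a' b' ∈ s -> a' ∈ a) /\ adj s (opair a b) ∈ T.

Definition branch (T v : V) : Prop :=
  stream v /\ forall m, m ∈ omega -> below v m ∈ T.

Definition block_ordered (v : V) : Prop :=
  forall a b a' b', opair a b ∈ v -> opair a' b' ∈ v -> a ∈ a' -> b ∈ a'.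

Variable k : nat.
Implicit Types t u v : @env V k -> V.
Lemma D_tree t : T k t -> D k (fun e => tree (t e)).
Proof. intros; unfold tree; dfn. Qed.
Lemma D_branch t u : T k t -> T k u -> D k (fun e => branch (t e) (u e)).
Proof. intros; unfold branch; dfn. Qed.
Lemma D_block_ordered t : T k t -> D k (fun e => block_ordered (t e)).
Proof. intros; unfold block_ordered; dfn. Qed.
End Trees.

Ltac dfn_trees := first [dfn_units | apply D_tree | apply D_branch | apply D_block_ordered].
Ltac dfn_lemma ::= dfn_trees.

Section TreesTheory.
Context {V : set_structure} {hZF : ZF V}.

Lemma tree_extend T s n : tree T -> s ∈ T -> n ∈ omega ->
  exists a b, n ∈ a /\ a ∈ omega /\ b ∈ omega /\ a ∈ b /\
    (forall a' b', opair a' b' ∈ s -> a' ∈ a) /\ adj s (opair a b) ∈ T.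
Proof.
  intros (h0 & h) hs hn; destruct (h s hs) as (_ & h').
  destruct (h' n hn) as (a & b & h1 & h2 & h3); exists a, b.
  destruct (h _ h3) as ((_ & hu & _) & _).
  destruct (units_mem _ a b hu) as (ha & hb & hab); [apply adj_spec; auto|]; auto 7.
Qed.

(** Positions [m] are scanned in increasing order, and a unit starting at [m] is added whenever the
    tree admits one and all earlier entries lie below [m]. The least admissible second entry is
    taken, so no choice is involved. *)
Lemma tree_branch T : tree T -> exists v, branch T v /\ block_ordered v.
Proof.
  intros hT.
  set (addable := fun m s b =>
    b ∈ omega /\ adj s (opair m b) ∈ T /\ forall a' b', opair a' b' ∈ s -> b' ∈ m).
  set (step := fun m s =>
    ite (exists b, addable m s b) (adj s (opair m (least (addable m s)))) s).
  set (st := nrec empty step).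
  assert (dstep : T2 step) by (unfold step, addable; dfn).
  assert (dst : T1 st) by (unfold st; dfn).
  assert (st0 : st empty = empty) by (apply nrec_0, dstep).
  assert (stS : forall n, n ∈ omega -> st (succ n) = step n (st n))
    by (intros n hn; apply nrec_succ; assumption).
  assert (stepS : forall m s,
    (exists b, addable m s b /\ step m s = adj s (opair m b)) \/
    ((forall b, ~ addable m s b) /\ step m s = s)).
  { intros m s; destruct (classic (exists b, addable m s b)) as [h|h].
    - left; exists (least (addable m s)); split; [|apply ite_true, h].
      apply least_spec; [unfold addable; dfn|].
      destruct h as (b & h); exists b; split; [apply h|exact h].
    - right; split; [intros b hb; apply h; eauto|apply ite_false, h]. }
  clearbody step.
  assert (stT : forall n, n ∈ omega -> st n ∈ T).
  { nat_induction; [rewrite st0; apply hT|].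
    intros n hn IH; rewrite (stS n hn).
    destruct (stepS n (st n)) as [(b & hb & ->)|(_ & ->)]; [apply hb|exact IH]. }
  assert (stlt : forall n, n ∈ omega -> forall a b, opair a b ∈ st n -> a ∈ n).
  { nat_induction.
    - rewrite st0; intros a b h; destruct (empty_spec _ h).
    - intros n hn IH a b; rewrite (stS n hn), succ_spec.
      destruct (stepS n (st n)) as [(c & hc & ->)|(_ & ->)]; [|eauto].
      rewrite adj_spec; intros [h|h]; [eauto|].
      apply opair_inj in h; tauto. }
  assert (stmono : forall n, n ∈ omega -> forall m, m ∈ n -> subset (st m) (st n)).
  { nat_induction; [intros m hm; destruct (empty_spec m hm)|].
    intros n hn IH m hm; assert (h : subset (st n) (st (succ n))).
    { rewrite (stS n hn); destruct (stepS n (st n)) as [(c & hc & ->)|(_ & ->)].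
      - intros z hz; apply adj_spec; auto.
      - intros z hz; exact hz. }
    apply succ_spec in hm; destruct hm as [hm| ->]; [|exact h].
    intros z hz; apply h, (IH m hm), hz. }
  (* After stage [m] only units starting at [m] or later are added; hence truncating the union at
     [m] gives back [st m]. *)
  assert (streach : forall n, n ∈ omega -> forall a b m, opair a b ∈ st n -> a ∈ m ->
    m ∈ omega -> opair a b ∈ st m).
  { nat_induction; [rewrite st0; intros a b m h; destruct (empty_spec _ h)|].
    intros n hn IH a b m h ham hm.
    destruct (classic (n ∈ m)) as [h'|h'].
    - assert (hs : succ n = m \/ succ n ∈ m) by nord.
      destruct hs as [<-|hs]; [exact h|apply (stmono m hm _ hs), h].
    - apply IH; [|exact ham|exact hm].
      rewrite (stS n hn) in h; destruct (stepS n (st n)) as [(c & hc & e)|(_ & e)];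
        rewrite e in h; [|exact h].
      apply adj_spec in h; destruct h as [h|h]; [exact h|].
      apply opair_inj in h; destruct h; subst; tauto. }
  assert (stB : forall n, n ∈ omega -> block_ordered (st n)).
  { nat_induction; [rewrite st0; intros a b a' b' h; destruct (empty_spec _ h)|].
    intros n hn IH; rewrite (stS n hn).
    destruct (stepS n (st n)) as [(c & hc & ->)|(_ & ->)]; [|exact IH].
    intros a b a' b'; rewrite !adj_spec; intros [h|h] [h'|h'] haa.
    - exact (IH a b a' b' h h' haa).
    - apply opair_inj in h'; destruct h'; subst; apply hc in h; exact h.
    - apply opair_inj in h; destruct h; subst; apply (stlt n hn) in h'.
      destruct (nat_asym n a' hn haa h').
    - apply opair_inj in h, h'; destruct h, h'; subst; destruct (mem_irrefl n haa). }
  set (v := bigcup (img omega st)).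
  assert (vS : forall p, p ∈ v <-> exists n, n ∈ omega /\ p ∈ st n).
  { intros p; unfold v; rewrite bigcup_spec; split.
    - intros (y & hy & hp); apply img_spec in hy; [|exact dst].
      destruct hy as (n & hn & ->); eauto.
    - intros (n & hn & hp); exists (st n); split; [apply img_spec; eauto|exact hp]. }
  assert (v2 : forall p q, p ∈ v -> q ∈ v -> exists n, n ∈ omega /\ p ∈ st n /\ q ∈ st n).
  { intros p q hp hq; apply vS in hp, hq.
    destruct hp as (n & hn & hp), hq as (m & hm & hq).
    destruct (nat_bound n m hn hm) as (l & hl & h1 & h2); exists l.
    split; [exact hl|split; [apply (stmono l hl n h1), hp|apply (stmono l hl m h2), hq]]. }
  assert (hv : stream v).
  { split; [|split].
    - intros p hp; apply vS in hp; destruct hp as (n & hn & hp).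
      destruct (proj2 hT _ (stT n hn)) as ((_ & hu & _) & _); exact (hu p hp).
    - intros a b b' h h'; destruct (v2 _ _ h h') as (n & hn & g & g').
      destruct (proj2 hT _ (stT n hn)) as ((_ & _ & hf & _) & _); exact (hf a b b' g g').
    - intros n0 hn0; assert (hn : succ n0 ∈ omega) by nat_side.
      assert (hlt : n0 ∈ succ n0) by apply mem_succ.
      set (n := succ n0) in *; clearbody n.
      destruct (proj2 hT _ (stT n hn)) as ((_ & hu & _ & M & hM & hb) & _).
      destruct (nat_bound n M hn hM) as (L & hL & h1 & h2).
      destruct (tree_extend T (st n) L hT (stT n hn) hL) as
        (a & b & g1 & g2 & g3 & g4 & g5 & g6).
      apply NNPP; intros H.
      (* If no unit started after [n0], the construction would stand still from [n] up to [a]. But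
         the tree extends [st n] by a unit at [a], beyond all its entries, and the scan would have
         added a unit there. *)
      assert (C : forall m, m ∈ omega -> m ∈ succ a -> n ∈ succ m -> st m = st n).
      { nat_induction.
        - intros _ h; apply succ_spec in h; destruct h as [h| ->];
            [destruct (empty_spec _ h)|reflexivity].
        - intros m hm IH hma hnm; apply succ_spec in hnm.
          destruct hnm as [hnm| ->]; [|reflexivity].
          rewrite (stS m hm), IH by (assumption || (clear - hZF hma hm g2; nord)).
          destruct (stepS m (st n)) as [(c & hc & e)|(_ & e)]; [|exact e].
          exfalso.
          assert (hmv : opair m c ∈ v).
          { apply vS; exists (succ m); split; [nat_side|].
            rewrite (stS m hm), IH by (assumption || (clear - hZF hma hm g2; nord)).
            rewrite e; apply adj_spec; auto. }
          apply H; exists m, c; split; [|exact hmv].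
          apply succ_spec in hnm; destruct hnm as [hnm| ->]; [|exact hlt].
          apply (nat_trans m n n0); assumption. }
      assert (E : st a = st n) by (apply C; [exact g2|apply mem_succ|nord]).
      destruct (stepS a (st a)) as [(c & hc & e)|(h & _)].
      + apply H; exists a, c; split.
        { apply (nat_trans a n n0); [exact g2|exact hlt|apply (nat_trans a L n); assumption]. }
        apply vS; exists (succ a); split; [nat_side|].
        rewrite (stS a g2), e; apply adj_spec; auto.
      + apply (h b); split; [exact g3|split; [rewrite E; exact g6|]].
        intros a' b' h'; rewrite E in h'.
        apply (nat_trans a L b'); [exact g2| |exact g1].
        apply (nat_trans L M b'); [exact hL|exact (hb a' b' h')|exact h2]. }
  exists v; split; [split; [exact hv|]|].
  - intros m hm; replace (below v m) with (st m); [apply stT, hm|].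
    symmetry; apply units_ext.
    + apply (units_subset _ v); [apply below_subset|apply hv].
    + destruct (proj2 hT _ (stT m hm)) as ((_ & hu & _) & _); exact hu.
    + intros a b _ _ _; rewrite below_spec; split.
      * intros (h & ham); apply vS in h; destruct h as (n & hn & h).
        apply (streach n hn); assumption.
      * intros h; split; [apply vS; eauto|apply (stlt m hm a b h)].
  - intros a b a' b' h h'; destruct (v2 _ _ h h') as (n & hn & g & g').
    exact (stB n hn a b a' b' g g').
Qed.

(** Two trees suffice: comparing two streams needs one part for each, and in a Fubini sum all parts
    follow the same tree. *)
Definition comb (T T' : V) : V :=
  sep HF (fun s => stage s /\ part s empty ∈ T /\
    forall i, i ∈ omega -> i <> empty -> part s i ∈ T').

Lemma comb_spec T T' s : s ∈ comb T T' <-> stage s /\ part s empty ∈ T /\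
  forall i, i ∈ omega -> i <> empty -> part s i ∈ T'.
Proof.
  unfold comb; rewrite sep_spec by dfn; split; [tauto|intros h; split; [apply h|exact h]].
Qed.

(* The label of a new unit is determined by [s] before the unit is chosen, so it can be
   taken from the tree that the label selects. *)
Lemma tree_comb T T' : tree T -> tree T' -> tree (comb T T').
Proof.
  intros hT hT'; split.
  - apply comb_spec; split; [apply stage_empty|].
    assert (E : forall i, part empty i = empty).
    { intros i; apply ext_eq; intros p; split; intros h; [|destruct (empty_spec p h)].
      apply part_subset in h; exact h. }
    split; [rewrite E; apply hT|intros i _ _; rewrite E; apply hT'].
  - intros s hs; apply comb_spec in hs; destruct hs as (hs & h0 & h1); split; [exact hs|].
    intros n hn; pose proof hs as (hHF & hu & hf & M & hM & hb).
    destruct (nat_bound n M hn hM) as (L & hL & g1 & g2).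
    (* [j] is the label that the new unit receives wherever above [L] it starts, so the tree to be
       extended is fixed first and the unit taken from it. *)
    set (j := label s L); destruct (label_spec s L hL) as (hj & _); fold j in hj.
    assert (ex : exists a b, L ∈ a /\ a ∈ omega /\ b ∈ omega /\ a ∈ b /\
      (j = empty -> adj (part s j) (opair a b) ∈ T) /\
      (j <> empty -> adj (part s j) (opair a b) ∈ T')).
    { destruct (classic (j = empty)) as [e|e].
      - destruct (tree_extend T (part s j) L hT) as (a & b & h);
          [rewrite e; exact h0|exact hL|]; exists a, b; tauto.
      - destruct (tree_extend T' (part s j) L hT') as (a & b & h);
          [apply h1; assumption|exact hL|]; exists a, b; tauto. }
    destruct ex as (a & b & hLa & ha & hb' & hab & e0 & e1).
    assert (old : forall x y, opair x y ∈ s -> x ∈ L).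
    { intros x y h; destruct (units_mem s x y hu h) as (hx & hy & hxy).
      pose proof (hb x y h) as hyM; clear - hZF hx hy hxy hyM hL hM g2; nord. }
    assert (olda : forall x y, opair x y ∈ s -> x ∈ a)
      by (intros x y h; apply (nat_trans a L x); eauto).
    exists a, b; split; [apply (nat_trans a L n); assumption|split; [exact olda|]].
    assert (stg : stage (adj s (opair a b))).
    { apply stage_adj; try assumption; intros x y h ->.
      exact (mem_irrefl a (olda a y h)). }
    assert (lold : forall x y, opair x y ∈ s -> label (adj s (opair a b)) x = label s x).
    { intros x y h; apply label_local; [apply (units_mem s x y hu h)| |].
      - intros x' y' hx h'; apply adj_spec in h'; destruct h' as [h'|h']; [eauto|].
        apply opair_inj in h'; destruct h'; subst.
        destruct (nat_asym a x ha hx (olda x y h)).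
      - intros x' y' _ h'; exists y'; apply adj_spec; auto. }
    assert (lnew : label (adj s (opair a b)) a = j).
    { transitivity (label s a).
      - apply label_local; [exact ha| |].
        + intros x' y' hx h'; apply adj_spec in h'; destruct h' as [h'|h']; [eauto|].
          apply opair_inj in h'; destruct h'; subst; destruct (mem_irrefl a hx).
        + intros x' y' _ h'; exists y'; apply adj_spec; auto.
      - apply label_gap; try assumption; apply succ_spec; auto. }
    assert (pj : part (adj s (opair a b)) j = adj (part s j) (opair a b)).
    { apply ext_eq; intros p; split; intros hp.
      - pose proof (part_subset _ _ p hp) as hp'; apply adj_spec in hp'.
        apply adj_spec; destruct hp' as [hp'| ->]; [left|auto].
        destruct (hu p hp') as (x & y & _ & _ & _ & ->); apply part_spec in hp.
        apply part_spec; split; [exact hp'|rewrite <- (lold x y hp'); exact (proj2 hp)].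
      - apply adj_spec in hp; destruct hp as [hp| ->].
        + pose proof (part_subset _ _ p hp) as hp'.
          destruct (hu p hp') as (x & y & _ & _ & _ & ->); apply part_spec in hp.
          apply part_spec; split; [apply adj_spec; auto|rewrite (lold x y hp'); exact (proj2 hp)].
        + apply part_spec; rewrite adj_spec; auto. }
    assert (pi : forall i, i <> j -> part (adj s (opair a b)) i = part s i).
    { intros i hi; apply ext_eq; intros p; split; intros hp.
      - pose proof (part_subset _ _ p hp) as hp'; apply adj_spec in hp'.
        destruct hp' as [hp'| ->].
        + destruct (hu p hp') as (x & y & _ & _ & _ & ->); apply part_spec in hp.
          apply part_spec; split; [exact hp'|rewrite <- (lold x y hp'); exact (proj2 hp)].
        + apply part_spec in hp; rewrite lnew in hp; destruct hi; symmetry; tauto.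
      - pose proof (part_subset _ _ p hp) as hp'.
        destruct (hu p hp') as (x & y & _ & _ & _ & ->); apply part_spec in hp.
        apply part_spec; split; [apply adj_spec; auto|rewrite (lold x y hp'); exact (proj2 hp)]. }
    apply comb_spec; split; [exact stg|split].
    + destruct (classic (j = empty)) as [e|e]; [rewrite <- e, pj; auto|].
      rewrite pi by congruence; exact h0.
    + intros i hi hi0; destruct (classic (i = j)) as [->|e]; [rewrite pj; auto|].
      rewrite pi by exact e; auto.
Qed.

Lemma branch_comb T T' v : branch (comb T T') v ->
  branch T (part v empty) /\
  forall i, i ∈ omega -> i <> empty -> branch T' (part v i).
Proof.
  intros (hv & h); pose proof hv as (hu & _); split; [split|].
  - apply stream_part; [exact hv|apply nat_0].
  - intros m hm; rewrite <- part_below by assumption.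
    specialize (h m hm); apply comb_spec in h; tauto.
  - intros i hi hi0; split; [apply stream_part; assumption|].
    intros m hm; rewrite <- part_below by assumption.
    specialize (h m hm); apply comb_spec in h; apply h; assumption.
Qed.

Lemma branch_subset T v w : branch T v -> (forall s, s ∈ T -> subset s w) -> subset v w.
Proof.
  intros ((hu & _) & h) H p hp; destruct (hu p hp) as (a & b & ha & _ & _ & ->).
  apply (H (below v (succ a))); [apply h; nat_side|].
  apply below_spec; split; [exact hp|apply mem_succ].
Qed.

End TreesTheory.
#[global] Opaque comb.

(** * Infinite sets as streams of consecutive pairs *)

Section ConsecutivePairs.
Context {V : set_structure} {hZF : ZF V}.

Definition even (n : V) : Prop := empty ∉ bit n.

Definition starts_pair (z a b : V) : Prop :=
  a ∈ z /\ b ∈ z /\ a ∈ b /\ (forall m, m ∈ z -> a ∈ m -> m ∉ b) /\ even (cnt z a).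

Definition pairs (z : V) : V :=
  sep HF (fun p => exists a b, p = opair a b /\ starts_pair z a b).

Lemma T_pairs k (t : env k -> V) : T k t -> T k (fun e => pairs (t e)).
Proof. intros; unfold pairs, starts_pair, even; dfn. Qed.

Lemma even_0 : even empty.
Proof. unfold even; rewrite bit_0; apply empty_spec. Qed.

Lemma even_succ n : n ∈ omega -> (even (succ n) <-> ~ even n).
Proof.
  intros hn; unfold even; rewrite (bit_succ n hn), increment_spec.
  destruct (mu_bit n hn) as (h1 & h2 & h3 & _).
  destruct (nat_0_le _ h1) as [e|e].
  - rewrite e in *; pose proof (empty_spec (V := V) empty); tauto.
  - pose proof (h3 empty e).
    assert (empty <> mu (bit n)) by (intros e'; rewrite <- e' in e; exact (empty_spec _ e)).
    tauto.
Qed.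

Lemma pairs_spec z a b : Inf z -> (opair a b ∈ pairs z <-> starts_pair z a b).
Proof.
  intros hz; unfold pairs; rewrite sep_spec by (unfold starts_pair, even; dfn); split.
  - intros (_ & a' & b' & e & h); apply opair_inj in e; destruct e; subst; exact h.
  - intros h; split; [|eauto]; destruct h as (h1 & h2 & _).
    apply opair_HF; apply omega_HF, (Inf_nat z); assumption.
Qed.

Lemma pairs_units z : Inf z -> units (pairs z).
Proof.
  intros hz p hp; unfold pairs in hp.
  rewrite sep_spec in hp by (unfold starts_pair, even; dfn).
  destruct hp as (_ & a & b & -> & h1 & h2 & h3 & _); exists a, b.
  split; [exact (Inf_nat z a hz h1)|split; [exact (Inf_nat z b hz h2)|auto]].
Qed.

Lemma next_exists z a : Inf z -> a ∈ omega ->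
  exists b, b ∈ z /\ a ∈ b /\ forall m, m ∈ z -> a ∈ m -> m ∉ b.
Proof.
  intros hz ha; destruct (least_spec (fun b => b ∈ z /\ a ∈ b) ltac:(dfn)) as (h1 & h2 & h3).
  - destruct (proj2 hz a ha) as (m & hm & ham); exists m; split; [|auto].
    exact (Inf_nat z m hz hm).
  - exists (least (fun b => b ∈ z /\ a ∈ b)); split; [tauto|split; [tauto|]].
    intros m hm ham h; exact (h3 m h (conj hm ham)).
Qed.

Lemma pairs_stream z : Inf z -> stream (pairs z).
Proof.
  intros hz; split; [apply pairs_units, hz|split].
  - intros a b b' h h'; rewrite pairs_spec in h, h' by exact hz.
    destruct h as (_ & h1 & h2 & h3 & _), h' as (_ & g1 & g2 & g3 & _).
    destruct (nat_total b (Inf_nat z b hz h1) b' (Inf_nat z b' hz g1)) as [h|[h|h]];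
      [destruct (h3 b' g1 g2 h)|auto|destruct (g3 b h1 h2 h)].
  - intros n hn; destruct (proj2 hz n hn) as (a & ha & hna).
    pose proof (Inf_nat z a hz ha) as ha'.
    destruct (next_exists z a hz ha') as (b & h1 & h2 & h3).
    pose proof (Inf_nat z b hz h1) as hb.
    destruct (classic (even (cnt z a))) as [e|e].
    + exists a, b; split; [exact hna|apply pairs_spec; [exact hz|]].
      split; [exact ha|auto].
    + destruct (next_exists z b hz hb) as (c & g1 & g2 & g3).
      exists b, c; split; [apply (nat_trans b a n); assumption|].
      apply pairs_spec; [exact hz|]; split; [exact h1|split; [exact g1|split; [exact g2|]]].
      split; [exact g3|].
      assert (E : cnt z b = succ (cnt z a)).
      { rewrite <- (cnt_in z a ha' ha); apply cnt_gap; [nat_side|exact hb| |].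
        - clear - hZF ha' hb h2; nord.
        - intros x hx hxz; assert (hx' : x ∈ omega) by nat_side.
          assert (~ a ∈ x) by (intros h; exact (h3 x hxz h hx)).
          clear - hZF H hx' ha'; nord. }
      rewrite E; apply even_succ; [apply cnt_nat, ha'|exact e].
Qed.

Definition entries (v : V) : V :=
  sep omega (fun m => exists a b, opair a b ∈ v /\ (m = a \/ m = b)).

Lemma entries_spec v m : m ∈ entries v <->
  m ∈ omega /\ exists a b, opair a b ∈ v /\ (m = a \/ m = b).
Proof. unfold entries; rewrite sep_spec by dfn; reflexivity. Qed.

Lemma entries_mem v a b : units v -> opair a b ∈ v -> a ∈ entries v /\ b ∈ entries v.
Proof.
  intros hu h; destruct (units_mem v a b hu h) as (ha & hb & _); rewrite !entries_spec.
  split; (split; [assumption|exists a, b; auto]).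
Qed.

Lemma entries_Inf v : stream v -> Inf (entries v).
Proof.
  intros (hu & _ & h); split; [intros m hm; apply entries_spec in hm; tauto|].
  intros n hn; destruct (h n hn) as (a & b & hna & hab); exists a; split; [|exact hna].
  apply (entries_mem v a b hu hab).
Qed.

(** Units of a block-ordered stream do not overlap and contribute two entries each, so the count is
    odd exactly while a unit has been entered and not yet completed. *)
Lemma parity_entries v : stream v -> block_ordered v -> forall m, m ∈ omega ->
  (even (cnt (entries v) m) <-> ~ exists a b, opair a b ∈ v /\ a ∈ m /\ b ∉ m).
Proof.
  intros (hu & hf & _) hB; unfold even; nat_induction.
  - rewrite cnt_0; split; [intros _ (a & b & _ & h & _); exact (empty_spec a h)|].
    intros _; exact even_0.
  - intros m hm IH; fold (even (cnt (entries v) m)) in IH.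
    fold (even (cnt (entries v) (succ m))).
    destruct (classic (m ∈ entries v)) as [h|h].
    + rewrite cnt_in, even_succ, IH by (assumption || apply cnt_nat, hm).
      apply entries_spec in h; destruct h as (_ & a & b & hab & [->| ->]).
      * destruct (units_mem v a b hu hab) as (ha & hb & hlt).
        split; [intros H; exfalso|intros H; exfalso].
        -- apply H; intros (x & y & hxy & hx & hy).
           exact (hy (hB x y a b hxy hab hx)).
        -- apply H; exists a, b; rewrite !succ_spec.
           split; [exact hab|split; [auto|]].
           intros [h|h]; [exact (nat_asym a b ha hlt h)|subst; exact (mem_irrefl a hlt)].
      * destruct (units_mem v a b hu hab) as (ha & hb & hlt); split.
        -- intros _ (x & y & hxy & hx & hy); rewrite succ_spec in *.
           destruct (units_mem v x y hu hxy) as (hx' & hy' & hxy').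
           destruct (nat_total a ha x hx') as [h|[h|h]].
           ++ pose proof (hB x y a b hxy hab h) as g; apply hy; left.
              apply (nat_trans b a y); assumption.
           ++ subst x; apply hy; right; apply (hf a); assumption.
           ++ pose proof (hB a b x y hab hxy h) as g.
              destruct hx as [hx|hx]; [exact (nat_asym b x hb g hx)|].
              subst; exact (mem_irrefl b g).
        -- intros _ H; apply H; exists a, b; split; [exact hab|split; [exact hlt|]].
           apply mem_irrefl.
    + rewrite cnt_out, IH by assumption; split; intros H (a & b & hab & h1 & h2);
        destruct (units_mem v a b hu hab) as (ha & hb & _);
        apply H; exists a, b; rewrite ?succ_spec in *; (split; [exact hab|]).
      * split; [|tauto]; destruct h1 as [h1| ->]; [exact h1|exfalso].
        apply h, entries_spec; split; [exact hm|exists m, b; auto].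
      * split; [auto|]; intros [g| ->]; [tauto|].
        apply h, entries_spec; split; [exact hm|exists a, m; auto].
Qed.

(** Turns a branch of a tree back into a point of a cube, to which the homogeneity of the cube
    applies. *)
Lemma pairs_entries v : stream v -> block_ordered v -> pairs (entries v) = v.
Proof.
  intros hv hB; pose proof hv as (hu & hf & _).
  pose proof (entries_Inf v hv) as hI.
  assert (main : forall a b, opair a b ∈ v -> starts_pair (entries v) a b).
  { intros a b h; destruct (units_mem v a b hu h) as (ha & hb & hab).
    destruct (entries_mem v a b hu h) as (ea & eb).
    split; [exact ea|split; [exact eb|split; [exact hab|split]]].
    - intros m hm ham hmb; apply entries_spec in hm.
      destruct hm as (hm & x & y & hxy & e).
      destruct (units_mem v x y hu hxy) as (hx & hy & hlt).
      destruct (nat_total a ha x hx) as [g|[g|g]].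
      + pose proof (hB x y a b hxy h g) as g'; destruct e; subst m;
          clear - hZF g g' ham ha hx hy hlt; nord.
      + subst x; rewrite (hf a y b hxy h) in e; destruct e; subst m;
          [exact (mem_irrefl a ham)|exact (mem_irrefl b hmb)].
      + pose proof (hB a b x y h hxy g) as g'; destruct e; subst m;
          clear - hZF g g' ham hmb ha hb hx hy hlt; nord.
    - apply parity_entries; try assumption; intros (x & y & hxy & h1 & h2).
      exact (h2 (hB x y a b hxy h h1)). }
  apply units_ext; [apply pairs_units, hI|exact hu|].
  intros a b ha hb hab; rewrite pairs_spec by exact hI; split; [|apply main].
  intros (h1 & h2 & h3 & h4 & h5); apply parity_entries in h5; try assumption.
  apply entries_spec in h1; destruct h1 as (_ & x & y & hxy & [->| ->]).
  - destruct (main x y hxy) as (_ & g2 & g3 & g4 & _).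
    destruct (units_mem v x y hu hxy) as (_ & hy & _).
    destruct (nat_total b hb y hy) as [g|[g|g]].
    + destruct (h4 y g2 g3 g).
    + subst; exact hxy.
    + destruct (g4 b h2 h3 g).
  (* A pair cannot start at the second entry of a unit, since that unit is still open there and the
     parity is odd. *)
  - exfalso; apply h5; exists x, y; split; [exact hxy|].
    split; [apply (units_mem v x y hu hxy)|apply mem_irrefl].
Qed.

(* Prefixing [a] to a tail of [z] makes [a] the first element of the first pair. *)
Lemma pairs_starting_at z a n : Inf z -> a ∈ z -> n ∈ omega ->
  exists z' b, Inf z' /\ subset z' z /\ n ∈ b /\ first_unit (pairs z') a b.
Proof.
  intros hz ha hn; pose proof (Inf_nat z a hz ha) as ha'.
  destruct (nat_bound a n ha' hn) as (L & hL & h1 & h2).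
  destruct (next_exists z L hz hL) as (b & g1 & g2 & g3).
  pose proof (Inf_nat z b hz g1) as hb.
  assert (S : forall m, m ∈ sep z (fun m => m = a \/ m ∉ succ L) <->
    m ∈ z /\ (m = a \/ m ∉ succ L)) by (intros; rewrite sep_spec by dfn; reflexivity).
  set (z' := sep z (fun m => m = a \/ m ∉ succ L)) in *; clearbody z'.
  assert (lt : forall m, m ∈ z' -> m = a \/ L ∈ m).
  { intros m hm; apply S in hm; destruct hm as (hm & [->|h]); [auto|right].
    pose proof (Inf_nat z m hz hm) as hm'; clear - hZF h hm' hL; nord. }
  assert (hI : Inf z').
  { split; [intros m hm; apply S in hm; apply (Inf_nat z); tauto|].
    intros k hk; destruct (nat_bound k L hk hL) as (l & hl & k1 & k2).
    destruct (proj2 hz l hl) as (m & hm & hlm); pose proof (Inf_nat z m hz hm) as hm'.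
    exists m; split; [|apply (nat_trans m l k); assumption].
    apply S; split; [exact hm|right]; clear - hZF hlm hm' hl hL k2; nord. }
  exists z', b; split; [exact hI|split; [intros m hm; apply S in hm; tauto|]].
  split; [apply (nat_trans b L n); assumption|split].
  - apply pairs_spec; [exact hI|]; split; [apply S; auto|split; [|split; [|split]]].
    + apply S; split; [exact g1|right]; clear - hZF g2 hb hL; nord.
    + apply (nat_trans b L a); assumption.
    + intros m hm ham; destruct (lt m hm) as [->|h]; [destruct (mem_irrefl a ham)|].
      apply S in hm; apply g3; tauto.
    + rewrite (cnt_gap z' empty nat_0 a ha'), cnt_0; [apply even_0| |].
      * destruct (nat_0_le a ha') as [->|h]; apply succ_spec; auto.
      * intros x hx hxz; exfalso; destruct (lt x hxz) as [->|h]; [exact (mem_irrefl a hx)|].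
        assert (hx' : x ∈ omega) by nat_side; clear - hZF hx hx' h h1 hL ha'; nord.
  - intros x y h; apply pairs_spec in h; [|exact hI]; destruct h as (h & _).
    destruct (lt x h) as [->|h']; [apply mem_irrefl|intros hx].
    assert (hx' : x ∈ omega) by nat_side; clear - hZF hx hx' h' h1 hL ha'; nord.
Qed.

End ConsecutivePairs.
#[global] Opaque pairs entries.
Ltac dfn_pairs := first [dfn_trees | apply T_pairs].
Ltac dfn_lemma ::= dfn_pairs.

(** * Dependent choice *)

Section DependentChoice.
Context {V : set_structure} {hZF : ZF V}.
Hypothesis hDC : DC_R V.

Lemma dependent_choice_omega (R : V -> V -> Prop) : D2 R ->
  (forall x, subset x omega -> exists y, subset y omega /\ R x y) ->
  exists f, forall n, n ∈ omega ->
    subset (app f n) omega /\ R (app f n) (app f (succ n)).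
Proof.
  intros hR H.
  set (r := bigcup (img (power omega)
    (fun x => img (sep (power omega) (fun y => R x y)) (fun y => opair x y)))).
  assert (rS : forall x y, opair x y ∈ r <->
    subset x omega /\ subset y omega /\ R x y).
  { intros x y; unfold r; rewrite bigcup_spec; split.
    - intros (u & hu & h); apply img_spec in hu; [|dfn]; destruct hu as (x' & hx & ->).
      apply img_spec in h; [|dfn]; destruct h as (y' & hy & e).
      apply sep_spec in hy; [|dfn]; apply opair_inj in e; destruct e; subst.
      rewrite !power_spec in *; tauto.
    - intros (hx & hy & h).
      exists (img (sep (power omega) (fun y => R x y)) (fun y => opair x y)).
      rewrite !img_spec by dfn; split; [exists x; rewrite power_spec; auto|].
      exists y; rewrite sep_spec, power_spec by dfn; auto. }
  assert (so : forall x : V, subset_omega x <-> subset x omega).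
  { intros x; split; intros h n hn; apply omega_spec, h, hn. }
  destruct (hDC r) as (f & (_ & hf) & h).
  - intros p hp; unfold r in hp; apply bigcup_spec in hp; destruct hp as (u & hu & hp).
    apply img_spec in hu; [|dfn]; destruct hu as (x & hx & ->).
    apply img_spec in hp; [|dfn]; destruct hp as (y & hy & ->).
    apply sep_spec in hy; [|dfn]; exists x, y; rewrite !so, is_opair_iff, <- !power_spec; tauto.
  - intros x hx; apply so in hx; destruct (H x hx) as (y & hy & hxy); exists y.
    apply pair_in_iff, rS; auto.
  - assert (fa : forall n, n ∈ omega -> pair_in f n (app f n)).
    { intros n hn; destruct (hf n (proj1 (omega_spec n) hn)) as (y & hy & uy).
      replace (app f n) with y; [exact hy|symmetry].
      apply pair_in_iff in hy; apply app_eq; [|exact hy].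
      exists y; split; [exact hy|]; intros y' hy'; apply uy, pair_in_iff, hy'. }
    exists f; intros n hn.
    assert (hr : opair (app f n) (app f (succ n)) ∈ r).
    { apply pair_in_iff, (h n (succ n)); try apply fa; try nat_side.
      - apply omega_spec, hn.
      - apply is_succ_iff; reflexivity. }
    apply rS in hr; tauto.
Qed.

(** Subsets of [HF] are transported to subsets of omega by the injection [code] and recovered by
    [decode]. *)
Lemma dependent_choice_HF (R : V -> V -> Prop) : D2 R ->
  (forall x, subset x HF -> exists y, subset y HF /\ R x y) ->
  exists f, forall n, n ∈ omega -> subset (app f n) HF /\ R (app f n) (app f (succ n)).
Proof.
  intros hR H.
  set (decode := fun x => sep HF (fun a => code a ∈ x)).
  assert (dS : forall x a, a ∈ decode x <-> a ∈ HF /\ code a ∈ x)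
    by (intros; unfold decode; rewrite sep_spec by dfn; reflexivity).
  destruct (dependent_choice_omega (fun x y => R (decode x) (decode y))) as (f & hf).
  - unfold decode; dfn.
  - intros x hx; destruct (H (decode x)) as (y & hy & h); [intros a ha; apply dS in ha; tauto|].
    exists (img y code); split.
    + intros a ha; apply img_spec in ha; [|dfn]; destruct ha as (b & hb & ->).
      apply code_spec, hy, hb.
    + replace (decode (img y code)) with y; [exact h|].
      apply ext_eq; intros a; rewrite dS, img_spec by dfn; split.
      * intros ha; split; [apply hy, ha|eauto].
      * intros (ha & b & hb & e); apply code_inj in e; subst; auto.
  - assert (dT : T1 (fun n => decode (app f n))) by (unfold decode; dfn).
    exists (lam omega (fun n => decode (app f n))); intros n hn.
    rewrite !app_lam by (assumption || nat_side); split; [|apply hf, hn].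
    intros a ha; apply dS in ha; tauto.
Qed.

(* Each choice may depend on all the previous ones: the state of the dependent choice is
   the sequence [g] built so far, of length [n], coded as
   [{(m, empty) : m < n} ∪ {(m, {x}) : m < n, x ∈ g m}]. *)
Theorem recursive_choice (R : V -> V -> V -> Prop) : D3 R ->
  (forall n g, n ∈ omega ->
     (forall m, m ∈ n -> subset (app g m) HF /\ R m (lam m (fun x => app g x)) (app g m)) ->
     exists y, subset y HF /\ R n (lam n (fun x => app g x)) y) ->
  exists f, forall n, n ∈ omega ->
    subset (app f n) HF /\ R n (lam n (fun x => app f x)) (app f n).
Proof.
  intros hR H.
  (* The markers with second component [empty] record the length even where an entry of the sequence
     is the empty set; singletons keep the elements distinct from these markers. *)
  set (len := fun G => sep omega (fun m => opair m empty ∈ G)).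
  set (get := fun G m => sep HF (fun x => opair m (sing x) ∈ G)).
  set (enc := fun n (F : V -> V) => sep HF (fun p => exists m, m ∈ n /\
    (p = opair m empty \/ exists x, x ∈ F m /\ p = opair m (sing x)))).
  assert (lenS : forall G m, m ∈ len G <-> m ∈ omega /\ opair m empty ∈ G)
    by (intros; unfold len; rewrite sep_spec by dfn; reflexivity).
  assert (getS : forall G m x, x ∈ get G m <-> x ∈ HF /\ opair m (sing x) ∈ G)
    by (intros; unfold get; rewrite sep_spec by dfn; reflexivity).
  assert (getD : T2 get) by (unfold get; dfn).
  assert (lenD : T1 len) by (unfold len; dfn).
  assert (sing_ne : forall x : V, empty <> sing x).
  { intros x e; apply (empty_spec x); rewrite e; apply sing_spec; reflexivity. }
  assert (sing_inj : forall x y : V, sing x = sing y -> x = y).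
  { intros x y e; apply (sing_spec y); rewrite <- e; apply sing_spec; reflexivity. }
  assert (sing_HF : forall x : V, x ∈ HF -> sing x ∈ HF).
  { intros x hx; replace (sing x) with (adj empty x); [apply adj_HF; [apply empty_HF|exact hx]|].
    apply ext_eq; intros z; rewrite adj_spec, sing_spec; pose proof (empty_spec z); tauto. }
  assert (len_enc : forall n F, T1 F -> n ∈ omega -> len (enc n F) = n).
  { intros n F hF hn; apply ext_eq; intros m; rewrite lenS; unfold enc.
    rewrite sep_spec by dfn; split.
    - intros (_ & _ & m' & hm' & [e|(x & _ & e)]); apply opair_inj in e; destruct e as [e e'].
      + subst; exact hm'.
      + destruct (sing_ne x e').
    - intros hm; assert (hm' : m ∈ omega) by nat_side; split; [exact hm'|].
      split; [apply opair_HF; [apply omega_HF, hm'|apply empty_HF]|eauto]. }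
  assert (get_enc : forall n F m, T1 F -> n ∈ omega -> m ∈ n -> subset (F m) HF ->
    get (enc n F) m = F m).
  { intros n F m hF hn hm hFm; apply ext_eq; intros x; rewrite getS; unfold enc.
    rewrite sep_spec by dfn; split.
    - intros (_ & _ & m' & hm' & [e|(y & hy & e)]); apply opair_inj in e; destruct e as [e e'].
      + destruct (sing_ne x (eq_sym e')).
      + apply sing_inj in e'; subst; exact hy.
    - intros hx; pose proof (hFm x hx) as hx'; split; [exact hx'|].
      split; [|eauto 6]; apply opair_HF; [apply omega_HF; nat_side|apply sing_HF, hx']. }
  assert (encHF : forall n F, T1 F -> subset (enc n F) HF)
    by (intros n F hF p hp; apply sep_spec in hp; [tauto|dfn]).
  clearbody enc len get.
  set (valid := fun G => len G ∈ omega /\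
    forall m, m ∈ len G -> R m (lam m (fun x => get G x)) (get G m)).
  assert (validD : D1 valid) by (unfold valid; dfn).
  (* The relation has to be total, so an invalid state is sent to some valid one. As the first state
     is arbitrary, validity is available only from the second state on. *)
  destruct (dependent_choice_HF (fun G G' =>
    (valid G -> valid G' /\ len G' = succ (len G) /\
       forall m, m ∈ len G -> get G' m = get G m) /\
    (~ valid G -> valid G'))) as (f & hf).
  - dfn.
  - intros G hG; destruct (classic (valid G)) as [[hn hv]|hv].
    + set (n := len G) in *.
      destruct (H n (lam n (fun x => get G x)) hn) as (y & hy & hRy).
      { intros m hm; rewrite app_lam by (dfn || assumption).
        split; [intros x hx; apply getS in hx; tauto|].
        replace (lam m (fun x => app (lam n (fun x => get G x)) x))
          with (lam m (fun x => get G x)); [apply hv, hm|].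
        apply lam_ext; [dfn|dfn|]; intros x hx; rewrite app_lam; [reflexivity|dfn|].
        apply (nat_trans n m x); assumption. }
      replace (lam n (fun x => app (lam n (fun x => get G x)) x))
        with (lam n (fun x => get G x)) in hRy
        by (apply lam_ext; [dfn|dfn|]; intros x hx; rewrite app_lam by (dfn || assumption);
            reflexivity).
      set (F := fun m => ite (m = n) y (get G m)).
      assert (hF : T1 F) by (unfold F; dfn).
      assert (Fn : F n = y) by (apply ite_true; reflexivity).
      assert (Fm : forall m, m ∈ n -> F m = get G m).
      { intros m hm; apply ite_false; intros ->; exact (mem_irrefl n hm). }
      assert (FHF : forall m, m ∈ succ n -> subset (F m) HF).
      { intros m hm; apply succ_spec in hm; destruct hm as [hm| ->].
        - rewrite Fm by exact hm; intros x hx; apply getS in hx; tauto.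
        - rewrite Fn; exact hy. }
      clearbody F.
      exists (enc (succ n) F).
      assert (gE : forall m, m ∈ succ n -> get (enc (succ n) F) m = F m).
      { intros m hm; apply get_enc; auto; apply nat_succ, hn. }
      assert (lE : len (enc (succ n) F) = succ n) by (apply len_enc; [exact hF|nat_side]).
      split; [|split; [intros _; split; [split|split]|]].
      * apply encHF, hF.
      * rewrite lE; nat_side.
      * rewrite lE; intros m hm; rewrite (gE m hm).
        replace (lam m (fun x => get (enc (succ n) F) x)) with (lam m (fun x => get G x)).
        -- apply succ_spec in hm; destruct hm as [hm| ->].
           ++ rewrite Fm by exact hm; apply hv, hm.
           ++ rewrite Fn; exact hRy.
        -- apply lam_ext; [dfn|dfn|]; intros x hx.
           assert (hxn : x ∈ n).
           { apply succ_spec in hm; destruct hm as [hm| ->]; [|exact hx].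
             apply (nat_trans n m x); assumption. }
           rewrite gE, Fm by (exact hxn || apply succ_spec; auto); reflexivity.
      * exact lE.
      * intros m hm; rewrite gE, Fm by (exact hm || apply succ_spec; auto); reflexivity.
      * intros h; destruct h; split; assumption.
    + exists empty; split; [intros z hz; destruct (empty_spec z hz)|].
      split; [intros h; destruct (hv h)|intros _].
      assert (l0 : len empty = empty).
      { apply ext_eq; intros m; rewrite lenS; split; [intros [_ h]|intros h];
          destruct (empty_spec _ h). }
      split; rewrite l0; [apply nat_0|intros m hm; destruct (empty_spec m hm)].
  - assert (fv : forall n, n ∈ omega -> valid (app f (succ n))).
    { intros n hn; destruct (hf n hn) as (_ & h1 & h2).
      destruct (classic (valid (app f n))) as [h|h]; [apply h1, h|apply h2, h]. }
    assert (fs : forall n, n ∈ omega ->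
      len (app f (succ (succ n))) = succ (len (app f (succ n))) /\
      forall m, m ∈ len (app f (succ n)) ->
        get (app f (succ (succ n))) m = get (app f (succ n)) m).
    { intros n hn; destruct (hf (succ n) (nat_succ n hn)) as (_ & h1 & _).
      destruct (h1 (fv n hn)) as (_ & h); exact h. }
    assert (ll : forall n, n ∈ omega -> forall m, m ∈ n -> m ∈ len (app f (succ n))).
    { nat_induction; [intros m hm; destruct (empty_spec m hm)|].
      intros n hn IH m hm; rewrite (proj1 (fs n hn)).
      destruct (fv n hn) as (hl & _).
      assert (n ∉ len (app f (succ n)) -> n = len (app f (succ n))).
      { intros h; destruct (nat_total n hn _ hl) as [g|[g|g]]; [|auto|tauto].
        destruct (mem_irrefl _ (IH _ g)). }
      apply succ_spec; apply succ_spec in hm; destruct hm as [hm| ->]; [auto|].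
      destruct (classic (n ∈ len (app f (succ n)))); auto. }
    assert (stab : forall n, n ∈ omega -> forall m, m ∈ n -> forall x,
      x ∈ len (app f (succ m)) -> x ∈ len (app f (succ n)) /\
        get (app f (succ n)) x = get (app f (succ m)) x).
    { nat_induction; [intros m hm; destruct (empty_spec m hm)|].
      intros n hn IH m hm x hx; rewrite (proj1 (fs n hn)), succ_spec.
      apply succ_spec in hm; destruct hm as [hm| ->].
      - destruct (IH m hm x hx) as [g1 g2]; split; [auto|].
        rewrite (proj2 (fs n hn)) by exact g1; exact g2.
      - split; [auto|apply (fs n hn), hx]. }
    (* The state at [succ (succ m)] is the earliest one guaranteed by [ll] to have length above [m];
       by [stab] its entry at [m] never changes afterwards. *)
    assert (hT : T1 (fun m => get (app f (succ (succ m))) m)) by dfn.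
    exists (lam omega (fun m => get (app f (succ (succ m))) m)); intros n hn.
    rewrite app_lam by assumption.
    split; [intros x hx; apply getS in hx; tauto|].
    destruct (fv (succ n) (nat_succ n hn)) as (hl & hv).
    assert (hnl : n ∈ len (app f (succ (succ n)))) by (apply ll; [nat_side|apply mem_succ]).
    specialize (hv n hnl).
    replace (lam n (fun x => app (lam omega (fun m => get (app f (succ (succ m))) m)) x))
      with (lam n (fun x => get (app f (succ (succ n))) x)); [exact hv|].
    apply lam_ext; [dfn|dfn|]; intros x hx; assert (hx' : x ∈ omega) by nat_side.
    rewrite app_lam by assumption.
    apply (stab (succ n) (nat_succ n hn) (succ x)); [clear - hZF hx hx' hn; nord|].
    apply ll; [nat_side|apply mem_succ].
Qed.

(** Step [n] of a recursive choice serves the element of [X] with code [n], if there is one, and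
    ignores the earlier choices. *)
Lemma countable_choice X (R : V -> V -> Prop) : D2 R -> subset X HF ->
  (forall x, x ∈ X -> exists y, subset y HF /\ R x y) ->
  exists f, forall x, x ∈ X -> subset (app f x) HF /\ R x (app f x).
Proof.
  intros hR hX H.
  destruct (recursive_choice (fun n _ y => forall x, x ∈ X -> code x = n -> R x y))
    as (f & hf); [dfn| |].
  - intros n g _ _; destruct (classic (exists x, x ∈ X /\ code x = n)) as [(x & hx & e)|h].
    + destruct (H x hx) as (y & hy & h); exists y; split; [exact hy|].
      intros x' hx' e'; rewrite (code_inj x' x); auto; congruence.
    + exists empty; split; [intros z hz; destruct (empty_spec z hz)|].
      intros x hx e; destruct h; eauto.
  - exists (lam X (fun x => app f (code x))); intros x hx.
    rewrite app_lam by (dfn || assumption).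
    destruct (hf (code x)) as (h1 & h2); [apply code_spec, hX, hx|auto].
Qed.

End DependentChoice.

(** * Codings *)

Section Codings.
Context {V : set_structure} {hZF : ZF V}.

Definition inter (x y : V) : V := sep x (fun z => z ∈ y).

(* A relation [d] between stages and points codes sets of points by streams. *)
Definition coded (d w : V) : V :=
  sep HF (fun x => exists m, m ∈ omega /\ opair (below w m) x ∈ d).

(** The last clause asks for a tree instead of a single stream [v], because witnesses for several
    substreams must be interleaved in the order that the labels dictate. *)
Definition coding (d P I : V) : Prop :=
  (forall q, q ∈ d -> exists s x, stage s /\ x ∈ P /\ q = opair s x) /\
  (forall w, stream w -> coded d w ∉ I) /\
  (forall w Q, stream w -> subset Q (coded d w) -> Q ∉ I ->
     exists T, tree T /\ (forall s, s ∈ T -> subset s w) /\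
       forall v, branch T v -> subset (coded d v) Q).

(* Every sequence [A] of positive sets admits a coding into its union.  The last clause
   forces a set containing enough of the coded sets to be positive on all the [A a]. *)
Definition codable (S I : V) : Prop :=
  forall A, (forall a, a ∈ omega -> subset (app A a) S /\ app A a ∉ I) ->
  exists d, coding d (bigcup (img omega (fun a => app A a))) I /\
    forall a B, a ∈ omega -> subset B S ->
      (forall n, n ∈ omega -> exists w b,
         stream w /\ n ∈ b /\ first_unit w a b /\ subset (coded d w) B) ->
      inter B (app A a) ∉ I.

Variable k : nat.
Implicit Types t u v : @env V k -> V.
Lemma T_coded t u : T k t -> T k u -> T k (fun e => coded (t e) (u e)).
Proof. intros; unfold coded; dfn. Qed.
End Codings.

Ltac dfn_coded := first [dfn_pairs | apply T_coded].
Ltac dfn_lemma ::= dfn_coded.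

Section CodingsDefinability.
Context {V : set_structure} {hZF : ZF V}.
Variable k : nat.
Implicit Types t u v : @env V k -> V.
Lemma D_coding t u v : T k t -> T k u -> T k v -> D k (fun e => coding (t e) (u e) (v e)).
Proof. intros; unfold coding; dfn. Qed.
End CodingsDefinability.

Ltac dfn_coding := first [dfn_coded | apply D_coding].
Ltac dfn_lemma ::= dfn_coding.

Section CodingsTheory.
Context {V : set_structure} {hZF : ZF V}.

Lemma D_codable k (t u : env k -> V) : T k t -> T k u -> D k (fun e => codable (t e) (u e)).
Proof. intros; unfold codable; dfn. Qed.

Lemma inter_spec (x y z : V) : z ∈ inter x y <-> z ∈ x /\ z ∈ y.
Proof. unfold inter; rewrite sep_spec by dfn; reflexivity. Qed.

Lemma coded_spec d w x : x ∈ coded d w <->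
  x ∈ HF /\ exists m, m ∈ omega /\ opair (below w m) x ∈ d.
Proof. unfold coded; rewrite sep_spec by dfn; reflexivity. Qed.

Lemma coded_subset d P I w : coding d P I -> subset (coded d w) P.
Proof.
  intros (h & _) x hx; apply coded_spec in hx; destruct hx as (_ & m & _ & hx).
  destruct (h _ hx) as (s & y & _ & hy & e); apply opair_inj in e; destruct e; subst; exact hy.
Qed.

(** This is what makes codings eligible for [countable_choice]. *)
Lemma coding_HF d P I : subset P HF -> coding d P I -> subset d HF.
Proof.
  intros hP (h & _) q hq; destruct (h q hq) as (s & x & (hs & _) & hx & ->).
  apply opair_HF; auto.
Qed.

Lemma first_unit_below w m a b : m ∈ omega ->
  (first_unit (below w m) a b <-> first_unit w a b /\ a ∈ m).
Proof.
  intros hm; unfold first_unit; split.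
  - intros (h & h'); apply below_spec in h; destruct h as (h & ha).
    split; [split; [exact h|]|exact ha]; intros x y hxy hxa.
    apply (h' x y); [|exact hxa]; apply below_spec; split; [exact hxy|].
    apply (nat_trans m a x); assumption.
  - intros ((h & h') & ha); split; [apply below_spec; auto|].
    intros x y hxy; apply below_spec in hxy; apply (h' x y); tauto.
Qed.

Lemma rest_below w c m : units w -> rest (below w m) c = below (rest w c) m.
Proof.
  intros hu; apply units_ext.
  - apply (units_subset _ w); [|exact hu]; intros p hp.
    apply (below_subset w m), (rest_subset _ c), hp.
  - apply (units_subset _ w); [|exact hu]; intros p hp.
    apply (rest_subset w c), (below_subset _ m), hp.
  - intros a b _ _ _; rewrite rest_spec, !below_spec, rest_spec; tauto.
Qed.

Lemma below_rest_small w a m : units w -> a ∈ omega -> m ∈ omega -> a ∉ m ->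
  below (rest w a) m = empty.
Proof.
  intros hu ha hm h; apply ext_eq; intros p; split; intros hp; [|destruct (empty_spec p hp)].
  pose proof (rest_subset _ _ p (below_subset _ _ p hp)) as hp'.
  destruct (hu p hp') as (x & y & hx & _ & _ & ->).
  apply below_spec in hp; rewrite rest_spec in hp; destruct hp as ((_ & h1) & h2).
  destruct h; apply (nat_trans m x a); assumption.
Qed.

(** * Codings for Fubini sums *)

Section FubiniCoding.
(** Frame for both uses. For a Fubini sum, [pi] is the first coordinate and [K] consists of the sets
    all of whose sections lie in the respective ideals; for Fin, [pi] is the identity and only the
    empty set is in [K]. *)
Variables (S K I : V) (pi : V -> V).
Let fibre (X n : V) : V := sep X (fun x => pi x = n).
Hypothesis hpi : T1 pi.
Hypothesis hS : subset S HF.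
Hypothesis K0 : empty ∈ K.
Hypothesis Kdown : forall X Y, X ∈ K -> subset Y X -> Y ∈ K.
Hypothesis Kunion : forall X Y, X ∈ K -> Y ∈ K -> union2 X Y ∈ K.
Hypothesis hI : forall X, X ∈ I <-> subset X S /\
  exists N, N ∈ omega /\ forall n, n ∈ omega -> n ∉ N -> fibre X n ∈ K.
Hypothesis hfibre : forall n P, n ∈ omega -> subset P S -> (forall x, x ∈ P -> pi x = n) ->
  P ∉ K -> exists d, coding d P K.
Hypothesis hDC : DC_R V.

Lemma fibre_spec X n x : x ∈ fibre X n <-> x ∈ X /\ pi x = n.
Proof. unfold fibre; rewrite sep_spec by dfn; reflexivity. Qed.

Section OneSequence.
Variable A : V.
Hypothesis hA : forall a, a ∈ omega -> subset (app A a) S /\ app A a ∉ I.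

(** Taking the least suitable column avoids a choice. A large [b] pushes the piece of [app A a]
    beyond any bounded set of columns. *)
Let column (a b : V) : V := least (fun n => b ∈ n /\ fibre (app A a) n ∉ K).
Let piece (a b : V) : V := fibre (app A a) (column a b).

Lemma column_spec a b : a ∈ omega -> b ∈ omega ->
  column a b ∈ omega /\ b ∈ column a b /\ piece a b ∉ K.
Proof.
  intros ha hb; destruct (hA a ha) as (h1 & h2).
  destruct (least_spec (fun n => b ∈ n /\ fibre (app A a) n ∉ K)) as (g1 & g2 & _).
  - unfold fibre; dfn.
  - apply NNPP; intros H; apply h2, hI; split; [exact h1|].
    exists (succ b); split; [nat_side|]; intros n hn hnb; apply NNPP; intros hK.
    apply H; exists n; split; [exact hn|split; [|exact hK]].
    clear - hZF hn hb hnb; nord.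
  - split; [exact g1|exact g2].
Qed.

Lemma piece_spec a b x : x ∈ piece a b <-> x ∈ app A a /\ pi x = column a b.
Proof. apply fibre_spec. Qed.

Lemma piece_codings : exists f, forall a b, a ∈ omega -> b ∈ omega ->
  subset (app f (opair a b)) HF /\ coding (app f (opair a b)) (piece a b) K.
Proof.
  set (X := sep HF (fun p => exists a b, a ∈ omega /\ b ∈ omega /\ p = opair a b)).
  assert (XS : forall p, p ∈ X <-> exists a b, a ∈ omega /\ b ∈ omega /\ p = opair a b).
  { intros p; unfold X; rewrite sep_spec by dfn; split; [tauto|].
    intros (a & b & ha & hb & ->); split; [|eauto].
    apply opair_HF; apply omega_HF; assumption. }
  destruct (countable_choice hDC X (fun p d => forall a b, p = opair a b ->
    coding d (piece a b) K)) as (f & hf).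
  - unfold piece, column, fibre; dfn.
  - intros p hp; unfold X in hp; apply sep_spec in hp; [tauto|dfn].
  - intros p hp; apply XS in hp; destruct hp as (a & b & ha & hb & ->).
    destruct (column_spec a b ha hb) as (h1 & _ & h2).
    destruct (hfibre (column a b) (piece a b) h1) as (d & hd); [|  |exact h2|].
    + intros x hx; apply piece_spec in hx; apply (hA a ha); tauto.
    + intros x hx; apply piece_spec in hx; tauto.
    + exists d; split.
      * apply (coding_HF d (piece a b) K); [|exact hd]; intros x hx.
        apply piece_spec in hx; apply hS, (hA a ha); tauto.
      * intros a' b' e; apply opair_inj in e; destruct e; subst; exact hd.
  - exists f; intros a b ha hb.
    destruct (hf (opair a b)) as (h1 & h2); [apply XS; eauto|auto].
Qed.

Section OneChoice.
Variable f : V.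
Hypothesis hf : forall a b, a ∈ omega -> b ∈ omega ->
  subset (app f (opair a b)) HF /\ coding (app f (opair a b)) (piece a b) K.

Let tailset (w i a b : V) : V := coded (app f (opair a b)) (rest (part w i) a).

(** A stage already shows the first unit of each of its nonempty parts, so the code of a sum is
    again given by a relation between stages and points. *)
Let code_rel : V :=
  sep HF (fun q => exists s x i a b, q = opair s x /\ stage s /\ i ∈ omega /\
    first_unit (part s i) a b /\ opair (rest (part s i) a) x ∈ app f (opair a b)).

Lemma code_rel_spec s x : opair s x ∈ code_rel <-> opair s x ∈ HF /\ stage s /\
  exists i a b, i ∈ omega /\ first_unit (part s i) a b /\
    opair (rest (part s i) a) x ∈ app f (opair a b).
Proof.
  unfold code_rel; rewrite sep_spec by dfn; split.
  - intros (h & s' & x' & i & a & b & e & hs & hi & h1 & h2).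
    apply opair_inj in e; destruct e; subst s' x'; split; [exact h|split; [exact hs|]].
    exists i, a, b; auto.
  - intros (h & hs & i & a & b & hi & h1 & h2); split; [exact h|].
    exists s, x, i, a, b; auto 7.
Qed.

Lemma first_unit_nat w a b : units w -> first_unit w a b ->
  a ∈ omega /\ b ∈ omega /\ a ∈ b.
Proof. intros hu (h & _); exact (units_mem w a b hu h). Qed.

Lemma units_part w i : units w -> units (part w i).
Proof. intros hu; apply (units_subset _ w); [apply part_subset|exact hu]. Qed.

Lemma tailset_piece w i a b : a ∈ omega -> b ∈ omega -> subset (tailset w i a b) (piece a b).
Proof. intros ha hb; apply (coded_subset _ _ K), hf; assumption. Qed.

Lemma tailset_positive w i a b : stream w -> i ∈ omega -> first_unit (part w i) a b ->
  tailset w i a b ∉ K.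
Proof.
  intros hw hi h; destruct (first_unit_nat _ a b (units_part w i (proj1 hw)) h) as (ha & hb & _).
  apply (hf a b ha hb), stream_rest; [apply stream_part; assumption|exact ha].
Qed.

Lemma coded_code_rel w x : stream w -> (x ∈ coded code_rel w <->
  exists i a b, i ∈ omega /\ first_unit (part w i) a b /\ x ∈ tailset w i a b).
Proof.
  intros hw; pose proof (proj1 hw) as hu; unfold tailset; rewrite coded_spec; split.
  - intros (hx & m & hm & h); apply code_rel_spec in h.
    destruct h as (_ & _ & i & a & b & hi & h1 & h2).
    rewrite (part_below w m i hu hm) in h1, h2.
    apply first_unit_below in h1; [|exact hm]; destruct h1 as (h1 & _).
    rewrite rest_below in h2 by apply units_part, hu.
    exists i, a, b; split; [exact hi|split; [exact h1|]]; apply coded_spec; eauto.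
  - intros (i & a & b & hi & h1 & hx); apply coded_spec in hx.
    destruct hx as (hx & m & hm & h2); split; [exact hx|].
    pose proof (units_part w i hu) as hu'.
    destruct (first_unit_nat _ a b hu' h1) as (ha & hb & _).
    (* The stage must be long enough to contain the first unit itself. If [m] does not exceed [a],
       the tail below [m] is empty, and so is the tail below [succ a]. *)
    assert (ex : exists l, l ∈ omega /\ a ∈ l /\
      below (rest (part w i) a) l = below (rest (part w i) a) m).
    { destruct (classic (a ∈ m)) as [h|h]; [eauto|].
      exists (succ a); split; [nat_side|split; [apply mem_succ|]].
      rewrite (below_rest_small _ a m hu' ha hm h); apply ext_eq; intros p; split; intros hp;
        [|destruct (empty_spec p hp)].
      pose proof (rest_subset _ _ p (below_subset _ _ p hp)) as hp'.
      destruct (hu' p hp') as (c & c' & hc & _ & _ & ->).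
      apply below_spec in hp; rewrite rest_spec in hp; destruct hp as ((_ & g1) & g2).
      exfalso; clear - hZF g1 g2 hc ha; nord. }
    destruct ex as (l & hl & hal & e); exists l; split; [exact hl|].
    pose proof (stage_below w hw l hl) as hs.
    apply code_rel_spec; split; [apply opair_HF; [apply hs|exact hx]|split; [exact hs|]].
    exists i, a, b; rewrite (part_below w l i hu hl); split; [exact hi|split].
    + apply first_unit_below; auto.
    + rewrite rest_below, e by exact hu'; exact h2.
Qed.

(** The unit at [a] has label [i], so i <= a < b < column: a late substream contributes to a late
    column only. *)
Lemma index_lt_column w i a b : stream w -> i ∈ omega -> first_unit (part w i) a b ->
  a ∈ omega /\ b ∈ omega /\ i ∈ succ a /\ b ∈ column a b /\ i ∈ column a b /\
  column a b ∈ omega.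
Proof.
  intros hw hi h; pose proof (units_part w i (proj1 hw)) as hu'.
  destruct (first_unit_nat _ a b hu' h) as (ha & hb & hab).
  destruct (column_spec a b ha hb) as (h1 & h2 & _).
  destruct h as (h & _); apply part_spec in h; destruct h as (_ & h).
  destruct (label_spec w a ha) as (_ & h'); rewrite h in h'.
  clear - hZF hi ha hb hab h1 h2 h'; generalize dependent (column a b); intros c hc hbc.
  assert (i ∈ succ a) by nord.
  repeat split; try assumption; nord.
Qed.

(** For every bound [N], the substream with index [N] contributes a positive set in a column beyond
    [N]. *)
Lemma code_rel_positive w : stream w -> coded code_rel w ∉ I.
Proof.
  intros hw h; apply hI in h; destruct h as (_ & N & hN & h).
  destruct (first_unit_exists (part w N) (stream_part w N hw hN)) as (a & b & hab).
  destruct (index_lt_column w N a b hw hN hab) as (ha & hb & _ & _ & h1 & h2).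
  apply (tailset_positive w N a b hw hN hab).
  apply (Kdown (fibre (coded code_rel w) (column a b))).
  - apply h; [exact h2|]; intros h'; exact (nat_asym N _ hN h1 h').
  - intros x hx; apply fibre_spec; split; [apply coded_code_rel; eauto 6|].
    apply tailset_piece, piece_spec in hx; tauto.
Qed.

Lemma code_rel_range q : q ∈ code_rel ->
  exists s x, stage s /\ x ∈ bigcup (img omega (fun a => app A a)) /\ q = opair s x.
Proof.
  intros hq; pose proof hq as hq'; unfold code_rel in hq'; apply sep_spec in hq'; [|dfn].
  destruct hq' as (_ & s & x & i & a & b & -> & hs & hi & h1 & h2).
  exists s, x; split; [exact hs|split; [|reflexivity]].
  destruct (first_unit_nat _ a b (units_part s i (proj1 (proj2 hs))) h1) as (ha & hb & _).
  destruct (hf a b ha hb) as (_ & (h & _)).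
  destruct (h _ h2) as (s' & x' & _ & hx & e); apply opair_inj in e; destruct e; subst s' x'.
  apply piece_spec in hx; apply bigcup_spec; exists (app A a); split; [|tauto].
  apply img_spec; [dfn|eauto].
Qed.

Section Trees.
Variables w Q : V.
Hypothesis hw : stream w.
Hypothesis hQ : subset Q (coded code_rel w).
Hypothesis hQI : Q ∉ I.

Let good (i a b : V) : Prop :=
  i ∈ omega /\ first_unit (part w i) a b /\ inter Q (tailset w i a b) ∉ K.

(** Only the finitely many substreams with index below [n] can reach column [n]. As [K] is closed
    under finite unions, one of their contributions has a positive intersection with [Q]. *)
Lemma good_in_fibre n : n ∈ omega -> fibre Q n ∉ K ->
  exists i a b, good i a b /\ column a b = n.
Proof.
  intros hn hK; apply NNPP; intros H; apply hK.
  assert (C : forall m, m ∈ omega -> sep (fibre Q n) (fun x => exists i a b,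
    i ∈ m /\ first_unit (part w i) a b /\ x ∈ tailset w i a b) ∈ K).
  { unfold tailset, fibre; nat_induction; fold (fibre Q n).
    - apply (Kdown empty); [exact K0|]; intros x hx; apply sep_spec in hx; [|dfn].
      destruct hx as (_ & i & a & b & hi & _); destruct (empty_spec i hi).
    - intros m hm IH.
      destruct (first_unit_exists (part w m) (stream_part w m hw hm)) as (a & b & hab).
      destruct (index_lt_column w m a b hw hm hab) as (ha & hb & _).
      set (Y := inter (fibre Q n) (tailset w m a b)).
      assert (hY : Y ∈ K).
      { destruct (classic (column a b = n)) as [e|e].
        - apply NNPP; intros hY; apply H; exists m, a, b; split; [|exact e].
          split; [exact hm|split; [exact hab|]]; intros h; apply hY.
          apply (Kdown _ Y h); intros x hx; apply inter_spec in hx.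
          apply inter_spec; destruct hx as (hx & hx'); apply fibre_spec in hx; tauto.
        - apply (Kdown empty); [exact K0|]; intros x hx; exfalso; apply inter_spec in hx.
          destruct hx as (h1 & h2); apply fibre_spec in h1; destruct h1 as (_ & h1).
          apply tailset_piece, piece_spec in h2; try assumption.
          apply e; rewrite <- h1; symmetry; tauto. }
      apply (Kdown _ _ (Kunion _ Y IH hY)).
      intros x hx; apply sep_spec in hx; [|dfn].
      destruct hx as (hx & i & c & c' & hi & h1 & h2).
      apply union2_spec; apply succ_spec in hi; destruct hi as [hi| ->].
      + left; apply sep_spec; [dfn|]; split; [exact hx|eauto 7].
      + right; apply inter_spec; split; [exact hx|].
        pose proof (stream_part w m hw hm) as hp.
        destruct (first_unit_unique (part w m) c c' a b) as (-> & ->); try assumption;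
          apply hp. }
  apply (Kdown _ _ (C n hn)); intros x hx; apply sep_spec; [unfold tailset; dfn|].
  split; [exact hx|]; apply fibre_spec in hx; destruct hx as (hx & e).
  apply hQ, coded_code_rel in hx; [|exact hw]; destruct hx as (i & a & b & hi & hab & hx).
  destruct (index_lt_column w i a b hw hi hab) as (ha & hb & _ & _ & h & _).
  exists i, a, b; split; [|auto].
  apply tailset_piece, piece_spec in hx; try assumption.
  destruct hx as (_ & hx); rewrite hx in e; rewrite <- e; exact h.
Qed.

(** If all good units started at or below [N], their indices would be at most [N] as well, so [Q]
    would have positive fibres in finitely many columns only and lie in [I]. *)
Lemma good_unbounded N : N ∈ omega -> exists i a b, good i a b /\ N ∈ a.
Proof.
  intros hN; apply NNPP; intros H; apply hQI, hI; split.
  { intros x hx; apply hQ, coded_code_rel in hx; [|exact hw].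
    destruct hx as (i & a & b & hi & hab & hx).
    destruct (index_lt_column w i a b hw hi hab) as (ha & hb & _).
    apply tailset_piece, piece_spec in hx; try assumption; apply (hA a ha); tauto. }
  destruct (collect_bound (fun i n => exists a b,
    first_unit (part w i) a b /\ n = column a b)
    ltac:(unfold column, fibre; dfn) (succ N) (nat_succ N hN)) as (M & hM & h).
  - intros i hi; assert (hi' : i ∈ omega) by nat_side.
    pose proof (stream_part w i hw hi') as hp.
    destruct (first_unit_exists _ hp) as (a & b & hab).
    destruct (index_lt_column w i a b hw hi' hab) as (_ & _ & _ & _ & _ & hc).
    exists (succ (column a b)); split; [nat_side|]; intros x (a' & b' & hab' & ->).
    destruct (first_unit_unique (part w i) a' b' a b) as (-> & ->); try assumption;
      try apply hp; apply mem_succ.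
  - exists M; split; [exact hM|]; intros n hn hnM; apply NNPP; intros hK.
    destruct (good_in_fibre n hn hK) as (i & a & b & hg & <-).
    pose proof hg as (hi & hab & _).
    destruct (index_lt_column w i a b hw hi hab) as (ha & hb & hia & _).
    apply hnM, (h i); [|eauto].
    assert (N ∉ a) by (intros h'; apply H; eauto).
    clear - hZF H0 ha hN hia hi; nord.
Qed.

(** The index determines the first unit of its substream, so one countable choice over omega
    provides all trees; an index without a good unit receives the empty set. *)
Lemma good_trees : exists F, forall i a b, good i a b ->
  tree (app F i) /\ (forall s, s ∈ app F i -> subset s (rest (part w i) a)) /\
  forall v, branch (app F i) v -> subset (coded (app f (opair a b)) v) Q.
Proof.
  destruct (countable_choice hDC omega (fun i T => forall a b, good i a b ->
    tree T /\ (forall s, s ∈ T -> subset s (rest (part w i) a)) /\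
    forall v, branch T v -> subset (coded (app f (opair a b)) v) Q)) as (F & hF).
  - unfold good, tailset; dfn.
  - exact omega_HF.
  - intros i hi; pose proof (stream_part w i hw hi) as hp.
    destruct (first_unit_exists _ hp) as (a & b & hab).
    destruct (index_lt_column w i a b hw hi hab) as (ha & hb & _).
    assert (un : forall a' b', good i a' b' -> a' = a /\ b' = b).
    { intros a' b' (_ & h & _); apply (first_unit_unique (part w i)); try assumption;
        apply hp. }
    destruct (classic (good i a b)) as [(_ & _ & hK)|hg].
    + destruct (hf a b ha hb) as (_ & _ & _ & hd).
      destruct (hd (rest (part w i) a) (inter Q (tailset w i a b))) as (T & h1 & h2 & h3).
      * apply stream_rest; assumption.
      * intros x hx; apply inter_spec in hx; tauto.
      * exact hK.
      * exists T; split; [intros s hs; apply (proj2 h1 s hs)|].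
        intros a' b' h; destruct (un a' b' h); subst a' b'.
        split; [exact h1|split; [exact h2|]]; intros v hv x hx.
        apply (h3 v hv), inter_spec in hx; tauto.
    + exists empty; split; [intros z hz; destruct (empty_spec z hz)|].
      intros a' b' h; destruct (un a' b' h); subst a' b'; destruct (hg h).
  - exists F; intros i a b h; apply (hF i (proj1 h)), h.
Qed.

Lemma good_index i a b i' b' : good i a b -> good i' a b' -> i = i'.
Proof.
  intros (_ & (h & _) & _) (_ & (h' & _) & _); apply part_spec in h, h'.
  destruct h, h'; congruence.
Qed.

(** At the root [T0] offers all good units, which start arbitrarily late by [good_unbounded]; after
    such a unit it follows the tree chosen for its substream. *)
Lemma code_rel_tree : exists T, tree T /\ (forall s, s ∈ T -> subset s w) /\
  forall v, branch T v -> subset (coded code_rel v) Q.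
Proof.
  destruct good_trees as (F & hF).
  set (T0 := sep HF (fun s => s = empty \/ exists i a b t, good i a b /\
    t ∈ app F i /\ s = adj t (opair a b))).
  assert (tS : forall i a b t, good i a b -> t ∈ app F i -> stage (adj t (opair a b)) /\
    subset t (rest (part w i) a) /\ a ∈ omega /\ b ∈ omega /\
    subset (adj t (opair a b)) (part w i)).
  { intros i a b t hg ht; destruct (hF i a b hg) as (h1 & h2 & _).
    pose proof hg as (hi & hab & _).
    destruct (first_unit_nat _ a b (units_part w i (proj1 hw)) hab) as (ha & hb & hlt).
    pose proof (h2 t ht) as h3; split; [|split; [exact h3|split; [exact ha|split; [exact hb|]]]].
    - apply stage_adj; try assumption; [apply (proj2 h1 t ht)|].
      intros x y h ->; apply h3, rest_spec in h; exact (mem_irrefl a (proj2 h)).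
    - intros p hp; apply adj_spec in hp; destruct hp as [hp| ->]; [|apply hab].
      apply (rest_subset _ a), h3, hp. }
  assert (T0S : forall s, s ∈ T0 <-> s = empty \/ exists i a b t, good i a b /\
    t ∈ app F i /\ s = adj t (opair a b)).
  { intros s; unfold T0; rewrite sep_spec by (unfold good, tailset; dfn); split; [tauto|].
    intros h; split; [|exact h]; destruct h as [->|(i & a & b & t & hg & ht & ->)];
      [apply empty_HF|apply (tS i a b t hg ht)]. }
  clearbody T0.
  assert (T0sub : forall s, s ∈ T0 -> subset s w).
  { intros s hs p hp; apply T0S in hs; destruct hs as [->|(i & a & b & t & hg & ht & ->)];
      [destruct (empty_spec p hp)|].
    apply (part_subset w i), (tS i a b t hg ht), hp. }
  assert (T0tree : tree T0).
  { split; [apply T0S; auto|]; intros s hs; apply T0S in hs.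
    destruct hs as [->|(i & a & b & t & hg & ht & ->)].
    - split; [apply stage_empty|]; intros n hn.
      destruct (good_unbounded n hn) as (i & a & b & hg & hna); exists a, b.
      split; [exact hna|split; [intros x y h; destruct (empty_spec _ h)|]].
      apply T0S; right; exists i, a, b, empty; split; [exact hg|split; [|reflexivity]].
      apply (hF i a b hg).
    - destruct (tS i a b t hg ht) as (h1 & h2 & ha & hb & _); split; [exact h1|].
      intros n hn; destruct (nat_bound n a hn ha) as (L & hL & g1 & g2).
      destruct (tree_extend (app F i) t L) as (c & c' & k1 & k2 & k3 & k4 & k5 & k6);
        [apply (hF i a b hg)|exact ht|exact hL|].
      exists c, c'; split; [apply (nat_trans c L n); assumption|split].
      + intros x y h; apply adj_spec in h; destruct h as [h|h]; [exact (k5 x y h)|].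
        apply opair_inj in h; destruct h; subst; apply (nat_trans c L a); assumption.
      + apply T0S; right; exists i, a, b, (adj t (opair c c')).
        split; [exact hg|split; [exact k6|]]; apply ext_eq; intros z; rewrite !adj_spec; tauto. }
  (* The first unit of a branch of [T0] fixes the index by [good_index]; hence all longer nodes come
     from the same chosen tree, and the rest of the branch is a branch of it. *)
  assert (T0branch : forall v a b, branch T0 v -> first_unit v a b ->
    subset (coded (app f (opair a b)) (rest v a)) Q).
  { intros v a b (hv & hb) hab; pose proof hv as (hu & hfun & _).
    destruct (first_unit_nat v a b hu hab) as (ha & hb' & _).
    assert (shape : forall m, m ∈ omega -> a ∈ m -> exists i t,
      good i a b /\ t ∈ app F i /\ below v m = adj t (opair a b)).
    { intros m hm ham; specialize (hb m hm); apply T0S in hb.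
      assert (hin : opair a b ∈ below v m) by (apply below_spec; split; [apply hab|exact ham]).
      destruct hb as [e|(i & a' & b' & t & hg & ht & e)];
        [rewrite e in hin; destruct (empty_spec _ hin)|].
      assert (hin' : opair a' b' ∈ v).
      { apply (below_subset v m); rewrite e; apply adj_spec; auto. }
      destruct (tS i a' b' t hg ht) as (_ & h2 & ha' & _).
      rewrite e in hin; apply adj_spec in hin; destruct hin as [hin|hin].
      - apply h2, rest_spec in hin; destruct (proj2 hab _ _ hin' (proj2 hin)).
      - apply opair_inj in hin; destruct hin; subst a' b'; exists i, t; auto. }
    destruct (shape (succ a)) as (i & t0 & hg & _); [nat_side|apply mem_succ|].
    apply (hF i a b hg); split; [apply stream_rest; assumption|]; intros m hm.
    destruct (classic (a ∈ m)) as [ham|ham].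
    - destruct (shape m hm ham) as (i' & t & hg' & ht & e).
      rewrite <- (good_index i a b i' b hg hg') in ht.
      destruct (tS i a b t hg ht) as ((_ & hu' & _) & h2 & _).
      replace (below (rest v a) m) with t; [exact ht|].
      apply units_ext.
      + apply (units_subset _ (adj t (opair a b))); [|exact hu'].
        intros z hz; apply adj_spec; auto.
      + apply (units_subset _ v); [|exact hu]; intros p hp.
        apply (rest_subset v a), (below_subset _ m), hp.
      + intros x y _ _ _; rewrite below_spec, rest_spec.
        assert (e' : opair x y ∈ below v m <-> opair x y ∈ adj t (opair a b))
          by (rewrite e; reflexivity).
        rewrite below_spec, adj_spec in e'; split.
        * intros h; pose proof (h2 _ h) as h3; apply rest_spec in h3; tauto.
        * intros ((h3 & h4) & h5); destruct (proj1 e' (conj h3 h5)) as [h|h]; [exact h|].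
          apply opair_inj in h; destruct h; subst; destruct (mem_irrefl a h4).
    - rewrite below_rest_small by assumption; apply (hF i a b hg). }
  (* All substreams of the new branch follow [T0], whatever their indices. The code of a substream
     depends on its first unit and its tail, not on the index that these units had in [w]. *)
  exists (comb T0 T0); split; [apply tree_comb; exact T0tree|split].
  - intros s hs p hp; apply comb_spec in hs; destruct hs as ((_ & hu & _) & h0 & h1).
    destruct (hu p hp) as (x & y & hx & _ & _ & ->).
    assert (hp' : opair x y ∈ part s (label s x)) by (apply part_spec; auto).
    destruct (label_spec s x hx) as (hl & _).
    destruct (classic (label s x = empty)) as [e|e].
    + rewrite e in hp'; apply (T0sub _ h0), hp'.
    + apply (T0sub _ (h1 _ hl e)), hp'.
  - intros v hv x hx; pose proof (proj1 hv) as hs.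
    apply coded_code_rel in hx; [|exact hs]; destruct hx as (i & a & b & hi & hab & hx).
    apply (T0branch (part v i) a b); [|exact hab|exact hx].
    destruct (branch_comb T0 T0 v hv) as (h0 & h1).
    destruct (classic (i = empty)) as [->|e]; [exact h0|exact (h1 i hi e)].
Qed.

End Trees.

(** The first unit of [w] is also the first unit of the part containing it. That part puts a
    positive subset of [app A a] into [B], in a column above [b] and so beyond any given [N]. *)
Lemma code_rel_large a B : a ∈ omega -> subset B S ->
  (forall n, n ∈ omega -> exists w b,
     stream w /\ n ∈ b /\ first_unit w a b /\ subset (coded code_rel w) B) ->
  inter B (app A a) ∉ I.
Proof.
  intros ha hB H hin; apply hI in hin; destruct hin as (_ & N & hN & h).
  destruct (H N hN) as (w & b & hw & hNb & hab & hwB).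
  pose proof (proj1 hw) as hu.
  destruct (first_unit_nat w a b hu hab) as (_ & hb & _).
  destruct (label_spec w a ha) as (hi & _); set (i := label w a) in *.
  assert (hab' : first_unit (part w i) a b).
  { split; [apply part_spec; split; [apply hab|reflexivity]|].
    intros x y h'; apply part_spec in h'; apply (proj2 hab x y); tauto. }
  destruct (column_spec a b ha hb) as (hc & hbc & _).
  apply (tailset_positive w i a b hw hi hab').
  apply (Kdown (fibre (inter B (app A a)) (column a b))).
  - apply h; [exact hc|]; intros h'; apply (nat_asym N (column a b) hN); [|exact h'].
    apply (nat_trans (column a b) b N); assumption.
  - intros x hx; pose proof hx as hx'; apply tailset_piece, piece_spec in hx'; try assumption.
    apply fibre_spec; rewrite inter_spec; split; [split; [|tauto]|tauto].
    apply hwB, coded_code_rel; [exact hw|]; exists i, a, b; auto.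
Qed.

Lemma code_rel_codable : exists d, coding d (bigcup (img omega (fun a => app A a))) I /\
  forall a B, a ∈ omega -> subset B S ->
    (forall n, n ∈ omega -> exists w b,
       stream w /\ n ∈ b /\ first_unit w a b /\ subset (coded d w) B) ->
    inter B (app A a) ∉ I.
Proof.
  exists code_rel; split; [|exact code_rel_large].
  split; [exact code_rel_range|split; [exact code_rel_positive|exact code_rel_tree]].
Qed.

End OneChoice.
End OneSequence.

Theorem codable_of_fibres : codable S I.
Proof.
  intros A hA; destruct (piece_codings A hA) as (f & hf).
  exact (code_rel_codable A hA f hf).
Qed.

End FubiniCoding.
End CodingsTheory.
#[global] Opaque coded inter.

(** * Ideals and mad families *)

Ltac dfn_codable := first [dfn_coding | apply D_codable].
Ltac dfn_lemma ::= dfn_codable.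

Section Ideals.
Context {V : set_structure} {hZF : ZF V}.

Lemma is_union2_iff (X A B : V) : is_union2 X A B <-> X = union2 A B.
Proof.
  split; [intros h; apply ext_eq; intros z; rewrite union2_spec; apply h|].
  intros -> z; apply union2_spec.
Qed.

Lemma is_inter2_iff (X A B : V) : is_inter2 X A B <-> X = inter A B.
Proof.
  split; [intros h; apply ext_eq; intros z; rewrite inter_spec; apply h|].
  intros -> z; apply inter_spec.
Qed.

Lemma ideal_on_iff (S I : V) : ideal_on S I <->
  (forall A, A ∈ I -> subset A S) /\ empty ∈ I /\
  (forall A B, A ∈ I -> B ∈ I -> union2 A B ∈ I) /\
  (forall A B, A ∈ I -> subset B A -> B ∈ I).
Proof.
  unfold ideal_on; split; intros (h1 & h2 & h3 & h4); split; try exact h1; split.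
  - destruct h2 as (e & he & h2); apply is_empty_iff in he; subst; exact h2.
  - split; [|exact h4]; intros A B hA hB; destruct (h3 A B hA hB) as (X & hX & h).
    apply is_union2_iff in hX; subst; exact h.
  - exists empty; split; [apply is_empty_iff; reflexivity|exact h2].
  - split; [|exact h4]; intros A B hA hB; exists (union2 A B); split; [|auto].
    apply is_union2_iff; reflexivity.
Qed.

(** The induction hypothesis over the least class. Its first clause yields countability and keeps
    codings within reach of dependent choice. *)
Definition codable_ideal (S I : V) : Prop := subset S HF /\ ideal_on S I /\ codable S I.

(** Applies codability to the constant sequence with value [P]. *)
Lemma codable_coding S I P : codable S I -> subset P S -> P ∉ I -> exists d, coding d P I.
Proof.
  intros h hP hPI; destruct (h (lam omega (fun _ => P))) as (d & hd & _).
  { intros a ha; rewrite app_lam by (dfn || assumption); auto. }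
  exists d; replace P with (bigcup (img omega (fun a => app (lam omega (fun _ => P)) a)));
    [exact hd|].
  apply ext_eq; intros x; rewrite bigcup_spec; split.
  - intros (y & hy & hx); apply img_spec in hy; [|dfn]; destruct hy as (a & ha & ->).
    rewrite app_lam in hx by (dfn || assumption); exact hx.
  - intros hx; exists P; split; [|exact hx]; apply img_spec; [dfn|].
    exists empty; split; [apply nat_0|rewrite app_lam; [reflexivity|dfn|apply nat_0]].
Qed.

Lemma countable_HF S : subset S HF -> countable S.
Proof.
  intros hS; exists omega, (lam S code); split; [exact omega_spec|].
  assert (E : forall x y, pair_in (lam S code) x y <-> x ∈ S /\ y = code x).
  { intros x y; rewrite pair_in_iff, lam_spec by dfn; split.
    - intros (x' & hx & e); apply opair_inj in e; destruct e; subst; auto.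
    - intros (hx & ->); eauto. }
  split; [split|split].
  - intros p hp; apply lam_spec in hp; [|dfn]; destruct hp as (x & hx & ->).
    exists x, (code x); split; [exact hx|apply is_opair_iff; reflexivity].
  - intros x hx; exists (code x); split; [apply E; auto|]; intros y hy.
    apply E in hy; symmetry; tauto.
  - intros x y h; apply E in h; destruct h as (hx & ->); apply code_spec, hS, hx.
  - intros x x' y h h'; apply E in h, h'; destruct h as (hx & e), h' as (hx' & e').
    apply code_inj; auto; congruence.
Qed.

Lemma class_codable : class_of_ideals codable_ideal.
Proof.
  split.
  - assert (h : D 2 (fun e : env 2 => codable_ideal (hd e) (hd (tl e)))).
    { unfold codable_ideal, ideal_on, is_union2; dfn. }
    destruct h as (phi & rho & h); exists phi, rho; intros x y; exact (h (tt, y, x)).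
  - intros S I (h1 & h2 & _); split; [apply countable_HF, h1|exact h2].
Qed.

Lemma full_tree w : stream w ->
  exists T, tree T /\ forall s, s ∈ T -> subset s w.
Proof.
  intros (hu & hf & h).
  assert (TS : forall s, s ∈ sep HF (fun s => stage s /\ subset s w) <->
    stage s /\ subset s w).
  { intros s; rewrite sep_spec by dfn; split; [tauto|]; intros hs; split; [apply hs|exact hs]. }
  exists (sep HF (fun s => stage s /\ subset s w)).
  split; [split|intros s hs; apply TS in hs; tauto].
  - apply TS; split; [apply stage_empty|intros p hp; destruct (empty_spec p hp)].
  - intros s hs; apply TS in hs; destruct hs as (hs & hsw); split; [exact hs|].
    intros n hn; pose proof hs as (_ & _ & _ & M & hM & hb).
    destruct (nat_bound n M hn hM) as (L & hL & h1 & h2).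
    destruct (h L hL) as (a & b & hLa & hab).
    destruct (units_mem w a b hu hab) as (ha & hb' & hlt).
    assert (old : forall a' b', opair a' b' ∈ s -> a' ∈ a).
    { intros x y hxy; destruct (units_mem w x y hu (hsw _ hxy)) as (hx & hy & hl).
      pose proof (hb x y hxy) as hyM; clear - hZF ha hx hy hl hyM hM hL h2 hLa; nord. }
    exists a, b; split; [apply (nat_trans a L n); assumption|split; [exact old|]].
    apply TS; split.
    + apply stage_adj; try assumption; intros x y hxy ->; exact (mem_irrefl a (old a y hxy)).
    + intros p hp; apply adj_spec in hp; destruct hp as [hp| ->]; auto.
Qed.

(** The germ of all codings: the truncation of any stream at zero is empty, so every stream codes
    the whole singleton, and any tree below [w] is a witness. *)
Lemma coding_singleton n K : n ∈ HF -> (forall X, X ∈ K <-> X = empty) ->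
  coding (sing (opair empty n)) (sing n) K.
Proof.
  intros hn hK.
  assert (E : forall w, coded (sing (opair empty n)) w = sing n \/
    coded (sing (opair empty n)) w = empty).
  { intros w; destruct (classic (n ∈ coded (sing (opair empty n)) w)) as [h|h];
      [left|right]; apply ext_eq; intros x.
    - rewrite sing_spec; split; [|intros ->; exact h].
      intros hx; apply coded_spec in hx; destruct hx as (_ & m & _ & hx).
      apply sing_spec, opair_inj in hx; tauto.
    - split; intros hx; [|destruct (empty_spec x hx)]; exfalso; apply h.
      assert (e : x = n).
      { pose proof hx as hx'; apply coded_spec in hx'; destruct hx' as (_ & m & _ & hx').
        apply sing_spec, opair_inj in hx'; tauto. }
      rewrite e in hx; exact hx. }
  split; [|split].
  - intros q hq; apply sing_spec in hq; subst; exists empty, n.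
    split; [apply stage_empty|split; [apply sing_spec; reflexivity|reflexivity]].
  - intros w hw h; apply hK in h; apply (empty_spec n); rewrite <- h; apply coded_spec.
    split; [exact hn|]; exists empty; split; [apply nat_0|rewrite below_0].
    apply sing_spec; reflexivity.
  - intros w Q hw hQ hQK; destruct (full_tree w hw) as (T & hT & hTw).
    exists T; split; [exact hT|split; [exact hTw|]]; intros v _ x hx.
    destruct (E v) as [e|e]; rewrite e in hx; [|destruct (empty_spec x hx)].
    apply sing_spec in hx; subst x; apply NNPP; intros h; apply hQK, hK, ext_eq.
    intros x; split; intros hx; [|destruct (empty_spec x hx)]; exfalso; apply h.
    destruct (E w) as [e'|e']; specialize (hQ x hx); rewrite e' in hQ;
      [|destruct (empty_spec x hQ)].
    apply sing_spec in hQ; subst; exact hx.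
Qed.

Hypothesis hDC : DC_R V.

Lemma Fin_iff I : is_Fin I -> forall x, x ∈ I <->
  subset x omega /\ exists N, N ∈ omega /\ subset x N.
Proof.
  intros hI x; rewrite (hI x).
  assert (so : subset_omega x <-> subset x omega).
  { split; intros h n hn; apply omega_spec, h, hn. }
  rewrite so; split; intros (h & h'); (split; [exact h|]).
  - apply finite_bounded; assumption.
  - destruct h' as (N & hN & h'); exact (bounded_finite x N hN h').
Qed.

(** Fin is the Fubini sum of the ideals on singletons that contain just the empty set. *)
Lemma codable_Fin : contains_Fin codable_ideal.
Proof.
  intros w I hw hI.
  assert (w = omega) as ->.
  { apply ext_eq; intros n; rewrite omega_spec; apply hw. }
  pose proof (Fin_iff I hI) as IS; clear hw hI.
  split; [exact omega_HF|split].
  - apply ideal_on_iff; split; [intros A hA; apply IS in hA; tauto|split; [|split]].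
    + apply IS; split; [intros z hz; destruct (empty_spec z hz)|].
      exists empty; split; [apply nat_0|intros z hz; exact hz].
    + intros A B hA hB; apply IS in hA, hB.
      destruct hA as (hA & N & hN & h1), hB as (hB & M & hM & h2).
      destruct (nat_bound N M hN hM) as (L & hL & g1 & g2); apply IS; split.
      * intros z hz; apply union2_spec in hz; destruct hz; auto.
      * exists L; split; [exact hL|]; intros z hz; apply union2_spec in hz.
        destruct hz as [hz|hz]; [apply (nat_trans L N z)|apply (nat_trans L M z)]; auto.
    + intros A B hA hB; apply IS in hA; destruct hA as (hA & N & hN & h); apply IS.
      split; [intros z hz; auto|exists N; split; [exact hN|intros z hz; auto]].
  - assert (KS : forall X : V, X ∈ sing empty <-> X = empty) by (intros; apply sing_spec).
    apply (codable_of_fibres omega (sing empty) I (fun x => x)).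
    + dfn.
    + exact omega_HF.
    + apply KS; reflexivity.
    + intros X Y hX hY; apply KS in hX; subst; apply KS, is_empty_iff.
      intros z hz; exact (empty_spec z (hY z hz)).
    + intros X Y hX hY; apply KS in hX, hY; subst; apply KS, is_empty_iff.
      intros z hz; apply union2_spec in hz; destruct hz as [hz|hz]; exact (empty_spec z hz).
    + intros X; rewrite IS; split; intros (hX & N & hN & h); (split; [exact hX|]);
        exists N; (split; [exact hN|]).
      * intros n hn hnN; apply KS, is_empty_iff; intros z hz; apply sep_spec in hz; [|dfn].
        destruct hz as (hz & ->); exact (hnN (h n hz)).
      * intros n hn; apply NNPP; intros hnN; specialize (h n (hX n hn) hnN).
        apply KS in h; apply (empty_spec n); rewrite <- h; apply sep_spec; [dfn|auto].
    + intros n P hn hP hPn hPK; exists (sing (opair empty n)).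
      replace P with (sing n); [apply coding_singleton; [apply omega_HF, hn|exact KS]|].
      apply ext_eq; intros x; rewrite sing_spec; split; [intros ->|auto].
      apply NNPP; intros h; apply hPK, KS, is_empty_iff; intros z hz.
      apply h; rewrite <- (hPn z hz); exact hz.
    + exact hDC.
Qed.

Definition first (p : V) : V := the (fun n => exists x, p = opair n x).
Definition section (X n : V) : V := sep HF (fun x => opair n x ∈ X).

Lemma first_opair (n x : V) : first (opair n x) = n.
Proof.
  apply (the_eq (fun m => exists y, opair n x = opair m y)); [|eauto].
  exists n; split; [eauto|]; intros m (y & e); apply opair_inj in e; tauto.
Qed.

Lemma T1_first : T1 first.
Proof. apply (T_the 1 (fun e n => exists x, hd e = opair n x)); dfn. Qed.

Lemma section_spec X n x : x ∈ section X n <-> x ∈ HF /\ opair n x ∈ X.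
Proof. unfold section; rewrite sep_spec by dfn; reflexivity. Qed.

Lemma codable_Fubini_sums : closed_under_Fubini_sums codable_ideal.
Proof.
  intros s i T J hs hi hC (hT & hJ).
  assert (appE : forall f n, function_on is_natural f -> n ∈ omega ->
    forall y, pair_in f n y <-> y = app f n).
  { intros f n (_ & hf) hn; destruct (hf n (proj1 (omega_spec n) hn)) as (z & hz & uz).
    assert (e : app f n = z).
    { apply pair_in_iff in hz; apply app_eq; [|exact hz].
      exists z; split; [exact hz|]; intros z' hz'; apply uz, pair_in_iff, hz'. }
    intros y; rewrite e; split; [intros h; symmetry; apply uz, h|intros ->; exact hz]. }
  assert (hC' : forall n, n ∈ omega -> codable_ideal (app s n) (app i n)).
  { intros n hn; apply (hC n); [apply omega_spec, hn|apply appE|apply appE]; auto. }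
  assert (TS : forall p, p ∈ T <-> exists n x, n ∈ omega /\ x ∈ app s n /\ p = opair n x).
  { intros p; rewrite (hT p); split.
    - intros (n & x & Sn & hn & h1 & h2 & h3); apply omega_spec in hn.
      apply appE in h1; [|exact hs|exact hn]; apply is_opair_iff in h3; subst; eauto.
    - intros (n & x & hn & hx & ->); exists n, x, (app s n).
      split; [apply omega_spec, hn|split; [apply appE; auto|split; [exact hx|]]].
      apply is_opair_iff; reflexivity. }
  assert (THF : subset T HF).
  { intros p hp; apply TS in hp; destruct hp as (n & x & hn & hx & ->).
    apply opair_HF; [apply omega_HF, hn|apply (proj1 (hC' n hn)), hx]. }
  assert (secE : forall X n Y, subset X T -> (is_section Y X n <-> Y = section X n)).
  { intros X n Y hX; split.
    - intros h; apply ext_eq; intros x; rewrite (h x), pair_in_iff, section_spec.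
      split; [|tauto]; intros hx; split; [|exact hx].
      apply hX, TS in hx; destruct hx as (m & y & hm & hy & e); apply opair_inj in e.
      destruct e; subst; apply (proj1 (hC' m hm)), hy.
    - intros -> x; rewrite section_spec, pair_in_iff; split; [tauto|]; intros hx.
      split; [|exact hx].
      apply hX, TS in hx; destruct hx as (m & y & hm & hy & e); apply opair_inj in e.
      destruct e; subst; apply (proj1 (hC' m hm)), hy. }
  (* The finite exceptional set is replaced by a bound [N], the form required by
     [codable_of_fibres]. *)
  assert (JS : forall X, X ∈ J <-> subset X T /\ exists N, N ∈ omega /\
    forall n, n ∈ omega -> n ∉ N -> section X n ∈ app i n).
  { intros X; rewrite (hJ X); split; intros (hX & N & hN & h); (split; [exact hX|]).
    - destruct (finite_bounded N) as (M & hM & hNM);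
        [intros n hn; apply h in hn; apply omega_spec; tauto|exact hN|].
      exists M; split; [exact hM|]; intros n hn hnM; apply NNPP; intros H.
      apply hnM, hNM, h; split; [apply omega_spec, hn|].
      exists (app i n), (section X n); split; [apply appE; auto|].
      split; [apply secE; auto|exact H].
    - assert (S : forall n, n ∈ sep omega (fun n => section X n ∉ app i n) <->
        n ∈ omega /\ section X n ∉ app i n)
        by (intros; rewrite sep_spec by (unfold section; dfn); reflexivity).
      exists (sep omega (fun n => section X n ∉ app i n)); split.
      + apply (bounded_finite _ N hN); intros n hn; apply S in hn; destruct hn as (hn & hn').
        apply NNPP; intros H; apply hn', h; assumption.
      + intros n; rewrite S, omega_spec; split; intros (hn & h'); (split; [exact hn|]);
          apply omega_spec in hn.
        * exists (app i n), (section X n); split; [apply appE; auto|].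
          split; [apply secE; auto|exact h'].
        * destruct h' as (In & Xn & h1 & h2 & h3); apply appE in h1; auto.
          apply secE in h2; [|exact hX]; subst; exact h3. }
  clear hC hT hJ secE appE hs hi.
  assert (id : forall n, n ∈ omega -> empty ∈ app i n /\
    (forall A B, A ∈ app i n -> B ∈ app i n -> union2 A B ∈ app i n) /\
    (forall A B, A ∈ app i n -> subset B A -> B ∈ app i n)).
  { intros n hn; destruct (hC' n hn) as (_ & h & _); apply ideal_on_iff in h; tauto. }
  assert (sec0 : forall n, section empty n = empty).
  { intros n; apply is_empty_iff; intros x hx; apply section_spec in hx.
    exact (empty_spec _ (proj2 hx)). }
  assert (secU : forall X Y n, section (union2 X Y) n = union2 (section X n) (section Y n)).
  { intros X Y n; apply ext_eq; intros x; rewrite union2_spec, !section_spec, union2_spec.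
    tauto. }
  assert (secM : forall X Y n, subset X Y -> subset (section X n) (section Y n)).
  { intros X Y n h x hx; apply section_spec in hx; apply section_spec; split; [tauto|].
    apply h, hx. }
  split; [exact THF|split].
  - apply ideal_on_iff; split; [intros A hA; apply JS in hA; tauto|split; [|split]].
    + apply JS; split; [intros z hz; destruct (empty_spec z hz)|].
      exists empty; split; [apply nat_0|intros n hn _; rewrite sec0; apply id, hn].
    + intros A B hA hB; apply JS in hA, hB.
      destruct hA as (hA & N & hN & h1), hB as (hB & M & hM & h2).
      destruct (nat_bound N M hN hM) as (L & hL & g1 & g2); apply JS; split.
      * intros z hz; apply union2_spec in hz; destruct hz; auto.
      * exists L; split; [exact hL|]; intros n hn hnL; rewrite secU; apply (id n hn).
        -- apply h1; [exact hn|]; intros h; apply hnL, (nat_trans L N n); assumption.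
        -- apply h2; [exact hn|]; intros h; apply hnL, (nat_trans L M n); assumption.
    + intros A B hA hB; apply JS in hA; destruct hA as (hA & N & hN & h); apply JS.
      split; [intros z hz; auto|exists N; split; [exact hN|]]; intros n hn hnN.
      apply (proj2 (proj2 (id n hn)) (section A n)); [auto|apply secM, hB].
  - set (K := sep (power T) (fun X => forall n, n ∈ omega -> section X n ∈ app i n)).
    assert (KS : forall X, X ∈ K <-> subset X T /\
      forall n, n ∈ omega -> section X n ∈ app i n).
    { intros X; unfold K; rewrite sep_spec, power_spec by (unfold section; dfn). reflexivity. }
    clearbody K.
    (* For a set concentrated on column [n], membership in [K] reduces to its section there, the
       other sections being empty. *)
    assert (Kfib : forall X n, n ∈ omega -> subset X T -> (forall p, p ∈ X -> first p = n) ->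
      section X n ∈ app i n -> X ∈ K).
    { intros X n hn hX hf h; apply KS; split; [exact hX|]; intros m hm.
      destruct (classic (m = n)) as [->|e]; [exact h|].
      replace (section X m) with empty; [apply id, hm|symmetry; apply is_empty_iff].
      intros x hx; apply section_spec in hx; apply e; rewrite <- (hf _ (proj2 hx)).
      symmetry; apply first_opair. }
    apply (codable_of_fibres T K J first).
    + exact T1_first.
    + exact THF.
    + apply KS; split; [intros z hz; destruct (empty_spec z hz)|].
      intros n hn; rewrite sec0; apply id, hn.
    + intros X Y hX hY; apply KS in hX; destruct hX as (hX & h); apply KS.
      split; [intros z hz; auto|]; intros n hn.
      apply (proj2 (proj2 (id n hn)) (section X n)); [auto|apply secM, hY].
    + intros X Y hX hY; apply KS in hX, hY; destruct hX as (hX & h), hY as (hY & h').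
      apply KS; split; [intros z hz; apply union2_spec in hz; destruct hz; auto|].
      intros n hn; rewrite secU; apply (id n hn); auto.
    + pose proof T1_first as hf.
      assert (fS : forall X n p, p ∈ sep X (fun x => first x = n) <-> p ∈ X /\ first p = n).
      { intros X n p; generalize dependent first; intros; rewrite sep_spec by dfn; reflexivity. }
      assert (secF : forall X n, section (sep X (fun x => first x = n)) n = section X n).
      { intros X n; apply ext_eq; intros x; rewrite !section_spec, fS, first_opair; tauto. }
      intros X; rewrite JS; split; intros (hX & N & hN & h); (split; [exact hX|]);
        exists N; (split; [exact hN|]); intros n hn hnN; specialize (h n hn hnN).
      * apply (Kfib _ n hn); [| |rewrite secF; exact h].
        -- intros p hp; apply fS in hp; apply hX; tauto.
        -- intros p hp; apply fS in hp; tauto.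
      * apply KS in h; rewrite <- secF; apply h, hn.
    + intros n P hn hP hPn hPK.
      assert (shape : forall Q, subset Q P -> forall p, p ∈ Q ->
        exists x, x ∈ section Q n /\ p = opair n x).
      { intros Q hQ p hp; pose proof (hQ p hp) as hp'.
        pose proof (hP p hp') as h; pose proof (hPn p hp') as h'; apply TS in h.
        destruct h as (m & x & hm & hx & ->); rewrite first_opair in h'; subst m.
        exists x; split; [|reflexivity]; apply section_spec; split; [|exact hp].
        apply (proj1 (hC' n hn)), hx. }
      assert (pos : forall Q, subset Q P -> Q ∉ K -> section Q n ∉ app i n).
      { intros Q hQ hQK h; apply hQK, (Kfib Q n hn); [| |exact h].
        - intros p hp; auto.
        - intros p hp; auto. }
      destruct (codable_coding (app s n) (app i n) (section P n)) as (d & hd1 & hd2 & hd3).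
      * apply (hC' n hn).
      * intros x hx; apply section_spec in hx; destruct hx as (_ & hx).
        apply hP, TS in hx; destruct hx as (m & y & hm & hy & e); apply opair_inj in e.
        destruct e; subst; exact hy.
      * apply pos; [intros z hz; exact hz|exact hPK].
      (* The coding of the section is moved into column [n] by attaching [n] to each point; the
         stages, and thus the trees, stay the same. *)
      * set (d' := sep HF (fun q => exists t x, q = opair t (opair n x) /\ opair t x ∈ d)).
        assert (nHF := omega_HF n hn).
        assert (dS : forall q, q ∈ d' <->
          exists t x, q = opair t (opair n x) /\ opair t x ∈ d).
        { intros q; unfold d'; rewrite sep_spec by dfn; split; [tauto|].
          intros (t & x & -> & h); split; [|eauto].
          destruct (hd1 _ h) as (t' & x' & ht & hx & e); apply opair_inj in e.
          destruct e; subst t' x'; apply section_spec in hx.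
          apply opair_HF; [apply ht|apply opair_HF; tauto]. }
        clearbody d'.
        assert (cS : forall w y, y ∈ coded d' w <-> exists x, x ∈ coded d w /\ y = opair n x).
        { intros w y; rewrite coded_spec; split.
          - intros (hy & m & hm & h); apply dS in h; destruct h as (t & x & e & h).
            apply opair_inj in e; destruct e; subst t y.
            exists x; split; [|reflexivity]; apply coded_spec; split; [|eauto].
            destruct (hd1 _ h) as (t' & x' & ht & hx & e); apply opair_inj in e.
            destruct e; subst t' x'; apply section_spec in hx; tauto.
          - intros (x & hx & ->); apply coded_spec in hx; destruct hx as (hx & m & hm & h).
            split; [apply opair_HF; assumption|]; exists m; split; [exact hm|].
            apply dS; eauto. }
        exists d'; split; [|split].
        -- intros q hq; apply dS in hq; destruct hq as (t & x & -> & h).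
           destruct (hd1 _ h) as (t' & x' & ht & hx & e); apply opair_inj in e.
           destruct e; subst t' x'; apply section_spec in hx.
           exists t, (opair n x); tauto.
        -- intros w hw h; apply KS in h; destruct h as (_ & h); apply (hd2 w hw).
           replace (coded d w) with (section (coded d' w) n); [apply h, hn|].
           apply ext_eq; intros x; rewrite section_spec, cS; split.
           ++ intros (_ & x' & hx & e); apply opair_inj in e; destruct e; subst; exact hx.
           ++ intros hx; split; [apply coded_spec in hx; tauto|eauto].
        -- intros w Q hw hQ hQK.
           assert (hQP : subset Q P).
           { intros p hp; apply hQ, cS in hp; destruct hp as (x & hx & ->).
             apply coded_spec in hx; destruct hx as (_ & m & _ & h).
             destruct (hd1 _ h) as (t' & x' & ht & hx & e); apply opair_inj in e.
             destruct e; subst t' x'; apply section_spec in hx; tauto. }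
           destruct (hd3 w (section Q n) hw) as (U & h1 & h2 & h3).
           ++ intros x hx; apply section_spec in hx; destruct hx as (_ & hx).
              apply hQ, cS in hx; destruct hx as (x' & hx & e); apply opair_inj in e.
              destruct e; subst; exact hx.
           ++ apply pos; assumption.
           ++ exists U; split; [exact h1|split; [exact h2|]]; intros v hv y hy.
              apply cS in hy; destruct hy as (x & hx & ->).
              apply (h3 v hv), section_spec in hx; tauto.
    + exact hDC.
Qed.

(** Minimality of the least class, applied to the definable class of codable ideals, is the
    induction principle. *)
Lemma least_class_codable S I : in_least_class S I -> codable_ideal S I.
Proof.
  intros h; apply h; [apply class_codable|apply codable_Fin|apply codable_Fubini_sums].
Qed.

End Ideals.

(** * Absence of infinite mad families *)

Section NoMadFamilies.
Context {V : set_structure} {hZF : ZF V}.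
Hypothesis hDC : DC_R V.
Hypothesis hR : all_sets_Ramsey V.

(** If the choice got stuck at [n], the values chosen so far would biject [n] with [X]. Elements of
    [X] are subsets of [HF], so [recursive_choice] covers them. *)
Lemma distinct_sequence X : infinite X -> (forall x, x ∈ X -> subset x HF) ->
  exists F, forall n, n ∈ omega -> app F n ∈ X /\ forall m, m ∈ n -> app F m <> app F n.
Proof.
  intros hX hHF.
  destruct (recursive_choice hDC (fun n g y => y ∈ X /\ forall m, m ∈ n -> app g m <> y))
    as (F & hF); [dfn| |].
  - intros n g hn hg.
    enough (h : exists y, y ∈ X /\ forall m, m ∈ n -> app g m <> y).
    { destruct h as (y & hy & h); exists y; split; [auto|split; [exact hy|]].
      intros m hm; rewrite app_lam by (dfn || assumption); auto. }
    apply NNPP; intros H; apply hX; exists n, (lam n (fun x => app g x)).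
    assert (E : forall x y, pair_in (lam n (fun x => app g x)) x y <-> x ∈ n /\ y = app g x).
    { intros x y; rewrite pair_in_iff, lam_spec by dfn; split.
      - intros (x' & hx & e); apply opair_inj in e; destruct e; subst; auto.
      - intros (hx & ->); eauto. }
    assert (ne : forall x y, x ∈ n -> y ∈ n -> x ∈ y -> app g x <> app g y).
    { intros x y hx hy hxy; destruct (hg y hy) as (_ & _ & h); specialize (h x hxy).
      rewrite app_lam in h by (dfn || assumption); exact h. }
    split; [apply omega_spec, hn|split; [split; [split|split]|]].
    + intros p hp; apply lam_spec in hp; [|dfn]; destruct hp as (x & hx & ->).
      exists x, (app g x); split; [exact hx|apply is_opair_iff; reflexivity].
    + intros x hx; exists (app g x); split; [apply E; auto|]; intros y hy.
      apply E in hy; symmetry; tauto.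
    + intros x y h; apply E in h; destruct h as (hx & ->); apply (hg x hx).
    + intros x x' y h h'; apply E in h, h'; destruct h as (hx & e), h' as (hx' & e').
      destruct (nat_total x (nat_mem n x hn hx) x' (nat_mem n x' hn hx')) as [h|[h|h]].
      * destruct (ne x' x hx' hx h); congruence.
      * auto.
      * destruct (ne x x' hx hx' h); congruence.
    + intros y hy; apply NNPP; intros h; apply H; exists y; split; [exact hy|].
      intros m hm e; apply h; exists m; apply E; auto.
  - exists F; intros n hn; destruct (hF n hn) as (_ & h1 & h2); split; [exact h1|].
    intros m hm; specialize (h2 m hm); rewrite app_lam in h2 by (dfn || assumption); exact h2.
Qed.

Lemma entries_subset v H : Inf H -> subset v (pairs H) -> subset (entries v) H.
Proof.
  intros hH hv m hm; apply entries_spec in hm; destruct hm as (_ & a & b & h & e).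
  apply hv, pairs_spec in h; [|exact hH]; destruct h as (ha & hb & _), e; subst; assumption.
Qed.

Lemma branch_comb_subset T T' v w : branch (comb T T') v ->
  (forall s, s ∈ T -> subset s w) -> (forall s, s ∈ T' -> subset s w) -> subset v w.
Proof.
  intros hv hT hT' p hp; destruct (branch_comb T T' v hv) as (h0 & h1).
  destruct (proj1 (proj1 hv) p hp) as (a & b & ha & _ & _ & ->).
  assert (hp' : opair a b ∈ part v (label v a)) by (apply part_spec; auto).
  destruct (label_spec v a ha) as (hl & _).
  destruct (classic (label v a = empty)) as [e|e].
  - rewrite e in hp'; exact (branch_subset T _ w h0 hT _ hp').
  - exact (branch_subset T' _ w (h1 _ hl e) hT' _ hp').
Qed.

Lemma no_mad_of_codable S I : codable_ideal S I ->
  ~ exists X, infinite X /\ mad S I X.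
Proof.
  intros (hS & hid & hcod) (X & hX & (had1 & had2) & hmax).
  apply ideal_on_iff in hid; destruct hid as (I1 & I2 & I3 & I4).
  assert (ad : forall A B, A ∈ X -> B ∈ X -> inter A B ∉ I -> A = B).
  { intros A B hA hB h; apply NNPP; intros ne; destruct (had2 A B hA hB ne) as (Y & hY & hYI).
    apply is_inter2_iff in hY; subst; exact (h hYI). }
  destruct (distinct_sequence X hX) as (F & hF).
  { intros x hx z hz; apply hS, (had1 x hx), hz. }
  destruct (hcod F) as (d & hd & large).
  { intros a ha; apply had1, hF, ha. }
  assert (cS : forall w, subset (coded d w) S).
  { intros w x hx; apply (coded_subset d _ I w hd), bigcup_spec in hx.
    destruct hx as (y & hy & hx); apply img_spec in hy; [|dfn]; destruct hy as (a & ha & ->).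
    apply (had1 (app F a)); [apply hF, ha|exact hx]. }
  destruct hd as (_ & cpos & ctree).
  (* Otherwise the code could be added to the family, so by maximality it is a member; being small
     relative to every member, including itself, it would lie in [I]. *)
  assert (dense : forall w, stream w -> exists B, B ∈ X /\ inter B (coded d w) ∉ I).
  { intros w hw; apply NNPP; intros H.
    assert (small : forall B, B ∈ X -> inter B (coded d w) ∈ I)
      by (intros B hB; apply NNPP; intros h; apply H; eauto).
    assert (hin : coded d w ∈ X).
    { rewrite <- (hmax (adj X (coded d w))); [apply adj_spec; auto| |].
      - split.
        + intros A hA; apply adj_spec in hA; destruct hA as [hA| ->]; auto.
        + intros A B hA hB ne; exists (inter A B); split; [apply is_inter2_iff; reflexivity|].
          apply adj_spec in hA, hB; destruct hA as [hA| ->], hB as [hB| ->].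
          * apply NNPP; intros h; apply ne, ad; assumption.
          * apply small, hA.
          * apply (I4 _ _ (small B hB)); intros z hz; apply inter_spec in hz.
            apply inter_spec; tauto.
          * tauto.
      - intros z hz; apply adj_spec; auto. }
    apply (cpos w hw), (I4 _ _ (small _ hin)); intros z hz; apply inter_spec; auto. }
  assert (uniq : forall w B B', stream w -> B ∈ X -> B' ∈ X -> subset (coded d w) B ->
    subset (coded d w) B' -> B = B').
  { intros w B B' hw hB hB' h h'; apply ad; try assumption; intros hi.
    apply (cpos w hw), (I4 _ _ hi); intros z hz; apply inter_spec; auto. }
  (* Every cube contains a set whose code is contained in a member of the family. *)
  destruct (Ramsey_below hR omega
    (fun z => exists B, B ∈ X /\ subset (coded d (pairs z)) B) Inf_omega ltac:(dfn))
    as (H1 & hH1 & _ & [P1|P1]).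
  (* The negative alternative fails: a block-ordered branch of the tree for a positive intersection
     with [B] gives a set in the cube whose code lies inside [B]. *)
  2:{ destruct (dense (pairs H1) (pairs_stream H1 hH1)) as (B & hB & hBI).
      destruct (ctree (pairs H1) (inter B (coded d (pairs H1))) (pairs_stream H1 hH1))
        as (T & hT & hTw & hTQ); [|exact hBI|].
      { intros z hz; apply inter_spec in hz; tauto. }
      destruct (tree_branch T hT) as (v & hv & hvB).
      apply (P1 (entries v)).
      - apply entries_Inf, hv.
      - apply entries_subset; [exact hH1|exact (branch_subset T v _ hv hTw)].
      - exists B; split; [exact hB|]; rewrite pairs_entries by (apply hv || exact hvB).
        intros z hz; apply (hTQ v hv), inter_spec in hz; tauto. }
  (* Any nonzero label would serve: [comb] treats all of them alike. *)
  set (one := succ empty : V).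
  assert (one_nat : one ∈ omega) by (apply nat_succ, nat_0).
  assert (one_ne : one <> empty).
  { intros e; apply (empty_spec (V := V) empty); rewrite <- e at 2; apply mem_succ. }
  clearbody one.
  destruct (Ramsey_below hR H1 (fun z => exists B, B ∈ X /\
    subset (coded d (part (pairs z) empty)) B /\ subset (coded d (part (pairs z) one)) B)
    hH1 ltac:(dfn)) as (H2 & hH2 & hH21 & [P2|P2]).
  (* Disagreement cannot be homogeneous either: in a branch of [comb T T] both parts follow the tree
     for the same positive intersection with [B]. *)
  2:{ destruct (dense (pairs H2) (pairs_stream H2 hH2)) as (B & hB & hBI).
      destruct (ctree (pairs H2) (inter B (coded d (pairs H2))) (pairs_stream H2 hH2))
        as (T & hT & hTw & hTQ); [|exact hBI|].
      { intros z hz; apply inter_spec in hz; tauto. }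
      destruct (tree_branch _ (tree_comb T T hT hT)) as (v & hv & hvB).
      destruct (branch_comb T T v hv) as (hv0 & hv1); specialize (hv1 one one_nat one_ne).
      apply (P2 (entries v)).
      - apply entries_Inf, hv.
      - apply entries_subset; [exact hH2|exact (branch_comb_subset T T v _ hv hTw hTw)].
      - exists B; split; [exact hB|]; rewrite pairs_entries by (apply hv || exact hvB).
        split; intros z hz; [apply (hTQ _ hv0), inter_spec in hz|apply (hTQ _ hv1), inter_spec in hz];
          tauto. }
  (* Trees for the full codes of [x] and [x'] are combed into one branch [v] inside [H2]. Its parts
     zero and [one] agree by homogeneity, and [uniq] identifies their members with [B] and [B']. *)
  assert (const : forall x x' B B', Inf x -> Inf x' -> subset x H2 -> subset x' H2 ->
    B ∈ X -> B' ∈ X -> subset (coded d (pairs x)) B -> subset (coded d (pairs x')) B' ->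
    B = B').
  { intros x x' B B' hx hx' hxH hxH' hB hB' hxB hxB'.
    destruct (ctree (pairs x) (coded d (pairs x)) (pairs_stream x hx)) as (T & hT & hTw & hTQ);
      [intros z hz; exact hz|apply cpos, pairs_stream, hx|].
    destruct (ctree (pairs x') (coded d (pairs x')) (pairs_stream x' hx'))
      as (T' & hT' & hTw' & hTQ'); [intros z hz; exact hz|apply cpos, pairs_stream, hx'|].
    destruct (tree_branch _ (tree_comb T T' hT hT')) as (v & hv & hvB).
    destruct (branch_comb T T' v hv) as (hv0 & hv1); specialize (hv1 one one_nat one_ne).
    destruct (P2 (entries v)) as (B'' & hB'' & h0 & h1).
    - apply entries_Inf, hv.
    - assert (hvu : subset v (union2 (pairs x) (pairs x'))).
      { apply (branch_comb_subset T T' v _ hv); intros s hs z hz; apply union2_spec;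
          [left; exact (hTw s hs z hz)|right; exact (hTw' s hs z hz)]. }
      intros m hm; apply entries_spec in hm; destruct hm as (_ & a & b & h & e).
      apply hvu, union2_spec in h; destruct h as [h|h]; apply pairs_spec in h; try assumption;
        destruct h as (ha & hb & _), e; subst; auto.
    - rewrite pairs_entries in h0, h1 by (apply hv || exact hvB).
      transitivity B''; [|symmetry].
      + apply (uniq (part v empty)); [apply hv0|exact hB|exact hB''| |exact h0].
        intros z hz; apply hxB, (hTQ _ hv0), hz.
      + apply (uniq (part v one)); [apply hv1|exact hB'|exact hB''| |exact h1].
        intros z hz; apply hxB', (hTQ' _ hv1), hz. }
  destruct (P1 H2 hH2 hH21) as (B & hB & hBc).
  (* Inside [H2] there are streams with first unit (a, b) for arbitrarily large [b], and by [const]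
     all their codes lie in [B]; so [large] makes [B] meet [app F a] positively. *)
  assert (eqB : forall a, a ∈ H2 -> B = app F a).
  { intros a ha; pose proof (Inf_nat H2 a hH2 ha) as ha'; apply ad; [exact hB|apply hF, ha'|].
    apply large; [exact ha'|apply had1, hB|]; intros n hn.
    destruct (pairs_starting_at H2 a n hH2 ha hn) as (z & b & hz & hzH & hnb & hfu).
    exists (pairs z), b; split; [apply pairs_stream, hz|split; [exact hnb|split; [exact hfu|]]].
    destruct (P1 z hz) as (B' & hB' & hB'c); [intros m hm; apply hH21, hzH, hm|].
    rewrite (const H2 z B B'); try assumption; intros m hm; exact hm. }
  destruct (proj2 hH2 empty nat_0) as (a & ha & _).
  pose proof (Inf_nat H2 a hH2 ha) as ha'.
  destruct (proj2 hH2 a ha') as (a' & ha2 & haa).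
  apply (proj2 (hF a' (Inf_nat H2 a' hH2 ha2)) a haa).
  rewrite <- (eqB a ha); apply eqB, ha2.
Qed.

End NoMadFamilies.

Theorem theorem1p2 (V : set_structure) (hZF : ZF V)
    (hDC : DC_R V)
    (hU : Ramsey_positive_uniformisation V)
    (hR : all_sets_Ramsey V) :
  forall S I : V, in_least_class S I ->
    ~ exists A : V, infinite A /\ mad S I A.
Proof.
  intros S I h; apply (no_mad_of_codable hDC hR), (least_class_codable hDC), h.
Qed.
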